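(* Let $X$ be an indecomposable object of $\mathrm{coh}\text{-}\mathbb{X}(p,q)$ which is a line bundle or a torsion sheaf supported at an exceptional point ($\infty$ or $0$), and let $\gamma=\phi^{-1}(X)$. Then the irreducible morphisms in $\mathrm{coh}\text{-}\mathbb{X}(p,q)$ starting at $X$ are obtained by elementary moves on endpoints of $\gamma$ (i.e. they are the morphisms $X\to\phi({}_s\gamma)$ and $X\to\phi(\gamma_e)$ corresponding to the elementary moves $\gamma\mapsto{}_s\gamma$ and $\gamma\mapsto\gamma_e$). Moreover, the Auslander–Reiten sequence starting at $X$ has the form $$0\longrightarrow\phi(\gamma)\longrightarrow\phi({}_s\gamma)\oplus\phi(\gamma_e)\longrightarrow\phi({}_s\gamma_e)\longrightarrow0.$$
   Context: Sheaves. Let $\mathbf{k}$ be an algebraically closed field and $1\le p\le q$ integers. $\mathbb{L}(p,q)$ is the abelian group on generators $\vec{x}_1,\vec{x}_2$ with relation $p\vec{x}_1=q\vec{x}_2=:\vec{c}$. $S=\mathbf{k}[x_1,x_2]$ is $\mathbb{L}(p,q)$-graded with $\deg x_i=\vec{x}_i$. $\mathrm{coh}\text{-}\mathbb{X}(p,q)$ is the quotient of the category of finitely generated $\mathbb{L}(p,q)$-graded $S$-modules by the Serre subcategory of finite dimensional modules; $\mathcal{O}$ is the image of $S$, and $\mathcal{O}(\vec{x})$ its grading shifts. The indecomposable vector bundles are the line bundles $\mathcal{O}(\vec{x})$; the indecomposable torsion sheaves supported at $\infty$, resp. $0$, are the uniserial sheaves $S_{\infty,i}^{(j)}$ ($i\in\mathbb{Z}/p$),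 resp. $S_{0,i}^{(j)}$ ($i\in\mathbb{Z}/q$), of length $j\ge1$ with top $S_{\infty,i}=\mathrm{coker}(x_1:\mathcal{O}((i-1)\vec{x}_1)\to\mathcal{O}(i\vec{x}_1))$, resp. $S_{0,i}=\mathrm{coker}(x_2:\mathcal{O}((i-1)\vec{x}_2)\to\mathcal{O}(i\vec{x}_2))$. Curves. Let $\mathbb{U}=\mathbb{R}\times[0,1]$ and $\pi:\mathbb{U}\to A_{p,q}$ the quotient by $(x,y)\sim(x+1,y)$, where $y=1$ covers the inner boundary $\partial$ and $y=0$ the outer boundary $\partial'$. For $i,j\in\mathbb{Z}$ let $[D^{i/p}_{j/q}]$ be the homotopy class of the image in $A_{p,q}$ of the oriented arc in $\mathbb{U}$ from $(\tfrac{j}{q},0)$ to $(\tfrac{i}{p},1)$ (positive bridging curve), and for $j-i\ge2$ let $[D^{i/p,j/p}]$, $[D_{i/q,j/q}]$ be those of the arcs from $(\tfrac{i}{p},1)$ to $(\tfrac{j}{p},1)$ and from $(\tfrac{i}{q},0)$ to $(\tfrac{j}{q},0)$ (peripheral curves). The bijection $\phi$: $[D^{i/p}_{j/q}]\mapsto\mathcal{O}(i\vec{x}_1-j\vec{x}_2)$, $[D^{(i-j-1)/p,\,i/p}]\mapsto S_{\infty,i}^{(j)}$, $[D_{-i/q,\,(j-i+1)/q}]\mapsto S_{0,i}^{(j)}$ ($j\geq 1$ in the last two). Elementary moves. ${}_s\gamma$ (resp. $\gamma_e$) is obtained from $\gamma$ by moving its starting point (resp. ending point) to the adjacent marked point on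 the same boundary, rotating clockwise around the other endpoint; ${}_s\gamma_e={}_s(\gamma_e)=({}_s\gamma)_e$. Explicitly: - $\gamma=[D^{j/p}_{i/q}]$: ${}_s\gamma=[D^{j/p}_{(i-1)/q}]$, $\gamma_e=[D^{(j+1)/p}_{i/q}]$, ${}_s\gamma_e=[D^{(j+1)/p}_{(i-1)/q}]$; - $\gamma=[D^{i/p,j/p}]$: ${}_s\gamma=[D^{(i+1)/p,j/p}]$ (for $j-i>2$), $\gamma_e=[D^{i/p,(j+1)/p}]$, ${}_s\gamma_e=[D^{(i+1)/p,(j+1)/p}]$; - $\gamma=[D_{i/q,j/q}]$: ${}_s\gamma=[D_{(i-1)/q,j/q}]$, $\gamma_e=[D_{i/q,(j-1)/q}]$ (for $j-i>2$), ${}_s\gamma_e=[D_{(i-1)/q,(j-1)/q}]$. When a move of a peripheral curve is not defined (case $j-i=2$), the corresponding term $\phi({}_s\gamma)$ or $\phi(\gamma_e)$ is $0$ and there is no corresponding irreducible morphism. *)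

(* Defs.v *)
From HB Require Import structures.
(* mpoly must be imported before the analysis files: the reverse order makes
   their notations clash. *)
From mathcomp Require Import all_boot all_order all_algebra ring_quotient.
From mathcomp Require Import mpoly.
From mathcomp Require Import boolp classical_sets set_interval reals topology.

Set Implicit Arguments.
Unset Strict Implicit.
Unset Printing Implicit Defensive.

Import Order.TTheory GRing.Theory Num.Theory numFieldTopology.Exports.
Local Open Scope ring_scope.
Local Open Scope quotient_scope.

(* L(p,q) = Z^2 / Z(p,-q) *)
Definition Lrel (p q : nat) : {pred int * int} :=
  fun u => `[< exists t : int, u = (t * p%:Z, - (t * q%:Z)) >].

Lemma Lrel_zmod p q : zmod_closed (Lrel p q).
Proof.
split=> [|u v]; first by apply/asboolP; exists 0; rewrite !mul0r oppr0.
move=> /asboolP [s ->] /asboolP [t ->]; apply/asboolP; exists (s - t).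
by rewrite !mulrBl opprB; congr pair; rewrite /= opprK addrC.
Qed.

HB.instance Definition _ p q :=
  GRing.isZmodClosed.Build (int * int)%type (Lrel p q) (Lrel_zmod p q).

Definition L (p q : nat) : zmodType := Quotient.quot (Lrel p q).

(* xvec ord0 and xvec ord_max are the generators x_1 and x_2. *)
Definition xvec (p q : nat) (v : 'I_2) : L p q :=
  \pi_(Quotient.quot (Lrel p q)) (if v == ord0 then (1, 0) else (0, 1)).

Section Ring.
Variables (k : closedFieldType) (p q : nat).
Local Notation S := {mpoly k[2]}.
Implicit Types (f g : S) (c : k) (d e : L p q).

Definition degL (m : 'X_{1..2}) : L p q := \sum_(v < 2) xvec p q v *+ m v.

Definition homogen (d : L p q) (f : S) : Prop :=
  forall m, m \in msupp f -> degL m = d.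

Definition hcomp (d : L p q) (f : S) : S :=
  \sum_(m <- msupp f | degL m == d) f@_m *: 'X_[m].

Lemma degLD m n : degL (m + n)%MM = degL m + degL n.
Proof.
by rewrite /degL -big_split; apply: eq_bigr => v _; rewrite mnmDE mulrnDr.
Qed.

Lemma degL_U v : degL U_(v)%MM = xvec p q v.
Proof.
rewrite /degL (bigD1 v) //= mnm1E eqxx mulr1n big1 ?addr0 // => w wv.
by rewrite mnm1E eq_sym (negPf wv) mulr0n.
Qed.

Lemma mcoeff_big (I : Type) (r : seq I) (P : pred I) (F : I -> S) m :
  (\sum_(i <- r | P i) F i)@_m = \sum_(i <- r | P i) (F i)@_m.
Proof. by rewrite raddf_sum. Qed.

Lemma mcoeff_hcomp d f m :
  (hcomp d f)@_m = if degL m == d then f@_m else 0.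
Proof.
rewrite /hcomp mcoeff_big big_mkcond /=.
rewrite (eq_bigr (fun n => if degL m == d then (f@_n *: 'X_[n] : S)@_m else 0)).
  case: eqP => _; last by rewrite big1.
  by rewrite -mcoeff_big -mpolyE.
move=> n _; rewrite !mcoeffZ mcoeffX.
case: (eqVneq n m) => [->|_] /=; first by [].
by rewrite mulr0; do 2!case: ifP.
Qed.

Lemma hcompD d f g : hcomp d (f + g) = hcomp d f + hcomp d g.
Proof.
apply/mpolyP => m; rewrite mcoeffD !mcoeff_hcomp mcoeffD.
by case: ifP => // _; rewrite addr0.
Qed.

Lemma hcompZ d c f : hcomp d (c *: f) = c *: hcomp d f.
Proof.
apply/mpolyP => m; rewrite mcoeffZ !mcoeff_hcomp mcoeffZ.
by case: ifP => // _; rewrite mulr0.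
Qed.

Lemma hcomp0 d : hcomp d 0 = 0.
Proof. by apply/mpolyP => m; rewrite mcoeff_hcomp mcoeff0 if_same. Qed.

Lemma hcomp_sum d (I : Type) (r : seq I) (F : I -> S) :
  hcomp d (\sum_(i <- r) F i) = \sum_(i <- r) hcomp d (F i).
Proof. exact: (big_morph (hcomp d) (hcompD d) (hcomp0 d)). Qed.

Lemma hcompX d m : hcomp d 'X_[m] = if degL m == d then 'X_[m] else 0.
Proof.
apply/mpolyP => n; rewrite mcoeff_hcomp mcoeffX.
case: (eqVneq m n) => [->|mn] /=.
  by case: ifP => _; rewrite ?mcoeff0 // mcoeffX eqxx.
by case: ifP => _; case: ifP => _; rewrite ?mcoeff0 // mcoeffX (negPf mn).
Qed.

Lemma hcomp_mulX d m g :
  hcomp (d + degL m) ('X_[m] * g) = 'X_[m] * hcomp d g.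
Proof.
rewrite {1}[g]mpolyE mulr_sumr hcomp_sum [in RHS]/hcomp mulr_sumr [RHS]big_mkcond /=.
apply: eq_bigr => n _.
rewrite -scalerAr (hcompZ _ g@_n) -mpolyXD hcompX degLD addrC.
rewrite (inj_eq (addIr (degL m))).
by case: ifP => _; rewrite ?scaler0 // -scalerAr -mpolyXD.
Qed.

Lemma hcomp_mul d e f g :
  homogen e f -> hcomp (d + e) (f * g) = f * hcomp d g.
Proof.
move=> hf; rewrite [f]mpolyE !mulr_suml hcomp_sum.
rewrite big_seq [RHS]big_seq; apply: eq_bigr => m /hf me.
by rewrite -!scalerAl (hcompZ _ f@_m) -me hcomp_mulX.
Qed.

Lemma hcomp_hcomp d e f :
  hcomp d (hcomp e f) = if d == e then hcomp e f else 0.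
Proof.
apply/mpolyP => m; rewrite !mcoeff_hcomp; case: (eqVneq d e) => [->|de].
  by rewrite mcoeff_hcomp; case: (degL m == e).
case: ifP => [/eqP md|_]; rewrite ?mcoeff0 //.
by rewrite md (negPf de).
Qed.

Lemma hcomp_decomp f (s : seq (L p q)) :
  uniq s -> {subset [seq degL m | m <- msupp f] <= s} ->
  f = \sum_(x <- s) hcomp x f.
Proof.
move=> us sub; apply/mpolyP => m; rewrite mcoeff_big.
under eq_bigr do rewrite mcoeff_hcomp.
case: (boolP (m \in msupp f)) => mf; last first.
  by rewrite big1 ?(memN_msupp_eq0 mf) // => x _; rewrite if_same.
rewrite (bigD1_seq (degL m)) ?us //=; last by apply/sub/map_f.
by rewrite eqxx big1 ?addr0 // => x; rewrite eq_sym => /negPf ->.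
Qed.

(* A finitely generated graded S-module. The direct sum decomposition
   M = (+)_x M_x is given by the projections gpr x : M -> M_x, so that
   M_x = [set m | gpr x m = m]. *)
Record grmod := GrMod {
  grcar :> lmodType S;
  gpr : L p q -> grcar -> grcar;
  gprD : forall x m n, gpr x (m + n) = gpr x m + gpr x n;
  gprZ : forall x e (f : S) m, homogen e f -> gpr (x + e) (f *: m) = f *: gpr x m;
  gprK : forall x y m, gpr x (gpr y m) = if x == y then gpr y m else 0;
  gpr_sum : forall m, exists2 s : seq (L p q), uniq s & m = \sum_(x <- s) gpr x m;
  gr_fg : exists s : seq grcar, forall m, exists c : nat -> S,
    m = \sum_(i < size s) c i *: s`_i
}.

(* fin_mod A B : the subspace A is finite dimensional over k modulo B. *)
Definition fin_mod (M : lmodType S) (A B : set M) : Prop :=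
  exists s : seq M, forall m, A m -> exists c : nat -> k,
    B (m - \sum_(i < size s) (c i)%:MP *: s`_i).

Definition fin_dim (M : lmodType S) (A : set M) := fin_mod A [set 0].
Definition cofinite (M : lmodType S) (A : set M) := fin_mod setT A.

Record graded_submod (M : grmod) (A : set M) : Prop := GradedSubmod {
  gsub0 : A 0;
  gsubD : forall m n, A m -> A n -> A (m + n);
  gsubZ : forall (f : S) m, A m -> A (f *: m);
  gsub_gpr : forall x m, A m -> A (gpr x m)
}.

Lemma gpr0 (M : grmod) x : gpr x (0 : M) = 0.
Proof. by apply: (addrI (gpr x (0 : M))); rewrite -gprD !addr0. Qed.

Lemma gpr_sum_big (M : grmod) x (I : Type) (r : seq I) (F : I -> M) :
  gpr x (\sum_(i <- r) F i) = \sum_(i <- r) gpr x (F i).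
Proof. exact: (big_morph (gpr x) (@gprD M x) (gpr0 M x)). Qed.

Lemma gpr_sum_ext (M : grmod) (m : M) (s : seq (L p q)) :
  uniq s -> m = \sum_(x <- s) gpr x m ->
  forall t, uniq t -> {subset s <= t} -> m = \sum_(x <- t) gpr x m.
Proof.
move=> us em t ut st.
have out x : x \notin s -> gpr x m = 0.
  move=> xs; rewrite em gpr_sum_big big_seq big1 // => y ys.
  by rewrite gprK; case: eqP => // xy; rewrite xy ys in xs.
rewrite (bigID (mem s)) /= [X in _ + X]big1 ?addr0; last by move=> x /out.
rewrite -big_filter {1}em; apply: perm_big; apply: uniq_perm => //.
  exact: filter_uniq.
by move=> x; rewrite mem_filter; case: (boolP (x \in s)) => //= /st.
Qed.

(* Line bundles: O(x) = S(x), with S(x)_y = S_(x+y). *)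
Lemma Oline_sum (x : L p q) (f : S^o) :
  exists2 s : seq (L p q), uniq s & f = \sum_(y <- s) hcomp (x + y) f.
Proof.
exists (undup [seq degL m - x | m <- msupp f]); first exact: undup_uniq.
rewrite -(big_map (fun y => x + y) xpredT (fun y => hcomp y f)) /=.
apply: hcomp_decomp.
  by rewrite map_inj_uniq ?undup_uniq //; apply: addrI.
move=> _ /mapP [m mf ->]; apply/mapP; exists (degL m - x).
  by rewrite mem_undup; apply/mapP; exists m.
by rewrite addrC subrK.
Qed.

Lemma Oline_fg : exists s : seq S^o, forall m, exists c : nat -> S,
  m = \sum_(i < size s) c i *: s`_i.
Proof.
by exists [:: 1] => f; exists (fun=> f); rewrite big_ord1 /= [RHS]mulr1.
Qed.

Definition Oline (x : L p q) : grmod.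
Proof.
refine (@GrMod S^o (fun y f => hcomp (x + y) f) _ _ _ (Oline_sum x) Oline_fg).
- by move=> y f g; apply: hcompD.
- by move=> y e f g hf; rewrite addrA; apply: hcomp_mul.
- by move=> y z f; rewrite hcomp_hcomp (inj_eq (addrI x)).
Defined.

Section DirectSum.
Variables M N : grmod.

Lemma dsum_sum (m : M * N) : exists2 s : seq (L p q), uniq s &
  m = \sum_(x <- s) (gpr x m.1, gpr x m.2).
Proof.
case: m => m n; have [s us em] := gpr_sum m; have [t ut en] := gpr_sum n.
exists (undup (s ++ t)); first exact: undup_uniq.
have E (F : L p q -> M) (G : L p q -> N) (r : seq (L p q)) :
  \sum_(x <- r) (F x, G x) = (\sum_(x <- r) F x, \sum_(x <- r) G x).
  elim: r => [|a r IH]; first by rewrite !big_nil.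
  by rewrite !big_cons IH.
rewrite E; congr pair.
- apply: (gpr_sum_ext us em) => [|x xs]; first exact: undup_uniq.
  by rewrite mem_undup mem_cat xs.
- apply: (gpr_sum_ext ut en) => [|x xs]; first exact: undup_uniq.
  by rewrite mem_undup mem_cat xs orbT.
Qed.

Lemma dsum_fg : exists s : seq (M * N), forall m, exists c : nat -> S,
  m = \sum_(i < size s) c i *: s`_i.
Proof.
have [s hs] := gr_fg M; have [t ht] := gr_fg N.
exists ([seq (a, 0) | a <- s] ++ [seq (0, b) | b <- t]) => -[m n].
have [c em] := hs m; have [d en] := ht n.
exists (fun i => if (i < size s)%N then c i else d (i - size s)%N).
rewrite size_cat !size_map big_split_ord /=.
have fstE (r : seq M) (e : nat -> S) l : (l <= size r)%N ->
  \sum_(i < l) e i *: [seq (a, 0 : N) | a <- r]`_i = (\sum_(i < l) e i *: r`_i, 0).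
  elim: l => [|l IH] lr; first by rewrite !big_ord0.
  rewrite !big_ord_recr /= IH ?(ltnW lr) // (nth_map 0) //.
  by congr pair; rewrite /= scaler0 addr0.
have sndE (r : seq N) (e : nat -> S) l : (l <= size r)%N ->
  \sum_(i < l) e i *: [seq (0 : M, a) | a <- r]`_i = (0, \sum_(i < l) e i *: r`_i).
  elim: l => [|l IH] lr; first by rewrite !big_ord0.
  rewrite !big_ord_recr /= IH ?(ltnW lr) // (nth_map 0) //.
  by congr pair; rewrite /= scaler0 addr0.
under eq_bigr => i _ do rewrite nth_cat size_map ltn_ord.
under [X in _ + X]eq_bigr => i _ do
  rewrite nth_cat size_map ltnNge leq_addr /= addKn.
rewrite fstE // sndE //= {1}em {1}en.
by congr pair; rewrite /= ?addr0 ?add0r.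
Qed.

Definition dsum : grmod.
Proof.
refine (@GrMod (M * N)%type (fun x m => (gpr x m.1, gpr x m.2)) _ _ _
          dsum_sum dsum_fg).
- by move=> x m n; rewrite !gprD.
- by move=> x e f m hf; rewrite !gprZ.
- by move=> x y m; rewrite !gprK; case: eqP.
Defined.

End DirectSum.

(* coh-X(p,q) has the finitely generated graded modules as objects. A morphism
   M -> N of this Serre quotient is represented by a homomorphism
   f : M' -> N / N'' of graded modules, where M / M' and N'' are finite
   dimensional. It is encoded by its graph {(m,n) | m \in M', n \in f(m)}, a
   graded submodule of M (+) N with domain M' and fibre N'' over 0; every graded
   submodule with M / M' and N'' finite dimensional arises in this way from
   exactly one f. *)
Record coh_hom (M N : grmod) := CohHom {
  graph : set (M * N);
  graph_sub : @graded_submod (dsum M N) graph;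
  graph_dom : cofinite [set m : M | exists n : N, graph (m, n)];
  graph_ker : fin_dim [set n : N | graph (0, n)]
}.

(* Equality in colim Hom(M', N / N''): f and g agree in some Hom(M0, N / N0). *)
Definition coh_eq (M N : grmod) (f g : coh_hom M N) : Prop :=
  exists (M0 : set M) (N0 : set N),
    [/\ graded_submod M0 /\ cofinite M0, graded_submod N0 /\ fin_dim N0 &
        forall m n n', M0 m -> graph f (m, n) -> graph g (m, n') -> N0 (n - n')].

Section FiniteDimension.
Variable M : lmodType S.
Implicit Types (A B W : set M) (s t : seq M).

Record ksub A : Prop := KSub {
  ksub0 : A 0;
  ksubD : forall m n, A m -> A n -> A (m + n);
  ksubZ : forall (c : k) m, A m -> A (c%:MP *: m)
}.

Lemma ksubN A m : ksub A -> A m -> A (- m).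
Proof.
move=> hA Am; have -> : - m = (-1 : k)%:MP *: m; last exact: ksubZ.
by rewrite mpolyCN scaleN1r.
Qed.

Fixpoint spn B s (m : M) : Prop :=
  if s is a :: s' then exists c : k, spn B s' (m - c%:MP *: a) else B m.

Lemma spnP B s m : spn B s m <->
  exists c : nat -> k, B (m - \sum_(i < size s) (c i)%:MP *: s`_i).
Proof.
elim: s m => [|a s IH] m /=.
  split=> [Bm|[c]]; first by exists (fun=> 0); rewrite big_ord0 subr0.
  by rewrite big_ord0 subr0.
split=> [[c /IH [d h]]|[c h]].
  exists (fun i => if i is j.+1 then d j else c).
  by rewrite big_ord_recl /= opprD addrA.
exists (c 0%N); apply/IH; exists (fun i => c i.+1).
by move: h; rewrite big_ord_recl /= opprD addrA.
Qed.

Lemma fin_modP A B :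
  fin_mod A B <-> exists s, forall m, A m -> spn B s m.
Proof.
by split=> -[s h]; exists s => m /h; rewrite spnP.
Qed.

Lemma spn_sub B B' s : (forall m, B m -> B' m) -> forall m, spn B s m -> spn B' s m.
Proof.
by move=> h; elim: s => [//|a s IH] m /= [c /IH]; exists c.
Qed.

Lemma spn_cat B s t m : spn B (s ++ t) m <-> spn (spn B t) s m.
Proof.
by elim: s m => [//|a s IH] m /=; split=> -[c /IH h]; exists c.
Qed.

Lemma spn_ksub B s : ksub B -> ksub (spn B s).
Proof.
move=> hB; elim: s => [//|a s IH]; split.
- by exists 0; rewrite mpolyC0 scale0r subr0; apply: ksub0 IH.
- move=> m n [c hc] [d hd]; exists (c + d).
  rewrite mpolyCD scalerDl opprD addrACA; exact: ksubD IH _ _ hc hd.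
- move=> e m [c hc]; exists (e * c).
  by rewrite mpolyCM -scalerA -scalerBr; apply: (ksubZ IH).
Qed.

Lemma spn_choose B W t : ksub B -> ksub W -> (forall w, W w -> spn B t w) ->
  exists2 ws, (forall w, w \in ws -> W w) & forall w, W w -> spn B ws w.
Proof.
move=> hB; elim: t W => [|a t IH] W hW hs; first by exists [::].
have hT := spn_ksub t hB.
have hW' : ksub (fun w => W w /\ spn B t w).
  split; first by split; [apply: ksub0 hW | apply: ksub0 hT].
    by move=> m n [? ?] [? ?]; split; [apply: (ksubD hW) | apply: (ksubD hT)].
  by move=> c m [? ?]; split; [apply: (ksubZ hW) | apply: (ksubZ hT)].
have [ws wsW hws] := IH _ hW' (fun w h => proj2 h).
have [[w0 [Ww0 nw0]]|none] := pselect (exists w0, W w0 /\ ~ spn B t w0); last first.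
  exists ws => [w /wsW []//|w Ww]; apply: hws; split => //.
  by apply: contrapT => nw; apply: none; exists w.
exists (w0 :: ws) => [w|w Ww].
  by rewrite inE => /orP [/eqP ->|/wsW []].
have [c0 h0] := hs _ Ww0; have [c h] := hs _ Ww.
have c00 : c0 != 0.
  apply/eqP => c00; apply: nw0.
  by move: h0; rewrite c00 mpolyC0 scale0r subr0.
exists (c / c0); apply: hws; split.
  by apply: (ksubD hW) => //; apply: (ksubN hW); apply: (ksubZ hW).
have -> : w - (c / c0)%:MP *: w0 =
    (w - c%:MP *: a) - (c / c0)%:MP *: (w0 - c0%:MP *: a).
  rewrite scalerBr scalerA -mpolyCM mulfVK // opprB addrA.
  by rewrite subrK.
by apply: (ksubD hT) => //; apply: (ksubN hT); apply: (ksubZ hT).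
Qed.

End FiniteDimension.

Lemma graded_ksub (M : grmod) (A : set M) : graded_submod A -> ksub A.
Proof. by case=> *; split; auto. Qed.

Section Composition.
Variables (M N P : grmod) (g : coh_hom N P) (f : coh_hom M N).

Definition comp_graph : set (M * P) :=
  [set u | exists n : N, graph f (u.1, n) /\ graph g (n, u.2)].

Lemma comp_graph_sub : @graded_submod (dsum M P) comp_graph.
Proof.
have [F0 FD FZ FP] := graph_sub f; have [G0 GD GZ GP] := graph_sub g; split.
- by exists 0.
- move=> [m1 l1] [m2 l2] [n1 [f1 g1]] [n2 [f2 g2]]; exists (n1 + n2).
  by split; [apply: (FD (m1, n1) (m2, n2)) | apply: (GD (n1, l1) (n2, l2))].
- move=> a [m l] [n [fn gn]]; exists (a *: n).
  by split; [apply: (FZ a (m, n)) | apply: (GZ a (n, l))].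
- move=> x [m l] [n [fn gn]]; exists (gpr x n).
  by split; [apply: (FP x (m, n)) | apply: (GP x (n, l))].
Qed.

Lemma lift_seq (X Y : lmodType S) (T : set (X * Y)) (s : seq X) :
  (forall a, a \in s -> exists b, T (a, b)) ->
  exists2 t : seq Y, size t = size s &
    forall i, (i < size s)%N -> T (s`_i, t`_i).
Proof.
elim: s => [|a s IH] h; first by exists [::].
have [b hb] := h a (mem_head _ _).
have [|t st ht] := IH; first by move=> c cs; apply: h; rewrite inE cs orbT.
by exists (b :: t) => [|[|i]] /=; rewrite ?st //; apply: ht.
Qed.

Lemma spn_lift (X Y : lmodType S) (T : set (X * Y)) (B : set X) (s : seq X)
    (t : seq Y) : ksub T -> size t = size s ->
  (forall i, (i < size s)%N -> T (s`_i, t`_i)) ->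
  forall a b, T (a, b) -> spn B s a ->
  spn [set b' | exists2 a', B a' & T (a', b')] t b.
Proof.
move=> hT; elim: s t => [|x s IH] [|y t] //= st hst a b Tab.
  by move=> Ba; exists a.
move=> [c hc]; exists c; apply: (IH t _ _ (a - c%:MP *: x)) => //.
- by case: st.
- by move=> i; apply: (hst i.+1).
- have /(ksubZ hT c)/(ksubN hT) := hst 0%N isT.
  exact: (ksubD hT Tab).
Qed.

Lemma comp_dom : cofinite [set m : M | exists n : P, comp_graph (m, n)].
Proof.
have /fin_modP [s hs] := graph_dom f; have /fin_modP [t ht] := graph_dom g.
have hF := graded_ksub (graph_sub f); have hG := graded_ksub (graph_sub g).
pose B : set N := [set n : N | exists l : P, graph g (n, l)]%classic.
pose W : set N := [set n : N | exists m : M, graph f (m, n)]%classic.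
have hB : ksub B.
  split; first by exists 0; apply: (ksub0 hG).
    move=> m n [a ha] [b hb]; exists (a + b); exact: (ksubD hG ha hb).
  by move=> c m [a ha]; exists (c%:MP *: a); apply: (ksubZ hG c ha).
have hW : ksub W.
  split; first by exists 0; apply: (ksub0 hF).
    move=> m n [a ha] [b hb]; exists (a + b); exact: (ksubD hF ha hb).
  by move=> c m [a ha]; exists (c%:MP *: a); apply: (ksubZ hF c ha).
have [|ws wsW hws] := spn_choose (t := t) hB hW; first by move=> w _; apply: ht.
pose T : set (N * M) := [set u | graph f (u.2, u.1)]%classic.
have hT : ksub T.
  split; first exact: (ksub0 hF).
    by move=> [m n] [m' n'] h h'; apply: (ksubD hF h h').
  by move=> c [m n] h; apply: (ksubZ hF c h).
have [ms sms hms] := lift_seq (T := T) wsW.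
apply/fin_modP; exists (s ++ ms) => m _; apply/spn_cat.
apply: spn_sub (hs m I) => {}m [n fmn].
have Wn : W n by exists m.
have := spn_lift hT sms hms fmn (hws _ Wn).
by apply: spn_sub => m' [n' [l gl] fn']; exists l, n'.
Qed.

Lemma comp_ker : fin_dim [set n : P | comp_graph (0, n)].
Proof.
have /fin_modP [s hs] := graph_ker f; have /fin_modP [t ht] := graph_ker g.
have hF := graded_ksub (graph_sub f); have hG := graded_ksub (graph_sub g).
pose W : set N := [set n : N | graph f (0, n) /\ exists l : P, graph g (n, l)]%classic.
have h0 : ksub ([set 0] : set N).
  by split=> // [m n -> ->|c m ->]; rewrite ?addr0 ?scaler0.
have hW : ksub W.
  split; first by split; [apply: (ksub0 hF) | exists 0; apply: (ksub0 hG)].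
    move=> m n [h [a ha]] [h' [b hb]]; split; last first.
      by exists (a + b); apply: (ksubD hG ha hb).
    have -> : (0, m + n) = (0 : M, m) + (0 : M, n) by congr pair; rewrite addr0.
    exact: (ksubD hF h h').
  move=> c m [h [a ha]]; split; last first.
    by exists (c%:MP *: a); apply: (ksubZ hG c ha).
  have -> : (0, c%:MP *: m) = c%:MP *: (0 : M, m) by congr pair; rewrite scaler0.
  exact: (ksubZ hF c h).
have [|ws wsW hws] := spn_choose (t := s) h0 hW; first by move=> w [/hs].
have [|ls sls hls] := lift_seq (T := graph g) (s := ws).
  by move=> w /wsW [].
apply/fin_modP; exists (ls ++ t) => l [n [/= fn gn]]; apply/spn_cat.
have Wn : W n by split=> //; exists l.
have := spn_lift hG sls hls gn (hws _ Wn).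
by apply: spn_sub => l' [n' -> h]; apply: ht.
Qed.

Definition coh_comp : coh_hom M P :=
  CohHom comp_graph_sub comp_dom comp_ker.

End Composition.

Lemma fin_dim0 (M : lmodType S) (A : set M) : (forall m, A m -> m = 0) -> fin_dim A.
Proof. by move=> h; apply/fin_modP; exists [::] => m /h ->; apply: erefl. Qed.

Lemma cofiniteT (M : lmodType S) (A : set M) : (forall m, A m) -> cofinite A.
Proof. by move=> h; apply/fin_modP; exists [::] => m _; apply: h. Qed.

Definition coh_id (M : grmod) : coh_hom M M.
Proof.
refine (@CohHom M M [set u | u.1 = u.2]%classic _ _ _).
- split=> [|[a b] [c d] /= -> ->|f [a b] /= ->|x [a b] /= ->]; exact: erefl.
- by apply: cofiniteT => m; exists m.
- exact: fin_dim0.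
Defined.

Definition coh_zero (M N : grmod) : coh_hom M N.
Proof.
refine (@CohHom M N [set u | u.2 = 0]%classic _ _ _).
- split=> [//|[a b] [c d] /= -> ->|f [a b] /= ->|x [a b] /= ->].
  + exact: addr0.
  + exact: scaler0.
  + exact: gpr0.
- by apply: cofiniteT => m; exists 0.
- exact: fin_dim0.
Defined.

(* x_v : O((i-1)x_v) -> O(i x_v) *)
Definition coh_mulX (v : 'I_2) (i : int) :
  coh_hom (Oline (xvec p q v *~ (i - 1))) (Oline (xvec p q v *~ i)).
Proof.
refine (@CohHom (Oline _) (Oline _) [set u | u.2 = 'X_v * u.1 :> S]%classic _ _ _).
- split=> [|[a b] [c d] /= -> ->|f [a b] /= ->|x [a b] /= ->].
  + by rewrite /= mulr0.
  + by rewrite mulrDr.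
  + by rewrite [LHS]mulrCA.
  + rewrite (_ : xvec p q v *~ i + x = xvec p q v *~ (i - 1) + x + xvec p q v).
      apply: hcomp_mul => m; rewrite msuppX inE => /eqP ->; exact: degL_U.
    by rewrite mulrzBr mulr1z addrAC subrK.
- by apply: cofiniteT => m; exists ('X_v * m).
- by apply: fin_dim0 => m /= ->; rewrite mulr0.
Defined.

Local Notation "f =c g" := (coh_eq f g) (at level 70).
Local Notation "g \c f" := (coh_comp g f) (at level 50).

Definition is_zero (X : grmod) : Prop := coh_id X =c coh_zero X X.

Definition is_iso (X Y : grmod) (f : coh_hom X Y) : Prop :=
  exists g : coh_hom Y X, g \c f =c coh_id X /\ f \c g =c coh_id Y.

Definition iso (X Y : grmod) : Prop := exists f : coh_hom X Y, is_iso f.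

Definition mono (X Y : grmod) (f : coh_hom X Y) : Prop :=
  forall (W : grmod) (a b : coh_hom W X), f \c a =c f \c b -> a =c b.

Definition is_kernel (X Y Z : grmod) (f : coh_hom X Y) (g : coh_hom Y Z) : Prop :=
  g \c f =c coh_zero X Z /\
  forall (W : grmod) (h : coh_hom W Y), g \c h =c coh_zero W Z ->
  exists2 a : coh_hom W X, f \c a =c h &
    forall b : coh_hom W X, f \c b =c h -> b =c a.

Definition is_cokernel (X Y Z : grmod) (f : coh_hom X Y) (g : coh_hom Y Z) : Prop :=
  g \c f =c coh_zero X Z /\
  forall (W : grmod) (h : coh_hom Y W), h \c f =c coh_zero X W ->
  exists2 a : coh_hom Z W, a \c g =c h &
    forall b : coh_hom Z W, b \c g =c h -> b =c a.

Definition short_exact (X Y Z : grmod) (f : coh_hom X Y) (g : coh_hom Y Z) : Prop :=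
  is_kernel f g /\ is_cokernel f g.

Definition split_mono (X Y : grmod) (f : coh_hom X Y) : Prop :=
  exists r : coh_hom Y X, r \c f =c coh_id X.

Definition split_epi (X Y : grmod) (f : coh_hom X Y) : Prop :=
  exists s : coh_hom Y X, f \c s =c coh_id Y.

Definition indecomposable (X : grmod) : Prop :=
  ~ is_zero X /\
  forall A B : grmod, iso X (dsum A B) -> is_zero A \/ is_zero B.

Definition irreducible_morphism (X Y : grmod) (f : coh_hom X Y) : Prop :=
  [/\ ~ split_mono f, ~ split_epi f &
      forall (Z : grmod) (h : coh_hom X Z) (g : coh_hom Z Y),
        f =c g \c h -> split_mono h \/ split_epi g].

(* Auslander-Reiten (almost split) sequence 0 -> X -f-> Y -g-> Z -> 0 *)
Definition AR_sequence (X Y Z : grmod) (f : coh_hom X Y) (g : coh_hom Y Z) : Prop :=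
  [/\ short_exact f g,
      ~ split_mono f /\
        (forall (W : grmod) (h : coh_hom X W), ~ split_mono h ->
          exists a : coh_hom Y W, h =c a \c f) &
      ~ split_epi g /\
        (forall (W : grmod) (h : coh_hom W Z), ~ split_epi h ->
          exists a : coh_hom W Y, h =c g \c a)].

Definition simple (X : grmod) : Prop :=
  ~ is_zero X /\
  forall (A : grmod) (u : coh_hom A X), mono u -> is_zero A \/ is_iso u.

Definition sub_le (X A B : grmod) (u : coh_hom A X) (v : coh_hom B X) : Prop :=
  exists w : coh_hom A B, u =c v \c w.

Definition uniserial (X : grmod) : Prop :=
  forall (A B : grmod) (u : coh_hom A X) (v : coh_hom B X),
    mono u -> mono v -> sub_le u v \/ sub_le v u.

Fixpoint has_length (X : grmod) (n : nat) : Prop :=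
  if n is n'.+1 then
    exists (A T : grmod) (u : coh_hom A X) (c : coh_hom X T),
      [/\ short_exact u c, simple T & has_length A n']
  else is_zero X.

Definition maximal_sub (X A : grmod) (u : coh_hom A X) : Prop :=
  [/\ mono u, ~ is_iso u &
      forall (B : grmod) (v : coh_hom B X), mono v -> sub_le u v ->
        sub_le v u \/ is_iso v].

(* The radical is the intersection of the maximal subobjects, i.e. their
   greatest lower bound. *)
Definition is_radical (X A : grmod) (r : coh_hom A X) : Prop :=
  [/\ mono r,
      forall (B : grmod) (v : coh_hom B X), maximal_sub v -> sub_le r v &
      forall (B : grmod) (u : coh_hom B X), mono u ->
        (forall (C : grmod) (v : coh_hom C X), maximal_sub v -> sub_le u v) ->
        sub_le u r].

Definition is_top (X T : grmod) : Prop :=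
  exists (A : grmod) (r : coh_hom A X) (c : coh_hom X T),
    is_radical r /\ is_cokernel r c.

Definition line_bundle (X : grmod) : Prop := exists x, iso X (Oline x).

(* The point infinity is x_1 = 0 (v = ord0), the point 0 is x_2 = 0
   (v = ord_max). A sheaf is torsion with support in this point iff a power of
   x_v vanishes on it in the quotient category. *)
Definition torsion_at (v : 'I_2) (X : grmod) : Prop :=
  exists n : nat, fin_dim [set m : X | exists m' : X, m = 'X_v ^+ n *: m'].

(* T is S_(infinity,i), resp. S_(0,i) *)
Definition is_simple_at (v : 'I_2) (i : int) (T : grmod) : Prop :=
  exists c : coh_hom (Oline (xvec p q v *~ i)) T, is_cokernel (coh_mulX v i) c.

(* X is S_(infinity,i)^(j), resp. S_(0,i)^(j) *)
Definition is_uniserial_at (v : 'I_2) (i : int) (j : nat) (X : grmod) : Prop :=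
  [/\ uniserial X, has_length X j &
      exists2 T : grmod, is_simple_at v i T & is_top X T].

End Ring.

Section Curves.
Variable R : realType.
Local Notation I := (set_type (`[(0 : R), 1]%classic)).

Lemma unit0_subproof : (0 : R) \in `[(0 : R), 1]%classic.
Proof. by rewrite mem_setE in_itv /= lexx ler01. Qed.
Lemma unit1_subproof : (1 : R) \in `[(0 : R), 1]%classic.
Proof. by rewrite mem_setE in_itv /= lexx ler01. Qed.

Definition unit0 : I := SigSub unit0_subproof.
Definition unit1 : I := SigSub unit1_subproof.

(* The universal cover U = R x [0,1] of the annulus, with y = 1 over the inner
   boundary and y = 0 over the outer one *)
Definition strip : topologicalType := (R * I)%type.

Definition deck (u v : strip) : bool :=
  `[< exists n : int, v = (u.1 + n%:~R, u.2) >].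

Lemma deck_equiv : equiv_class_of deck.
Proof.
split=> [[x y]|[x y] [x' y']|[x y] [x' y'] [x'' y'']].
- by apply/asboolP; exists 0; rewrite addr0.
- by apply/asboolP/asboolP => -[n [-> ->]]; exists (- n);
    rewrite /= mulrNz addrK.
- move=> /asboolP [m [-> ->]] /asboolP [n [-> ->]].
  by apply/asboolP; exists (m + n); rewrite /= intrD addrA.
Qed.

Canonical deck_equiv_rel := EquivRelPack deck_equiv.

Definition annulus : topologicalType := quotient_topology {eq_quot deck}.

Definition to_annulus (u : strip) : annulus :=
  \pi_(quotient_topology {eq_quot deck}) u.

Definition homotopic (f g : I -> annulus) : Prop :=
  exists H : I * I -> annulus,
    [/\ continuous H,
        forall s, H (s, unit0) = f s,
        forall s, H (s, unit1) = g s &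
        forall t, H (unit0, t) = f unit0 /\ H (unit1, t) = f unit1].

(* A curve is a homotopy class of oriented paths in the annulus. *)
Definition curve := set (I -> annulus).

(* the class of the image of an arc of the strip from a to b *)
Definition arc_class (a b : strip) : curve :=
  [set g | exists c : I -> strip,
     [/\ continuous c, c unit0 = a, c unit1 = b & homotopic (to_annulus \o c) g]]%classic.

End Curves.

Inductive arc :=
  | Bridging of int & int   (* Bridging i j = D^{i/p}_{j/q} *)
  | PeriphIn of int & int   (* PeriphIn i j = D^{i/p,j/p} *)
  | PeriphOut of int & int. (* PeriphOut i j = D_{i/q,j/q} *)

Definition wf_arc (a : arc) : Prop :=
  match a with
  | Bridging _ _ => True
  | PeriphIn i j | PeriphOut i j => 2 <= j - i
  end.

Definition arc_curve (R : realType) (p q : nat) (a : arc) : curve R :=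
  let inner (i : int) : strip R := (i%:~R / p%:R, unit1 R) in
  let outer (i : int) : strip R := (i%:~R / q%:R, unit0 R) in
  match a with
  | Bridging i j => arc_class (outer j) (inner i)
  | PeriphIn i j => arc_class (inner i) (inner j)
  | PeriphOut i j => arc_class (outer i) (outer j)
  end.

(* arc_s a, arc_e a are None when the move is not defined. *)
Definition arc_s (a : arc) : option arc :=
  match a with
  | Bridging j i => Some (Bridging j (i - 1))
  | PeriphIn i j => if 2 < j - i then Some (PeriphIn (i + 1) j) else None
  | PeriphOut i j => Some (PeriphOut (i - 1) j)
  end.

Definition arc_e (a : arc) : option arc :=
  match a with
  | Bridging j i => Some (Bridging (j + 1) i)
  | PeriphIn i j => Some (PeriphIn i (j + 1))
  | PeriphOut i j => if 2 < j - i then Some (PeriphOut i (j - 1)) else None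
  end.

Definition arc_se (a : arc) : arc :=
  match a with
  | Bridging j i => Bridging (j + 1) (i - 1)
  | PeriphIn i j => PeriphIn (i + 1) (j + 1)
  | PeriphOut i j => PeriphOut (i - 1) (j - 1)
  end.

Section Moves.
Variables (R : realType) (p q : nat).
Local Notation cls := (@arc_curve R p q).

Definition s_move (gamma : curve R) (gamma' : option (curve R)) : Prop :=
  exists a, [/\ wf_arc a, gamma = cls a & gamma' = omap cls (arc_s a)].

Definition e_move (gamma : curve R) (gamma' : option (curve R)) : Prop :=
  exists a, [/\ wf_arc a, gamma = cls a & gamma' = omap cls (arc_e a)].

Definition se_move (gamma gamma' : curve R) : Prop :=
  exists a, [/\ wf_arc a, gamma = cls a & gamma' = cls (arc_se a)].

(* phi gamma X : the sheaf X is (isomorphic to) phi(gamma). *)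
Inductive phi (k : closedFieldType) : curve R -> grmod k p q -> Prop :=
  | phi_bridging (i j : int) (X : grmod k p q) :
      iso X (Oline k (xvec p q ord0 *~ i - xvec p q ord_max *~ j)) ->
      phi (cls (Bridging i j)) X
  | phi_inner (i : int) (j : nat) (X : grmod k p q) :
      (1 <= j)%N -> is_uniserial_at ord0 i j X ->
      phi (cls (PeriphIn (i - j%:Z - 1) i)) X
  | phi_outer (i : int) (j : nat) (X : grmod k p q) :
      (1 <= j)%N -> is_uniserial_at ord_max i j X ->
      phi (cls (PeriphOut (- i) (j%:Z - i + 1))) X.

(* phi of the result of a move, which is 0 when the move is not defined *)
Definition phi_opt (k : closedFieldType) (gamma : option (curve R))
    (X : grmod k p q) : Prop :=
  if gamma is Some gamma' then phi gamma' X else is_zero X.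

End Moves.

(* Main.v *)
(* A subquotient of a finitely generated graded module is finite dimensional iff
   all its elements are killed by large powers of x_1 and x_2. Hence a morphism of
   coh-X out of O(y) is known from the images of x_1^t and x_2^t for large t, one
   out of U_{i,j} = O(i x_v) / x_v^j from the image of a large power of the other
   variable.
   With v, w the two indices, the Auslander-Reiten sequences are the explicit
     0 -> O(y) -> O(y + x_w) (+) O(y + x_v) -> O(y + x_v + x_w) -> 0,
     0 -> U_{i,j} -> U_{i,j-1} (+) U_{i+1,j+1} -> U_{i+1,j} -> 0.
   To see that the first map f is left almost split, take h : X -> W. Either h
   visibly factors through f, or the generator of the socle of local cohomology
   survives in W, and then Zorn's lemma yields a functional on W that is 1 on it.
   By local duality this functional is a morphism W -> X, which splits h. Since the
   end terms have local endomorphism rings, the sequence is also right almost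
   split, and the irreducible morphisms starting at X are exactly those to the two
   middle summands.
   Finally a uniserial torsion sheaf with top S_{.,i} is isomorphic to some U_{i,t}:
   a generator of the top lifts to a monomorphism U_{i,t} -> X which is not
   contained in the radical, hence by uniseriality an isomorphism. *)

(* The left half is attacked directly because a morphism out of X is given by explicit elements of
   W: a pair of them for a line bundle, one for [U_{i,j}]. The whole obstruction to factoring h
   through f is the image in W of the socle generator, seen in the colimit of W / (X_v^N, X_w^N),
   resp. of W / X_v^j along multiplication by X_w. If it vanishes at some stage, the relation that
   witnesses this also writes down the factorisation. If it never vanishes, the separating
   functional must become a morphism W -> X; this works because each degree of L(p,q) contains only
   finitely many monomials, so that values of the functional are coefficients of polynomials. The
   socle generator of the local cohomology of S is 1 / (X_v X_w), of degree -(x_v + x_w), and this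
   is the shift between the two ends of the sequence. Morphisms are handled as relations: a lift or
   an inverse is a composite of relations, and every condition is only tested after multiplication
   by large powers of both variables. *)
From mathcomp Require Import zify ring.
From HB Require Import structures.
From mathcomp Require Import all_boot all_order all_algebra.
From mathcomp Require Import mpoly.
From mathcomp Require Import boolp classical_sets functions reals.
Require Import Defs.

Set Implicit Arguments.
Unset Strict Implicit.
Unset Printing Implicit Defensive.

Import Order.TTheory GRing.Theory Num.Theory.
Local Open Scope ring_scope.
Local Open Scope quotient_scope.

(** * Noetherianity *)

(** Each line [a y = n] needs only one further element, one with [b] least on it: it lies below all
    the others of that line. *)
Lemma dickson_bounded (T : eqType) (a b : T -> nat) (P : T -> Prop) n :
  exists2 l : seq T, (forall x, x \in l -> P x) &
    forall y, P y -> (a y < n)%N ->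
      exists2 x, x \in l & (a x <= a y)%N && (b x <= b y)%N.
Proof.
elim: n => [|n [l lP lmin]]; first by exists [::].
have [ex|nex] := pselect (exists y, P y /\ a y = n); last first.
  exists l => // y Py; rewrite ltnS leq_eqVlt => /predU1P[an|/lmin]; last exact.
  by case: nex; exists y.
have exb : exists m, `[< exists y, [/\ P y, a y = n & b y = m] >].
  by have [y [Py an]] := ex; exists (b y); apply/asboolP; exists y.
case: (ex_minnP exb) => m /asboolP[y0 [Py0 an0 bm0]] mmin.
exists (y0 :: l) => [x|y Py].
  by rewrite inE => /predU1P[->|/lP].
rewrite ltnS leq_eqVlt => /predU1P[an|/(lmin _ Py)[x xl le]]; last first.
  by exists x; rewrite ?inE ?xl ?orbT.
exists y0; first by rewrite inE eqxx.
by rewrite an0 an leqnn bm0 mmin //; apply/asboolP; exists y.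
Qed.

(** Dickson's lemma in the plane. Outside the quadrant above a chosen [x0] one of the two
    coordinates is bounded, and both strips are covered by the bounded case. *)
Lemma dickson (T : eqType) (a b : T -> nat) (P : T -> Prop) :
  exists2 l : seq T, (forall x, x \in l -> P x) &
    forall y, P y -> exists2 x, x \in l & (a x <= a y)%N && (b x <= b y)%N.
Proof.
have [[x0 Px0]|nex] := pselect (exists x, P x); last first.
  by exists [::] => // y Py; case: nex; exists y.
have [l1 P1 min1] := dickson_bounded a b P (a x0).
have [l2 P2 min2] := dickson_bounded b a P (b x0).
exists (x0 :: l1 ++ l2) => [x|y Py].
  by rewrite inE mem_cat => /predU1P[->//|/orP[/P1|/P2]].
have [/(min1 _ Py)[x xl le]|ax] := ltnP (a y) (a x0).
  by exists x; rewrite ?inE ?mem_cat ?xl ?orbT.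
have [/(min2 _ Py)[x xl le]|bx] := ltnP (b y) (b x0).
  by exists x; rewrite 1?andbC // ?inE ?mem_cat ?xl ?orbT.
by exists x0; rewrite ?inE ?eqxx ?ax ?bx.
Qed.

Section Noetherian.
Variable k : closedFieldType.
Local Notation S := {mpoly k[2]}.

Record submod (M : lmodType S) (A : M -> Prop) : Prop := Submod {
  sub0 : A 0;
  subD : forall m n, A m -> A n -> A (m + n);
  subZ : forall (f : S) m, A m -> A (f *: m)
}.

Lemma subN (M : lmodType S) (A : M -> Prop) : submod A -> forall m, A m -> A (- m).
Proof. by move=> hA m Am; rewrite -scaleN1r; apply: (subZ hA). Qed.

Lemma subB (M : lmodType S) (A : M -> Prop) :
  submod A -> forall m n, A m -> A n -> A (m - n).
Proof. by move=> hA m n Am An; apply: (subD hA) => //; apply: (subN hA). Qed.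

Lemma sub_sum (M : lmodType S) (A : M -> Prop) (I : Type) (r : seq I) (P : pred I)
    (F : I -> M) :
  submod A -> (forall i, P i -> A (F i)) -> A (\sum_(i <- r | P i) F i).
Proof. by move=> hA hF; apply: big_ind => //; [apply: sub0 hA | apply: subD hA]. Qed.

Fixpoint sspan (M : lmodType S) (B : M -> Prop) (s : seq M) (m : M) : Prop :=
  if s is a :: s' then exists c : S, sspan B s' (m - c *: a) else B m.

Section Span.
Variable M : lmodType S.
Implicit Types (A B : M -> Prop) (s t : seq M).

Lemma sspanP B s m : sspan B s m <->
  exists c : nat -> S, B (m - \sum_(i < size s) c i *: s`_i).
Proof.
elim: s m => [|a s IH] m /=.
  split=> [Bm|[c]]; first by exists (fun=> 0); rewrite big_ord0 subr0.
  by rewrite big_ord0 subr0.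
split=> [[c /IH [d h]]|[c h]].
  exists (fun i => if i is j.+1 then d j else c).
  by rewrite big_ord_recl /= opprD addrA.
exists (c 0%N); apply/IH; exists (fun i => c i.+1).
by move: h; rewrite big_ord_recl /= opprD addrA.
Qed.

Lemma sspan_cat B s t m : sspan B (s ++ t) m <-> sspan (sspan B t) s m.
Proof.
by elim: s m => [//|a s IH] m /=; split=> -[c /IH h]; exists c.
Qed.

Lemma sspan_submod B s : submod B -> submod (sspan B s).
Proof.
move=> hB; elim: s => [//|a s IH]; split.
- by exists 0; rewrite scale0r subr0; apply: sub0 IH.
- move=> m n [c hc] [d hd]; exists (c + d).
  rewrite scalerDl opprD addrACA; exact: subD IH _ _ hc hd.
- move=> e m [c hc]; exists (e * c).
  by rewrite -scalerA -scalerBr; apply: (subZ IH).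
Qed.

Lemma submod0 : submod (fun m : M => m = 0).
Proof. by split=> // [m n -> ->|f m ->]; rewrite ?addr0 ?scaler0. Qed.

Lemma sspan_base B s m : submod B -> B m -> sspan B s m.
Proof.
by move=> hB Bm; elim: s => [//|a s IH]; exists 0; rewrite scale0r subr0.
Qed.

Lemma sspan_mem B s m : submod B -> m \in s -> sspan B s m.
Proof.
move=> hB; elim: s => [//|a s IH]; rewrite inE => /predU1P[->|/IH hm] /=.
  by exists 1; rewrite scale1r subrr; apply: sspan_base => //; apply: sub0 hB.
by exists 0; rewrite scale0r subr0.
Qed.

End Span.

(** Hilbert's basis theorem by division: by Dickson, finitely many members of I have leading
    monomials dividing all others, and subtracting a multiple of one of them lowers the leading
    monomial. *)
Lemma ideal_fg (I : S^o -> Prop) : submod I ->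
  exists2 s : seq S^o, (forall f, f \in s -> I f) &
    forall f, I f -> sspan (fun m : S^o => m = 0) s f.
Proof.
move=> hI.
have [l lI lmin] := dickson (fun f : S => mlead f ord0)
  (fun f : S => mlead f ord_max) (fun f : S => I f /\ f != 0).
exists l => [f /lI[]//|]; elim/mleadrect => f IH If.
have hs := @sspan_submod S^o _ l (submod0 S^o).
have [->|f0] := eqVneq f 0; first exact: sub0 hs.
have [g gl /andP[le0 le1]] := lmin f (conj If f0).
have [Ig g0] := lI _ gl.
have le : (mlead g <= mlead f)%MM.
  apply/mnm_lepP => i; case: i => -[|[|//]] i2.
    by rewrite (_ : Ordinal i2 = ord0) //; apply/val_inj.
  by rewrite (_ : Ordinal i2 = ord_max) //; apply/val_inj.
pose h : S := (mleadc f / mleadc g) *: 'X_[mlead f - mlead g].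
have c0 : mleadc f / mleadc g != 0.
  by rewrite mulf_neq0 ?invr_eq0 ?mleadc_eq0.
have h0 : h != 0 by rewrite -mleadc_eq0 mleadcZE mulf_neq0 // mleadXm mcoeffX eqxx oner_neq0.
have lh : mlead (h * g) = mlead f.
  by rewrite mleadM // mleadZ // mleadXm submK.
have ch : mleadc (h * g) = mleadc f.
  by rewrite mleadM // mleadcM mleadcZE mleadXm mcoeffX eqxx mulr1 mulfVK ?mleadc_eq0.
have hg : sspan (fun m : S^o => m = 0) l (h *: (g : S^o)).
  by apply: (subZ hs); apply: (sspan_mem (M := S^o)) gl; apply: submod0.
rewrite -[f](subrK (h * g)); apply: (subD hs) => //.
have [->|d0] := eqVneq (f - h * g) 0; first exact: sub0 hs.
apply: IH; last by apply: (subB hI) => //; apply: (subZ hI h).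
rewrite lt_neqAle; apply/andP; split; last first.
  by apply: le_trans (mleadB_le _ _) _; rewrite lh joinxx.
apply/eqP => e; move: d0; rewrite -mleadc_eq0 e mcoeffB -{2}lh ch subrr.
by rewrite eqxx.
Qed.

(** Induction on the generators of M. The coefficients at [a] of elements of A form an ideal; lifts
    [ms] of its generators reduce A to its part in the span of the remaining generators. *)
Lemma submodule_fg (M : lmodType S) (s : seq M) (A : M -> Prop) : submod A ->
  (forall m, A m -> sspan (fun m => m = 0) s m) ->
  exists2 t : seq M, (forall m, m \in t -> A m) &
    forall m, A m -> sspan (fun m => m = 0) t m.
Proof.
elim: s A => [|a s IH] A hA As; first by exists [::].
have h0 := submod0 M; have hs := sspan_submod s h0.
have [|fs fsI Ifs] := @ideal_fg (fun f => exists2 m, A m & sspan (fun m => m = 0) s (m - f *: a)).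
  split.
  - by exists 0; [apply: sub0 hA | rewrite scale0r subr0; apply: sub0 hs].
  - move=> f g [m Am hm] [n An hn]; exists (m + n); first exact: subD hA _ _ Am An.
    by rewrite scalerDl opprD addrACA; apply: (subD hs).
  - move=> e f [m Am hm]; exists (e *: m); first exact: subZ hA _ _ Am.
    by rewrite -scalerA -scalerBr; apply: (subZ hs).
have [||t tA At] := IH (fun m => A m /\ sspan (fun m => m = 0) s m).
- split=> //.
  + by split; [apply: sub0 hA | apply: sub0 hs].
  + by move=> m n [? ?] [? ?]; split; [apply: (subD hA) | apply: (subD hs)].
  + by move=> f m [? ?]; split; [apply: (subZ hA) | apply: (subZ hs)].
- by move=> m [].
have [f /fsI[m Am hm]|ms msfs msh] := @lift_seq k S^o M
  [set u | A u.2 /\ sspan (fun m => m = 0) s (u.2 - (u.1 : S) *: a)]%classic fs.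
  by exists m.
exists (ms ++ t) => [m|m Am].
  rewrite mem_cat => /orP[/(nthP 0)[i ims <-]|/tA[]//].
  by rewrite msfs in ims; have [] := msh i ims.
have [f hf] := As _ Am.
have /Ifs/sspanP[c /subr0_eq hc] : exists2 m, A m & sspan (fun m => m = 0) s (m - f *: a).
  by exists m.
apply/sspan_cat/sspanP; exists c; apply: At; split.
  apply: (subB hA) => //; apply: sub_sum => // i _; apply: (subZ hA).
  by have [] := msh i; rewrite -?msfs.
have -> : m - \sum_(i < size ms) c i *: ms`_i =
    (m - f *: a) - \sum_(i < size ms) c i *: (ms`_i - fs`_i *: a).
  under [X in _ = _ - X]eq_bigr do rewrite scalerBr scalerA.
  rewrite sumrB -scaler_suml opprB addrA; congr (_ - _).
  by rewrite msfs -[X in _ + X *: a]hc subrK.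
apply: (subB hs) => //; apply: sub_sum => // i _; apply: (subZ hs).
by have [] := msh i; rewrite -?msfs.
Qed.

End Noetherian.

(** * Coefficients and degrees *)

Section Degrees.
Variables (k : closedFieldType) (p q : nat).
Hypotheses (p0 : (0 < p)%N) (q0 : (0 < q)%N).
Local Notation S := {mpoly k[2]}.
Local Notation x_ := (xvec p q).

Lemma xvec_rel (a b : int) : x_ ord0 *~ a + x_ ord_max *~ b = 0 ->
  exists t : int, a = t * p%:Z /\ b = - (t * q%:Z).
Proof.
rewrite /xvec /= -!raddfMz -raddfD => /eqP; rewrite -(raddf0 \pi_(L p q)).
rewrite -Quotient.idealrBE subr0 => /asboolP[t].
rewrite [LHS]surjective_pairing /= => -[].
rewrite -[X in _ + X = _ -> _]/(fst ((0, 1) *~ b)) -[X in X + _]/(fst ((1, 0) *~ a)).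
rewrite -[X in _ -> _ + X = _ -> _]/(snd ((0, 1) *~ b)) -[X in _ -> X + _ = _ -> _]/(snd ((1, 0) *~ a)).
rewrite !raddfMz /= !mul0rz addr0 add0r !intz => -> ->; by exists t.
Qed.

Variables (v w : 'I_2).
Hypothesis vw : v != w.

Lemma ord2E (i : 'I_2) : i = v \/ i = w.
Proof.
move: vw; case: (i =P v) => [->|/eqP]; first by left.
case: i v w => -[|[|//]] hi [] -[|[|//]] hv [] -[|[|//]] hw // *;
 by right; apply/val_inj.
Qed.

(** Hides which of the two variables is x_1: all that matters later is that the coefficients of a
    relation have opposite signs. *)
Lemma xvec_rel_pos (a b : int) : x_ v *~ a + x_ w *~ b = 0 ->
  exists P Q : nat, [/\ (0 < P)%N, (0 < Q)%N &
    exists t : int, a = t * P%:Z /\ b = - (t * Q%:Z)].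
Proof.
have [[-> ->]|[-> ->]] : (v = ord0 /\ w = ord_max) \/ (v = ord_max /\ w = ord0).
- move: vw; case: v w => -[|[|//]] hv [] -[|[|//]] hw // _;
   by [left; split; apply/val_inj|right; split; apply/val_inj].
- by move=> /xvec_rel h; exists p, q.
- rewrite addrC => /xvec_rel[t [-> ->]]; exists q, p; split=> //.
  by exists (- t); rewrite !mulNr opprK.
Qed.

Lemma xvec_indep (a b : int) : x_ v *~ a + x_ w *~ b = 0 ->
  0 <= a -> 0 <= b -> a = 0 /\ b = 0.
Proof. by move=> /xvec_rel_pos[P [Q [P0 Q0 [t [-> ->]]]]] *; split; nia. Qed.

Lemma xvec_free (a : int) : x_ v *~ a = 0 -> a = 0.
Proof.
move=> e; have := @xvec_rel_pos a 0; rewrite mulr0z addr0 => /(_ e).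
by move=> [P [Q [P0 Q0 [t [-> h]]]]]; nia.
Qed.

Lemma xvec_inj : injective (intmul (x_ v)).
Proof.
by move=> a b e; apply/eqP; rewrite -subr_eq0; apply/eqP/xvec_free;
  rewrite mulrzBr e subrr.
Qed.

(** Finitely many monomials per degree, which makes the power series of local duality polynomials.
    Two solutions differ by t(P,-Q); nonnegativity of a and b gives -a0 <= t <= b0, whence the
    bound. *)
Lemma xvec_bound d : exists B : nat, forall a b : nat,
  x_ v *+ a + x_ w *+ b = d -> (a < B)%N && (b < B)%N.
Proof.
have [[a0 [b0 <-]]|nex] := pselect (exists a0 b0 : nat, x_ v *+ a0 + x_ w *+ b0 = d); last first.
  by exists 0%N => a b e; case: nex; exists a, b.
exists (a0 + b0 + (p + q) * (a0 + b0)).+1 => a b /eqP.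
rewrite !pmulrn -subr_eq0 opprD addrACA -!mulrzBr => /eqP e.
have [P [Q [P0 Q0 [PQ [t [h1 h2]]]]]] : exists P Q : nat, [/\ (0 < P)%N, (0 < Q)%N &
  (P + Q = p + q)%N /\ exists t : int, a%:Z - a0%:Z = t * P%:Z /\ b%:Z - b0%:Z = - (t * Q%:Z)].
  have [[e1 e2]|[e1 e2]] : (v = ord0 /\ w = ord_max) \/ (v = ord_max /\ w = ord0).
  - move: vw; case: v w => -[|[|//]] hv [] -[|[|//]] hw // _;
     by [left; split; apply/val_inj|right; split; apply/val_inj].
  - by move: e; rewrite e1 e2 => /xvec_rel[t ht]; exists p, q; split=> //; split=> //; exists t.
  - move: e; rewrite e1 e2 addrC => /xvec_rel[t [-> ->]]; exists q, p; split=> //.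
    by split; [rewrite addnC | exists (- t); rewrite !mulNr opprK].
have t1 : t <= b0%:Z by nia.
have t2 : - t <= a0%:Z by nia.
have t3 : t * P%:Z <= b0%:Z * P%:Z by rewrite ler_wpM2r.
have t4 : - t * Q%:Z <= a0%:Z * Q%:Z by rewrite ler_wpM2r.
rewrite -PQ mulnDl !mulnDr; apply/andP; split; lia.
Qed.

Lemma xvec_bound1 d : exists B : nat, forall n : int, x_ v *~ n = d -> (`|n| < B)%N.
Proof.
have [[n0 <-]|nex] := pselect (exists n0, x_ v *~ n0 = d); last first.
  by exists 0%N => n e; case: nex; exists n.
by exists `|n0|.+1 => n /xvec_inj ->.
Qed.

Definition mon (a b : nat) : 'X_{1..2} := (U_(v) *+ a + U_(w) *+ b)%MM.

Lemma mon_v a b : mon a b v = a.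
Proof. by rewrite /mon mnmDE !mulmnE !mnm1E eqxx eq_sym (negPf vw) mul1n mul0n addn0. Qed.

Lemma mon_w a b : mon a b w = b.
Proof. by rewrite /mon mnmDE !mulmnE !mnm1E eqxx (negPf vw) mul1n mul0n. Qed.

Lemma monE (m : 'X_{1..2}) : m = mon (m v) (m w).
Proof. by apply/mnmP => i; have [->|->] := ord2E i; rewrite ?mon_v ?mon_w. Qed.

Lemma mon_eq a b a' b' : (mon a b == mon a' b') = (a == a') && (b == b').
Proof.
apply/eqP/andP => [e|[/eqP -> /eqP ->]//].
have ev : mon a b v = mon a' b' v by rewrite e.
have ew : mon a b w = mon a' b' w by rewrite e.
by rewrite !mon_v in ev; rewrite !mon_w in ew; rewrite ev ew !eqxx.
Qed.

Lemma degL_mon a b : degL p q (mon a b) = x_ v *+ a + x_ w *+ b.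
Proof.
have M (m : 'X_{1..2}) n : degL p q (m *+ n)%MM = degL p q m *+ n.
  elim: n => [|n IH]; last by rewrite mulmS mulrS -IH degLD.
  by rewrite mulm0n mulr0n /degL big1 // => i _; rewrite mnm0E mulr0n.
by rewrite /mon degLD !M !degL_U.
Qed.

Definition cf (f : S) a b := f@_(mon a b).

Lemma cfP (f g : S) : (forall a b, cf f a b = cf g a b) -> f = g.
Proof. by move=> h; apply/mpolyP => m; rewrite (monE m); apply: h. Qed.

Lemma cfD f g a b : cf (f + g) a b = cf f a b + cf g a b.
Proof. exact: mcoeffD. Qed.
Lemma cfZ c f a b : cf (c *: f) a b = c * cf f a b.
Proof. exact: mcoeffZ. Qed.
Lemma cf0 a b : cf 0 a b = 0.
Proof. exact: mcoeff0. Qed.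
Lemma cfN f a b : cf (- f) a b = - cf f a b.
Proof. exact: mcoeffN. Qed.

Lemma X_mon a b : 'X_[mon a b] = 'X_v ^+ a * 'X_w ^+ b :> S.
Proof. by rewrite /mon mpolyXD !mpolyXn. Qed.

Lemma cfX f (m n : nat) a b : cf ('X_v ^+ m * 'X_w ^+ n * f) a b =
  if (m <= a)%N && (n <= b)%N then cf f (a - m) (b - n) else 0.
Proof.
rewrite -X_mon /cf mulrC.
have [/andP[h1 h2]|h] := boolP ((m <= a)%N && (n <= b)%N).
  have -> : mon a b = (mon m n + mon (a - m) (b - n))%MM.
    by apply/mnmP => i; rewrite mnmDE; have [->|->] := ord2E i; rewrite ?mon_v ?mon_w subnKC.
  by rewrite mcoeffMX.
apply/memN_msupp_eq0/negP; rewrite (perm_mem (msuppMX _ _)) => /mapP[l _ e].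
have ev : mon a b v = (mon m n + l)%MM v by rewrite e.
have ew : mon a b w = (mon m n + l)%MM w by rewrite e.
by move: h; rewrite mnmDE !mon_v in ev; rewrite mnmDE !mon_w in ew; rewrite ev ew !leq_addr.
Qed.

Lemma cfXv f m a b : cf ('X_v ^+ m * f) a b = if (m <= a)%N then cf f (a - m) b else 0.
Proof. by have := cfX f m 0 a b; rewrite expr0 mulr1 andbT subn0. Qed.

Lemma cfXw f n a b : cf ('X_w ^+ n * f) a b = if (n <= b)%N then cf f a (b - n) else 0.
Proof. by have := cfX f 0 n a b; rewrite expr0 mul1r subn0. Qed.

Lemma cf_mon m n a b : cf ('X_v ^+ m * 'X_w ^+ n) a b = ((m == a) && (n == b))%:R.
Proof. by rewrite -X_mon /cf mcoeffX mon_eq. Qed.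

Lemma cf_hcomp d f a b :
  cf (@hcomp k p q d f) a b = if x_ v *+ a + x_ w *+ b == d then cf f a b else 0.
Proof. by rewrite /cf mcoeff_hcomp degL_mon. Qed.

Definition mkpoly (n : nat) (c : nat -> nat -> k) : S :=
  \sum_(a < n) \sum_(b < n) c a b *: ('X_v ^+ a * 'X_w ^+ b).

Lemma cf_mkpoly n c a b : (forall a b, ~~ ((a < n)%N && (b < n)%N) -> c a b = 0) ->
  cf (mkpoly n c) a b = c a b.
Proof.
move=> c0; rewrite /cf /mkpoly mcoeff_big.
under eq_bigr => i _ do (rewrite mcoeff_big; under eq_bigr => j _ do
  rewrite mcoeffZ -/(cf _ a b) cf_mon).
have [/andP[an bn]|/[dup] h /c0 ->] := boolP ((a < n)%N && (b < n)%N).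
  rewrite (bigD1 (Ordinal an)) //= (bigD1 (Ordinal bn)) //= !eqxx mulr1.
  rewrite big1 => [|j jb]; last first.
    by rewrite (_ : _ == b = false) ?mulr0 //; apply/negP => /eqP e; case/eqP: jb; apply/val_inj.
  rewrite big1 ?addr0 // => i ia; rewrite big1 // => j _.
  by rewrite (_ : _ == a = false) ?mulr0 //; apply/negP => /eqP e; case/eqP: ia; apply/val_inj.
rewrite big1 // => i _; rewrite big1 // => j _.
case: eqP => [ia|_]; last by rewrite mulr0.
case: eqP => [jb|_]; last by rewrite mulr0.
by move: h; rewrite -ia -jb !ltn_ord.
Qed.

Lemma dvd_Xv (f : S) n : (forall a b, (a < n)%N -> cf f a b = 0) -> exists g, f = 'X_v ^+ n * g.
Proof.
move=> h; exists (\sum_(m <- msupp f) f@_m *: ('X_v ^+ (m v - n) * 'X_w ^+ m w)).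
rewrite {1}[f]mpolyE mulr_sumr big_seq [RHS]big_seq; apply: eq_bigr => m mf.
rewrite -scalerAr mulrA -exprD subnKC -?X_mon -?monE //.
rewrite leqNgt; apply/negP => /(h _ (m w)); rewrite /cf -monE => e.
by move: mf; rewrite mcoeff_msupp e eqxx.
Qed.

Lemma mpoly_ind2 (A : S -> Prop) : (forall c, A c%:MP) ->
  (forall f g, A f -> A g -> A (f + g)) ->
  (forall f, A f -> A ('X_v * f)) -> (forall f, A f -> A ('X_w * f)) -> forall f, A f.
Proof.
move=> hC hD hv hw f; rewrite [f]mpolyE.
have A0 : A 0 by have := hC 0; rewrite mpolyC0.
apply: big_ind => // m _; rewrite (monE m) X_mon -mul_mpolyC mulrCA.
move: f@__ => c.
elim: (m v) => [|n IH]; last by rewrite exprS -[X in A X]mulrA; apply: hv.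
rewrite expr0 mul1r mulrC; elim: (m w) => [|n IH]; last by rewrite exprS -[X in A X]mulrA; apply: hw.
by rewrite expr0 mul1r.
Qed.

(** Meant for [dual_rel], where multiplication by a single variable is an index shift while a
    general polynomial is unwieldy. *)
Lemma submod_gen (M : lmodType S) (A : M -> Prop) : A 0 ->
  (forall m n, A m -> A n -> A (m + n)) -> (forall (c : k) m, A m -> A (c%:MP *: m)) ->
  (forall m, A m -> A (('X_v : S) *: m)) -> (forall m, A m -> A (('X_w : S) *: m)) -> submod A.
Proof.
move=> A0 AD AC Av Aw; split=> // f; elim/mpoly_ind2: f => [c m|f g hf hg m Am|f hf m Am|f hf m Am].
- exact: AC.
- by rewrite scalerDl; apply: AD; [apply: hf | apply: hg].
- by rewrite -scalerA; apply/Av/hf.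
- by rewrite -scalerA; apply/Aw/hf.
Qed.

Lemma homogen_X (n : nat) (u : 'I_2) : homogen (x_ u *+ n) ('X_u ^+ n : S).
Proof.
move=> m; rewrite mpolyXn msuppX inE => /eqP ->.
elim: n => [|n IH]; last by rewrite mulmS degLD IH degL_U mulrS.
by rewrite /degL big1 // => i _; rewrite mnm0E mulr0n.
Qed.

Lemma homogen_C (c : k) : homogen (0 : L p q) c%:MP.
Proof.
move=> m; rewrite msuppC; case: ifP => //; rewrite inE => _ /eqP ->.
by rewrite /degL big1 // => i _; rewrite mnm0E mulr0n.
Qed.

End Degrees.

(** * Finite dimensional quotients *)

Section Finiteness.
Variables (k : closedFieldType) (p q : nat).
Hypotheses (p0 : (0 < p)%N) (q0 : (0 < q)%N).
Local Notation S := {mpoly k[2]}.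
Local Notation x_ := (xvec p q).

(* Modulo a submodule A, a finitely generated submodule B is finite dimensional
   iff evt A holds on B, so that dimensions need not be counted any more. *)
Definition evt (M : lmodType S) (A : M -> Prop) (m : M) : Prop :=
  exists t : nat, forall v : 'I_2, A (('X_v : S) ^+ t *: m).

Definition tor (M : lmodType S) (m : M) : Prop := evt (fun n => n = 0) m.

Lemma submod_exp (M : lmodType S) (A : M -> Prop) v t t' m : submod A -> (t <= t')%N ->
  A (('X_v : S) ^+ t *: m) -> A (('X_v : S) ^+ t' *: m).
Proof. by move=> hA /subnK <- At; rewrite exprD -scalerA; apply: (subZ hA). Qed.

Lemma evt_sub (M : lmodType S) (A B : M -> Prop) m :
  (forall n, A n -> B n) -> evt A m -> evt B m.
Proof. by move=> AB [t h]; exists t => v; apply: AB. Qed.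

Lemma evt_base (M : lmodType S) (A : M -> Prop) m : A m -> evt A m.
Proof. by exists 0%N => v; rewrite expr0 scale1r. Qed.

Lemma submod_evt (M : lmodType S) (A : M -> Prop) : submod A -> submod (evt A).
Proof.
move=> hA; split.
- exact/evt_base/(sub0 hA).
- move=> m n [s hs] [t ht]; exists (maxn s t) => v; rewrite scalerDr; apply: (subD hA).
    by apply: (submod_exp hA (leq_maxl s t)).
  by apply: (submod_exp hA (leq_maxr s t)).
- move=> f m [t h]; exists t => v.
  by rewrite scalerA mulrC -scalerA; apply: (subZ hA).
Qed.

Lemma evt_idem (M : lmodType S) (A : M -> Prop) m : submod A -> evt (evt A) m -> evt A m.
Proof.
move=> hA [s hs]; have [t0 h0] := hs ord0; have [t1 h1] := hs ord_max.
exists (maxn t0 t1 + s)%N => v; rewrite exprD -scalerA.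
have [->|->] : v = ord0 \/ v = ord_max by apply: (@ord2E ord0 ord_max).
  exact: (submod_exp hA (leq_maxl _ _) (h0 _)).
exact: (submod_exp hA (leq_maxr _ _) (h1 _)).
Qed.

(** The standard reduction below: an element may be replaced by its multiples by a large power of
    each variable, which lie in the domain of a given morphism. *)
Lemma evt_pow (M : lmodType S) (A : M -> Prop) m s : submod A ->
  (forall v, evt A (('X_v : S) ^+ s *: m)) -> evt A m.
Proof. by move=> hA h; apply: evt_idem => //; exists s. Qed.

Lemma submod_tor (M : lmodType S) : submod (@tor M).
Proof. exact/submod_evt/submod0. Qed.

Lemma evtI (M : lmodType S) (A B : M -> Prop) m : submod A -> submod B ->
  evt A m -> evt B m -> evt (fun n => A n /\ B n) m.
Proof.
move=> hA hB [s hs] [t ht]; exists (maxn s t) => v; split.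
  exact: (submod_exp hA (leq_maxl s t)).
exact: (submod_exp hB (leq_maxr s t)).
Qed.

Lemma graded_is_submod (M : grmod k p q) (A : M -> Prop) : graded_submod A -> submod A.
Proof. by case. Qed.

Lemma gprX (M : grmod k p q) v t x (m : M) :
  gpr (x + x_ v *+ t) (('X_v : S) ^+ t *: m) = ('X_v : S) ^+ t *: gpr x m.
Proof. exact/gprZ/homogen_X. Qed.

Lemma gprX' (M : grmod k p q) v t x (m : M) :
  gpr x (('X_v : S) ^+ t *: m) = ('X_v : S) ^+ t *: gpr (x - x_ v *+ t) m.
Proof. by rewrite -gprX subrK. Qed.

Lemma gprC (M : grmod k p q) (c : k) x (m : M) : gpr x (c%:MP *: m) = c%:MP *: gpr x m.
Proof. by rewrite -{1}[x]addr0; apply/gprZ/homogen_C. Qed.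

Lemma gprN (M : grmod k p q) x (m : M) : gpr x (- m) = - gpr x m.
Proof. by apply: (addrI (gpr x m)); rewrite -gprD !subrr gpr0. Qed.

Lemma gprB (M : grmod k p q) x (m n : M) : gpr x (m - n) = gpr x m - gpr x n.
Proof. by rewrite gprD gprN. Qed.

Lemma graded_evt (M : grmod k p q) (A : M -> Prop) : graded_submod A -> graded_submod (evt A).
Proof.
move=> hA; have [E0 ED EZ] := submod_evt (graded_is_submod hA).
split=> // x m [t h]; exists t => v; rewrite -gprX; exact: (gsub_gpr hA).
Qed.

Lemma graded0 (M : grmod k p q) : @graded_submod k p q M (fun n => n = 0).
Proof. by have [E0 ED EZ] := submod0 M; split=> // x m ->; apply: gpr0. Qed.

Lemma graded_tor (M : grmod k p q) : @graded_submod k p q M (@tor M).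
Proof. exact/graded_evt/graded0. Qed.

Lemma graded_gpr_all (M : grmod k p q) (A : M -> Prop) m : submod A ->
  (forall x, A (gpr x m)) -> A m.
Proof. by move=> hA h; have [s _ ->] := gpr_sum m; apply: sub_sum. Qed.

Lemma scalerC_eq0 (M : lmodType S) (A : M -> Prop) (c : k) m : submod A -> c != 0 ->
  A (c%:MP *: m) -> A m.
Proof.
move=> hA c0 /(subZ hA (c^-1)%:MP); by rewrite scalerA -mpolyCM mulVf // mpolyC1 scale1r.
Qed.

(** One more power of X_v than there are spanning vectors gives a linear relation modulo B. The
    multiples of a have pairwise distinct degrees, so a homogeneous projection isolates a single
    term of it. *)
Lemma fin_mod_evt_homog (M : grmod k p q) (A B : M -> Prop) (v : 'I_2) y a :
  graded_submod A -> graded_submod B -> fin_mod A B ->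
  A a -> gpr y a = a -> exists t, B (('X_v : S) ^+ t *: a).
Proof.
move=> hA hB [s hs] Aa ya.
pose w := if v == ord0 then ord_max else ord0 : 'I_2.
have vw : v != w by rewrite /w; case: (v =P ord0) => [->|/eqP].
have /choice[C hC] t := hs _ (gsubZ hA (('X_v : S) ^+ t) Aa).
pose Cm := \matrix_(t < (size s).+1, i < size s) C t i.
have K0 : kermx Cm != 0.
  rewrite -mxrank_eq0 mxrank_ker subn_eq0 -ltnNge ltnS.
  exact: rank_leq_col.
pose u := nz_row (kermx Cm).
have u0 : u != 0 by rewrite nz_row_eq0.
have uC : u *m Cm = 0 by apply/sub_kermxP/nz_row_sub.
have Bsum : B (\sum_(t < (size s).+1) (u 0 t)%:MP *: (('X_v : S) ^+ t *: a)).
  have -> : \sum_(t < (size s).+1) (u 0 t)%:MP *: (('X_v : S) ^+ t *: a) =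
    \sum_(t < (size s).+1) (u 0 t)%:MP *: (('X_v : S) ^+ t *: a - \sum_(i < size s) (C t i)%:MP *: s`_i).
    under [RHS]eq_bigr do rewrite scalerBr.
    rewrite sumrB -[LHS]subr0; congr (_ - _); symmetry.
    under eq_bigr do rewrite scaler_sumr.
    rewrite exchange_big big1 //= => i _.
    under eq_bigr do rewrite scalerA -mpolyCM.
    rewrite -scaler_suml -raddf_sum /=.
    have := congr1 (fun m : 'rV_(size s) => m 0 i) uC; rewrite !mxE => e.
    rewrite (eq_bigr (fun j => u 0 j * Cm j i)) => [|j _]; last by rewrite mxE.
    by rewrite e mpolyC0 scale0r.
  by apply: sub_sum (graded_is_submod hB) _ => t _; apply: (gsubZ hB); apply: hC.
have [i [t ut]] := matrix0Pn _ u0; rewrite ord1 in ut.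
exists t; apply: (scalerC_eq0 (graded_is_submod hB) ut).
have := gsub_gpr hB (y + x_ v *+ t) Bsum; rewrite gpr_sum_big (bigD1 t) //=.
rewrite big1 => [|r rt]; first by rewrite gprC gprX ya addr0.
rewrite gprC -{1}ya -gprX gprK; case: eqP => [/addrI/eqP|_]; last by rewrite scaler0.
rewrite !pmulrn (inj_eq (xvec_inj p0 q0 vw)) eqz_nat => /eqP/val_inj e.
by rewrite e eqxx in rt.
Qed.

Lemma fin_mod_evt (M : grmod k p q) (A B : M -> Prop) a :
  graded_submod A -> graded_submod B -> fin_mod A B -> A a -> evt B a.
Proof.
move=> hA hB AB Aa; apply: graded_gpr_all => [|y]; first exact/submod_evt/graded_is_submod.
have ya : gpr y (gpr y a) = gpr y a by rewrite gprK eqxx.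
have Ay := gsub_gpr hA y Aa; have sB := graded_is_submod hB.
have [s hs] := fin_mod_evt_homog ord0 hA hB AB Ay ya.
have [t ht] := fin_mod_evt_homog ord_max hA hB AB Ay ya.
exists (maxn s t) => v.
have [->|->] : v = ord0 \/ v = ord_max by apply: (@ord2E ord0 ord_max).
  exact: (submod_exp sB (leq_maxl _ _) hs).
exact: (submod_exp sB (leq_maxr _ _) ht).
Qed.

Lemma ksub_submod (M : lmodType S) (A : M -> Prop) : submod A -> ksub A.
Proof. by case=> A0 AD AZ; split=> // c m; apply: AZ. Qed.

Lemma spn_base (M : lmodType S) (B : set M) s m : ksub B -> B m -> spn B s m.
Proof.
by move=> hB Bm; elim: s => [//|a s IH]; exists 0; rewrite mpolyC0 scale0r subr0.
Qed.

Lemma spn_mem (M : lmodType S) (B : set M) s m : ksub B -> m \in s -> spn B s m.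
Proof.
move=> hB; elim: s => [//|a s IH]; rewrite inE => /predU1P[->|/IH hm] /=.
  by exists 1; rewrite mpolyC1 scale1r subrr; apply: spn_base => //; apply: ksub0 hB.
by exists 0; rewrite mpolyC0 scale0r subr0.
Qed.

(** With a common exponent t for all generators, only the t^2 monomials with both exponents below t
    act nontrivially modulo B. *)
Lemma evt_fin_mod (M : lmodType S) (A B : M -> Prop) (s : seq M) : submod B ->
  (forall m, A m -> sspan (fun n => n = 0) s m) -> (forall m, m \in s -> evt B m) ->
  fin_mod A B.
Proof.
move=> hB As sB.
have [t ht] : exists t, forall m, m \in s -> forall v, B (('X_v : S) ^+ t *: m).
  elim: s sB {As} => [|a s IH] sB; first by exists 0%N.
  have [|t ht] := IH; first by move=> m ms; apply: sB; rewrite inE ms orbT.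
  have [u hu] := sB a (mem_head _ _).
  exists (maxn t u) => m; rewrite inE => /predU1P[->|ms] v.
    exact: (submod_exp hB (leq_maxr _ _) (hu v)).
  exact: (submod_exp hB (leq_maxl _ _) (ht m ms v)).
have v01 : ord0 != ord_max :> 'I_2 by [].
pose l := [seq ('X_ord0 ^+ ab.1 * 'X_ord_max ^+ ab.2 : S) *: m |
            ab <- [seq (a, b) | a <- iota 0 t, b <- iota 0 t], m <- s].
have hl := spn_ksub l (ksub_submod hB).
have key m a b : m \in s -> spn B l (('X_ord0 ^+ a * 'X_ord_max ^+ b : S) *: m).
  move=> ms; have [ta|at_] := leqP t a.
    apply: (spn_base _ (ksub_submod hB)); rewrite mulrC -scalerA; apply: (subZ hB).
    exact: (submod_exp hB ta (ht _ ms _)).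
  have [tb|bt] := leqP t b.
    apply: (spn_base _ (ksub_submod hB)); rewrite -scalerA; apply: (subZ hB).
    exact: (submod_exp hB tb (ht _ ms _)).
  apply: spn_mem; first exact: ksub_submod.
  apply/allpairsP; exists ((a, b), m); split=> //=.
  by apply/allpairsP; exists (a, b); rewrite !mem_iota.
have hk f m : m \in s -> spn B l (f *: m).
  move=> ms; rewrite [f]mpolyE scaler_suml; apply: big_ind => [||e _].
  - exact: ksub0 hl.
  - exact: ksubD hl.
  - rewrite -mul_mpolyC -scalerA; apply: (ksubZ hl).
    by rewrite [e](monE v01) X_mon; apply: key.
apply/fin_modP; exists l => m /As/sspanP[c /subr0_eq ->].
apply: big_ind => [||i _]; [exact: ksub0 hl | exact: ksubD hl |].
exact/hk/mem_nth.
Qed.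

Lemma gr_sspan (M : grmod k p q) : exists s : seq M, forall m, sspan (fun n => n = 0) s m.
Proof.
have [s hs] := gr_fg M; exists s => m; have [c ->] := hs m.
by apply/sspanP; exists c; rewrite subrr.
Qed.

Lemma cofiniteE (M : grmod k p q) (A : set M) : graded_submod A ->
  cofinite A <-> forall m, evt A m.
Proof.
move=> hA; split=> [h m|h].
  apply: (@fin_mod_evt M setT) => //.
have [s hs] := gr_sspan M.
exact: (@evt_fin_mod M setT A s (graded_is_submod hA)).
Qed.

(** Noetherianity enters here: A itself has to be finitely generated before a common exponent
    exists. *)
Lemma fin_dimE (M : grmod k p q) (A : set M) : graded_submod A ->
  fin_dim A <-> forall m, A m -> tor m.
Proof.
move=> hA; split=> [h m Am|h].
  by apply: (@fin_mod_evt M A) => //; apply: graded0.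
have [s hs] := gr_sspan M.
have [t tA At] := submodule_fg (graded_is_submod hA) (fun m _ => hs m).
by apply: (@evt_fin_mod M A [set 0]%classic t) => [|//|m /tA/h]; first exact: submod0.
Qed.

End Finiteness.

(** * The additive category of coherent sheaves *)

Section CohHom.
Variables (k : closedFieldType) (p' q' : nat).
Local Notation S := {mpoly k[2]}.
Local Notation grm := (grmod k p'.+1 q'.+1).
Implicit Types (M N P : grm).

Lemma coh_dom M N (f : coh_hom M N) m : evt (fun m => exists n, graph f (m, n)) m.
Proof.
have [G0 GD GZ GP] := graph_sub f.
apply: (proj1 (cofiniteE _ _ _) (graph_dom f) m) => //; split.
- by exists 0.
- by move=> a b [c hc] [d hd]; exists (c + d); apply: (GD (a, c) (b, d)).
- by move=> e a [c hc]; exists (e *: c); apply: (GZ e (a, c)).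
- by move=> x a [c hc]; exists (gpr x c); apply: (GP x (a, c)).
Qed.

Lemma graphD M N (f : coh_hom M N) m n m' n' :
  graph f (m, n) -> graph f (m', n') -> graph f (m + m', n + n').
Proof. exact: (gsubD (graph_sub f)). Qed.

Lemma graphZ M N (f : coh_hom M N) (e : S) m n : graph f (m, n) -> graph f (e *: m, e *: n).
Proof. exact: (gsubZ (graph_sub f)). Qed.

Lemma graphG M N (f : coh_hom M N) x m n : graph f (m, n) -> graph f (gpr x m, gpr x n).
Proof. exact: (gsub_gpr (graph_sub f)). Qed.

Lemma graph00 M N (f : coh_hom M N) : graph f (0, 0).
Proof. exact: (gsub0 (graph_sub f)). Qed.

Lemma graphN M N (f : coh_hom M N) m n : graph f (m, n) -> graph f (- m, - n).
Proof. by move=> /(graphZ (-1)); rewrite !scaleN1r. Qed.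

Lemma graphB M N (f : coh_hom M N) m n m' n' :
  graph f (m, n) -> graph f (m', n') -> graph f (m - m', n - n').
Proof. by move=> h /graphN; apply: graphD. Qed.

Lemma submod_graph M N (f : coh_hom M N) :
  submod (fun m => exists n, graph f (m, n)).
Proof.
split; first by exists 0; apply: graph00.
- by move=> m m' [n hn] [n' hn']; exists (n + n'); apply: graphD.
- by move=> e m [n hn]; exists (e *: n); apply: graphZ.
Qed.

Lemma coh_ker M N (f : coh_hom M N) n : graph f (0, n) -> tor n.
Proof.
move: n; apply: (proj1 (fin_dimE _ _ _) (graph_ker f)) => //; split=> /=.
- exact: graph00.
- by move=> a b h /(graphD h); rewrite addr0.
- by move=> e a /(graphZ e); rewrite scaler0.
- by move=> x a /(graphG x); rewrite gpr0.
Qed.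

Lemma coh_fun M N (f : coh_hom M N) m n n' : graph f (m, n) -> graph f (m, n') -> tor (n - n').
Proof. by move=> h /(graphB h); rewrite subrr; apply: coh_ker. Qed.

Section MkCoh.
Variables (M N : grm) (G : set (M * N)).
Hypothesis hG : @graded_submod _ _ _ (dsum M N) G.
Hypothesis hd : forall m, evt (fun m => exists n, G (m, n)) m.
Hypothesis hk : forall n, G (0, n) -> tor n.

Lemma mkcoh_dom : cofinite [set m : M | exists n, G (m, n)]%classic.
Proof.
have [G0 GD GZ GP] := hG; apply/cofiniteE => //; split.
- by exists 0.
- by move=> a b [c hc] [d hd']; exists (c + d); apply: (GD (a, c) (b, d)).
- by move=> e a [c hc]; exists (e *: c); apply: (GZ e (a, c)).
- by move=> x a [c hc]; exists (gpr x c); apply: (GP x (a, c)).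
Qed.

Lemma mkcoh_ker : fin_dim [set n : N | G (0, n)]%classic.
Proof.
have [G0 GD GZ GP] := hG; apply/fin_dimE => //; split=> /=.
- exact: G0.
- by move=> a b ha hb; have := GD _ _ ha hb; congr G; congr pair; apply: addr0.
- by move=> e a ha; have := GZ e _ ha; congr G; congr pair; apply: scaler0.
- by move=> x a /(GP x); rewrite /= gpr0.
Qed.

Definition mkcoh : coh_hom M N := @CohHom _ _ _ M N G hG mkcoh_dom mkcoh_ker.

End MkCoh.

(** The witnesses of the colimit can always be taken largest, M0 everything and N0 the torsion part,
    since the cofiniteness of M0 and the finiteness of N0 only cost powers of the variables. *)
Lemma coh_eqE M N (f g : coh_hom M N) : coh_eq f g <->
  forall m n n', graph f (m, n) -> graph g (m, n') -> tor (n - n').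
Proof.
split=> [[M0 [N0 [[gM cM] [gN fN] h]]] m n n' hf hg|h].
  have [t ht] := proj1 (@cofiniteE k p'.+1 q'.+1 isT isT M M0 gM) cM m.
  apply: (evt_pow (s := t) (submod0 _)) => v; rewrite scalerBr.
  apply: (proj1 (@fin_dimE k p'.+1 q'.+1 isT isT N N0 gN) fN) => //.
  by apply: h (ht v) _ _; apply: graphZ.
exists setT, (@tor _ N); split; last by move=> m n n' _; apply: h.
- split; first by split.
  by apply: cofiniteT.
- split; first exact: graded_tor.
  by apply/fin_dimE => //; apply: graded_tor.
Qed.

(** One inclusion suffices because a graph determines its values up to torsion. *)
Lemma coh_eq_sub M N (f g : coh_hom M N) :
  (forall m n, graph f (m, n) -> graph g (m, n)) -> coh_eq f g.
Proof. by move=> h; apply/coh_eqE => m n n' /h; apply: coh_fun. Qed.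

Lemma coh_eq_evt M N (f g : coh_hom M N) :
  (forall m, evt (fun m => exists n, graph f (m, n) /\ graph g (m, n)) m) -> coh_eq f g.
Proof.
move=> h; apply/coh_eqE => m n n' hf hg; have [t ht] := h m.
apply: (evt_pow (s := t) (submod0 _)) => v.
have [a [fa ga]] := ht v; have := coh_fun (graphZ ('X_v ^+ t) hf) fa.
have := coh_fun (graphZ ('X_v ^+ t) hg) ga => h1 h2.
have := subB (submod_tor N) h2 h1; congr tor.
by rewrite scalerBr opprB addrA subrK.
Qed.

Lemma coh_eq_refl M N (f : coh_hom M N) : coh_eq f f.
Proof. exact: coh_eq_sub. Qed.

Lemma coh_eq_sym M N (f g : coh_hom M N) : coh_eq f g -> coh_eq g f.
Proof.
move=> /coh_eqE h; apply/coh_eqE => m n n' hg hf; rewrite -opprB.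
exact/(subN (submod_tor _))/h/hg.
Qed.

Lemma coh_eq_trans M N (f g h : coh_hom M N) : coh_eq f g -> coh_eq g h -> coh_eq f h.
Proof.
move=> /coh_eqE h1 /coh_eqE h2; apply/coh_eqE => m n n' hf hh.
have [t ht] := coh_dom g m.
apply: (evt_pow (s := t) (submod0 _)) => v; have [a ha] := ht v.
have := h1 _ _ _ (graphZ _ hf) ha; have := h2 _ _ _ ha (graphZ _ hh) => e1 e2.
have := subD (submod_tor N) e2 e1; congr tor.
by rewrite scalerBr addrA subrK.
Qed.

Lemma coh_comp_congr M N P (f f' : coh_hom M N) (g g' : coh_hom N P) :
  coh_eq f f' -> coh_eq g g' -> coh_eq (coh_comp g f) (coh_comp g' f').
Proof.
move=> hf hg; apply: (@coh_eq_trans _ _ _ (coh_comp g f')).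
  move/coh_eqE: hf => hf; apply/coh_eqE => m n n' [a /= [fa gn]] [a' /= [fa' gn']].
  have [t ht] := hf _ _ _ fa fa'.
  apply: (evt_pow (s := t) (submod0 _)) => v.
  by have := graphZ ('X_v ^+ t) (graphB gn gn'); rewrite ht; apply: coh_ker.
move/coh_eqE: hg => hg; apply/coh_eqE => m n n' [a /= [fa gn]] [a' /= [fa' gn']].
have [t ht] := coh_fun fa fa'.
apply: (evt_pow (s := t) (submod0 _)) => v; rewrite scalerBr.
apply: hg (graphZ _ gn) _.
suff -> : ('X_v : S) ^+ t *: a = ('X_v : S) ^+ t *: a' by apply: graphZ.
by apply/eqP; rewrite -subr_eq0 -scalerBr; apply/eqP.
Qed.

Section Add.
Variables (M N : grm) (f g : coh_hom M N).

Definition coh_add : coh_hom M N.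
Proof.
refine (@mkcoh M N [set u | exists n1 n2,
  [/\ u.2 = n1 + n2, graph f (u.1, n1) & graph g (u.1, n2)]]%classic _ _ _).
- split.
  + by exists 0, 0; rewrite /= addr0; split=> //; apply: graph00.
  + move=> [a b] [c d] [b1 [b2 /= [-> h1 h2]]] [d1 [d2 /= [-> h3 h4]]].
    by exists (b1 + d1), (b2 + d2); rewrite /= addrACA; split=> //; apply: graphD.
  + move=> e [a b] [b1 [b2 /= [-> h1 h2]]].
    by exists (e *: b1), (e *: b2); rewrite /= scalerDr; split=> //; apply: graphZ.
  + move=> x [a b] [b1 [b2 /= [-> h1 h2]]].
    by exists (gpr x b1), (gpr x b2); rewrite /= gprD; split=> //; apply: graphG.
- move=> m; apply: evt_sub (evtI (submod_graph f) (submod_graph g) (coh_dom f m) (coh_dom g m)).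
  by move=> n [[a ha] [b hb]]; exists (a + b), a, b.
- by move=> n [n1 [n2 /= [-> /coh_ker h1 /coh_ker h2]]]; apply: (subD (submod_tor _)).
Defined.

Definition coh_opp : coh_hom M N.
Proof.
refine (@mkcoh M N [set u | graph f (u.1, - u.2)]%classic _ _ _).
- split=> /=.
  + by rewrite oppr0; apply: graph00.
  + by move=> [a b] [c d] /= h1 h2; rewrite opprD; apply: graphD.
  + by move=> e [a b] /= h; rewrite -scalerN; apply: graphZ.
  + by move=> x [a b] /= h; rewrite -gprN; apply: graphG.
- move=> m; apply: evt_sub (coh_dom f m).
  by move=> n [a ha]; exists (- a); rewrite /= opprK.
- by move=> n /= /coh_ker/(subN (submod_tor _)); rewrite opprK.
Defined.

End Add.

Definition coh_eqb M N (f g : coh_hom M N) : bool := `[< coh_eq f g >].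

Lemma coh_eqb_equiv M N : equiv_class_of (@coh_eqb M N).
Proof.
split=> [f|f g|g f h].
- exact/asboolP/coh_eq_refl.
- by apply/asboolP/asboolP; apply: coh_eq_sym.
- by move=> /asboolP h1 /asboolP h2; apply/asboolP; apply: coh_eq_trans h1 h2.
Qed.

HB.instance Definition _ M N := gen_eqMixin (coh_hom M N).
HB.instance Definition _ M N := gen_choiceMixin (coh_hom M N).

Definition coh_equiv_rel M N := EquivRelPack (coh_eqb_equiv M N).

(** Classes turn [coh_eq] into equality and the morphisms into abelian groups, so that the
    categorical arguments become rewriting. *)
Definition Hom M N := {eq_quot (coh_equiv_rel M N)}.
HB.instance Definition _ M N := Choice.on (Hom M N).

Definition cls M N (f : coh_hom M N) : Hom M N := \pi_({eq_quot (coh_equiv_rel M N)}) f.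

Lemma clsP M N (f g : coh_hom M N) : cls f = cls g <-> coh_eq f g.
Proof.
by rewrite /cls; split=> [/eqmodP/asboolP//|h]; apply/eqmodP/asboolP.
Qed.

Definition rep M N (F : Hom M N) : coh_hom M N := repr (F : {eq_quot (coh_equiv_rel M N)}).

Lemma repK M N (F : Hom M N) : cls (rep F) = F.
Proof. exact: reprK. Qed.

Lemma rep_cls M N (f : coh_hom M N) : coh_eq (rep (cls f)) f.
Proof. by apply/clsP; rewrite repK. Qed.

Definition hadd M N (F G : Hom M N) : Hom M N := cls (coh_add (rep F) (rep G)).
Definition hopp M N (F : Hom M N) : Hom M N := cls (coh_opp (rep F)).

Lemma coh_add_congr M N (f f' g g' : coh_hom M N) :
  coh_eq f f' -> coh_eq g g' -> coh_eq (coh_add f g) (coh_add f' g').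
Proof.
move=> /coh_eqE hf /coh_eqE hg; apply/coh_eqE => m n n'.
move=> [a [b /= [-> fa gb]]] [a' [b' /= [-> fa' gb']]].
by rewrite opprD addrACA; apply: (subD (submod_tor _)); [apply: hf fa fa' | apply: hg gb gb'].
Qed.

Lemma haddE M N (f g : coh_hom M N) : hadd (cls f) (cls g) = cls (coh_add f g).
Proof. by apply/clsP/coh_add_congr; apply: rep_cls. Qed.

Lemma coh_opp_congr M N (f g : coh_hom M N) : coh_eq f g -> coh_eq (coh_opp f) (coh_opp g).
Proof.
move=> /coh_eqE h; apply/coh_eqE => m n n' /= fn gn'.
have := subN (submod_tor _) (h _ _ _ fn gn'); congr tor.
by rewrite opprB opprK addrC.
Qed.

Lemma hoppE M N (f : coh_hom M N) : hopp (cls f) = cls (coh_opp f).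
Proof. by apply/clsP/coh_opp_congr; apply: rep_cls. Qed.

Lemma haddA M N : associative (@hadd M N).
Proof.
move=> F G H; rewrite -[F]repK -[G]repK -[H]repK !haddE; apply/clsP/coh_eq_sub => m n.
move=> [a [_ /= [-> fa [b [c /= [-> gb hc]]]]]].
by exists (a + b), c; split=> //=; [rewrite addrA | exists a, b].
Qed.

Lemma haddC M N : commutative (@hadd M N).
Proof.
move=> F G; rewrite -[F]repK -[G]repK !haddE; apply/clsP/coh_eq_sub => m n.
by move=> [a [b /= [-> fa gb]]]; exists b, a; rewrite addrC.
Qed.

Lemma hadd0 M N : left_id (cls (coh_zero M N)) (@hadd M N).
Proof.
move=> F; rewrite -[F]repK haddE; apply/clsP/coh_eq_sub => m n.
by move=> [a [b /= [-> -> h]]]; rewrite add0r.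
Qed.

Lemma haddN M N : left_inverse (cls (coh_zero M N)) (@hopp M N) (@hadd M N).
Proof.
move=> F; rewrite -[F]repK hoppE haddE; apply/clsP/coh_eqE => m n n'.
move=> [a [b /= [-> h1 h2]]] /= ->; rewrite subr0 addrC -[X in _ + X]opprK.
exact: coh_fun h2 h1.
Qed.

HB.instance Definition _ M N :=
  GRing.isZmodule.Build (Hom M N) (@haddA M N) (@haddC M N) (@hadd0 M N) (@haddN M N).

Lemma clsD M N (f g : coh_hom M N) : cls f + cls g = cls (coh_add f g).
Proof. exact: haddE. Qed.

Lemma clsN M N (f : coh_hom M N) : - cls f = cls (coh_opp f).
Proof. exact: hoppE. Qed.

Lemma cls0 M N : cls (coh_zero M N) = 0.
Proof. by []. Qed.

Definition hcmp M N P (G : Hom N P) (F : Hom M N) : Hom M P := cls (coh_comp (rep G) (rep F)).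
Local Notation "g ** f" := (hcmp g f) (at level 40, left associativity).
Definition hid M : Hom M M := cls (coh_id M).

Lemma cls_comp M N P (g : coh_hom N P) (f : coh_hom M N) :
  cls (coh_comp g f) = cls g ** cls f.
Proof. by apply/clsP/coh_comp_congr; apply/coh_eq_sym/rep_cls. Qed.

Lemma hcmpA M N P Q (h : Hom P Q) (g : Hom N P) (f : Hom M N) : h ** (g ** f) = h ** g ** f.
Proof.
rewrite -[f]repK -[g]repK -[h]repK -!cls_comp; apply/clsP/coh_eq_sub => m n.
by move=> [a [[b /= [fb ga]] hn]]; exists b; split=> //; exists a.
Qed.

Lemma hcmp1 M N (f : Hom M N) : f ** hid M = f.
Proof.
rewrite -[f]repK -!cls_comp; apply/clsP/coh_eq_sub => m n.
by move=> [a /= [<-]].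
Qed.

Lemma h1cmp M N (f : Hom M N) : hid N ** f = f.
Proof.
rewrite -[f]repK -!cls_comp; apply/clsP/coh_eq_sub => m n.
by move=> [a /= [h <-]].
Qed.

Lemma hcmpDl M N P (g h : Hom N P) (f : Hom M N) : (g + h) ** f = g ** f + h ** f.
Proof.
rewrite -[f]repK -[g]repK -[h]repK clsD -!cls_comp clsD; apply/clsP/coh_eq_sub => m n.
move=> [a /= [fa [b [c /= [-> gb hc]]]]]; exists b, c; split=> //; by exists a.
Qed.

Lemma hcmpDr M N P (h : Hom N P) (f g : Hom M N) : h ** (f + g) = h ** f + h ** g.
Proof.
rewrite -[f]repK -[g]repK -[h]repK clsD -!cls_comp clsD.
apply/clsP/coh_eq_sym/coh_eq_sub => m n.
move=> [b [c /= [-> [a [fa ha]] [a' [ga' ha']]]]]; exists (a + a'); split; last exact: graphD.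
by exists a, a'.
Qed.

Lemma hcmp0 M N P (g : Hom N P) : g ** (0 : Hom M N) = 0.
Proof. by apply: (addrI (g ** 0)); rewrite -hcmpDr !addr0. Qed.
Lemma h0cmp M N P (f : Hom M N) : (0 : Hom N P) ** f = 0.
Proof. by apply: (addrI (0 ** f)); rewrite -hcmpDl !addr0. Qed.
Lemma hcmpN M N P (g : Hom N P) (f : Hom M N) : g ** (- f) = - (g ** f).
Proof. by apply: (addrI (g ** f)); rewrite -hcmpDr !subrr hcmp0. Qed.
Lemma hNcmp M N P (g : Hom N P) (f : Hom M N) : (- g) ** f = - (g ** f).
Proof. by apply: (addrI (g ** f)); rewrite -hcmpDl !subrr h0cmp. Qed.
Lemma hcmpBl M N P (g h : Hom N P) (f : Hom M N) : (g - h) ** f = g ** f - h ** f.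
Proof. by rewrite hcmpDl hNcmp. Qed.
Lemma hcmpBr M N P (h : Hom N P) (f g : Hom M N) : h ** (f - g) = h ** f - h ** g.
Proof. by rewrite hcmpDr hcmpN. Qed.

End CohHom.

Notation "g ** f" := (hcmp g f) (at level 40, left associativity) : coh_scope.
Delimit Scope coh_scope with coh.

(** * Subobjects, quotients and exact sequences *)

Section Constructions.
Variables (k : closedFieldType) (p' q' : nat).
Local Notation S := {mpoly k[2]}.
Local Notation grm := (grmod k p'.+1 q'.+1).
Implicit Types (M N P W X Y Z : grm).

(** The proof [hA] is an index so that the closedness instance can be attached to this head
    symbol. *)
Definition subpred M (A : M -> Prop) (hA : graded_submod A) : {pred M} := fun m => `[< A m >].

Lemma subpred_closed M (A : M -> Prop) (hA : graded_submod A) : submod_closed (subpred hA).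
Proof.
split; first by apply/asboolP; apply: (gsub0 hA).
move=> f m n /asboolP hm /asboolP hn; apply/asboolP.
by apply: (gsubD hA) => //; apply: (gsubZ hA).
Qed.

HB.instance Definition _ M (A : M -> Prop) (hA : graded_submod A) :=
  GRing.isSubmodClosed.Build S M (subpred hA) (subpred_closed hA).

Section Sub.
Variables (M : grm) (A : M -> Prop) (hA : graded_submod A).

Record subcar := SubCar { subval : M; _ : subval \in subpred hA }.
HB.instance Definition _ := [isSub for subval].
HB.instance Definition _ := [Choice of subcar by <:].
HB.instance Definition _ := [SubChoice_isSubLmodule of subcar by <:].

Lemma subcarP (e : subcar) : A (subval e).
Proof. by case: e => m /= /asboolP. Qed.

Definition mksub m (Am : A m) : subcar := SubCar (introT (asboolP _) Am : m \in subpred hA).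

Definition subgpr x (e : subcar) : subcar := mksub (gsub_gpr hA x (subcarP e)).

Lemma subval_sum I (r : seq I) (F : I -> subcar) :
  subval (\sum_(i <- r) F i) = \sum_(i <- r) subval (F i).
Proof. by elim/big_rec2: _ => // i x y _ <-. Qed.

Lemma sub_gr_sum (m : subcar) :
  exists2 s : seq (L p'.+1 q'.+1), uniq s & m = \sum_(x <- s) subgpr x m.
Proof.
have [s us e] := gpr_sum (subval m); exists s => //.
by apply/val_inj; rewrite /= subval_sum.
Qed.

Lemma sub_gr_fg : exists s : seq subcar, forall m, exists c : nat -> S,
  m = \sum_(i < size s) c i *: s`_i.
Proof.
have [s hs] := gr_sspan M.
have [t tA At] := submodule_fg (graded_is_submod hA) (fun m _ => hs m).
have [r rt] : exists r : seq subcar, [seq subval e | e <- r] = t.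
  elim: t tA {At} => [|a t IH] tA; first by exists [::].
  have [|r <-] := IH; first by move=> m mt; apply: tA; rewrite inE mt orbT.
  by exists (mksub (tA a (mem_head _ _)) :: r).
exists r => m; have /sspanP[c /subr0_eq hc] := At _ (subcarP m).
exists c; apply/val_inj; rewrite /= subval_sum hc -rt size_map.
by apply: eq_bigr => i _; rewrite (nth_map 0).
Qed.

Definition subgr : grm.
Proof.
refine (@GrMod _ _ _ subcar subgpr _ _ _ sub_gr_sum sub_gr_fg).
- by move=> x m n; apply/val_inj; apply: gprD.
- by move=> x e f m hf; apply/val_inj; apply: gprZ.
- move=> x y m; apply/val_inj; rewrite /= gprK; by case: ifP.
Defined.

End Sub.

Section Quot.
Variables (M : grm) (A : M -> Prop) (hA : graded_submod A).

Definition qcar := Quotient.quot (subpred hA).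
HB.instance Definition _ := GRing.Zmodule.on qcar.

Definition qpi (m : M) : qcar := \pi_(Quotient.quot (subpred hA)) m.

Lemma qpiP m n : qpi m = qpi n <-> A (m - n).
Proof.
split=> [/eqP|h]; first by rewrite /qpi -Quotient.idealrBE => /asboolP.
by apply/eqP; rewrite /qpi -Quotient.idealrBE; apply/asboolP.
Qed.

Lemma qpi0P m : qpi m = 0 <-> A m.
Proof.
have -> : (0 : qcar) = qpi 0 by rewrite /qpi raddf0.
by rewrite qpiP subr0.
Qed.

Lemma qpiD m n : qpi (m + n) = qpi m + qpi n.
Proof. exact: raddfD. Qed.

Lemma qpi_surj (a : qcar) : exists m, a = qpi m.
Proof. by exists (repr a); rewrite /qpi reprK. Qed.

Definition qscale (f : S) (a : qcar) : qcar := qpi (f *: repr a).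

Lemma qscaleE f m : qscale f (qpi m) = qpi (f *: m).
Proof.
apply/qpiP; rewrite -scalerBr; apply: (gsubZ hA).
by apply/qpiP; rewrite /qpi reprK.
Qed.

Lemma qscaleA f g a : qscale f (qscale g a) = qscale (f * g) a.
Proof. by have [m ->] := qpi_surj a; rewrite !qscaleE scalerA. Qed.
Lemma qscale1 : left_id 1 qscale.
Proof. by move=> a; have [m ->] := qpi_surj a; rewrite qscaleE scale1r. Qed.
Lemma qscaleDr : right_distributive qscale +%R.
Proof.
move=> f a b; have [m ->] := qpi_surj a; have [n ->] := qpi_surj b.
by rewrite -qpiD !qscaleE -qpiD scalerDr.
Qed.
Lemma qscaleDl a : {morph qscale^~ a : f g / f + g}.
Proof. by move=> f g /=; have [m ->] := qpi_surj a; rewrite !qscaleE -qpiD scalerDl. Qed.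

HB.instance Definition _ := GRing.Zmodule_isLmodule.Build S qcar
  qscaleA qscale1 qscaleDr qscaleDl.

Lemma qpiZ (f : S) m : qpi (f *: m) = f *: qpi m.
Proof. by rewrite -qscaleE. Qed.

Lemma qpi_sum I (r : seq I) (F : I -> M) :
  qpi (\sum_(i <- r) F i) = \sum_(i <- r) qpi (F i).
Proof. exact: raddf_sum. Qed.

Definition qgpr x (a : qcar) : qcar := qpi (gpr x (repr a)).

Lemma qgprE x m : qgpr x (qpi m) = qpi (gpr x m).
Proof.
apply/qpiP; rewrite -gprB; apply: (gsub_gpr hA).
by apply/qpiP; rewrite /qpi reprK.
Qed.

Lemma quot_gr_sum (m : qcar) :
  exists2 s : seq (L p'.+1 q'.+1), uniq s & m = \sum_(x <- s) qgpr x m.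
Proof.
have [n ->] := qpi_surj m; have [s us e] := gpr_sum n; exists s => //.
by rewrite {1}e qpi_sum; apply: eq_bigr => x _; rewrite qgprE.
Qed.

Lemma quot_gr_fg : exists s : seq qcar, forall m, exists c : nat -> S,
  m = \sum_(i < size s) c i *: s`_i.
Proof.
have [s hs] := gr_fg M; exists (map qpi s) => a.
have [m ->] := qpi_surj a; have [c ->] := hs m; exists c.
rewrite qpi_sum size_map; apply: eq_bigr => i _.
by rewrite qpiZ (nth_map 0).
Qed.

Definition quotgr : grm.
Proof.
refine (@GrMod _ _ _ qcar qgpr _ _ _ quot_gr_sum quot_gr_fg).
- move=> x a b; have [m ->] := qpi_surj a; have [n ->] := qpi_surj b.
  by rewrite -qpiD !qgprE -qpiD gprD.
- move=> x e f a hf; have [m ->] := qpi_surj a.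
  by rewrite -qpiZ !qgprE -qpiZ; congr qpi; apply: gprZ.
- move=> x y a; have [m ->] := qpi_surj a.
  rewrite !qgprE gprK; case: ifP => // _; by rewrite /qpi raddf0.
Defined.

End Quot.

Section Map.
Variables (M N : grm) (phi : M -> N).
Hypothesis phiD : forall m n, phi (m + n) = phi m + phi n.
Hypothesis phiZ : forall (f : S) m, phi (f *: m) = f *: phi m.
Hypothesis phiG : forall x m, phi (gpr x m) = gpr x (phi m).

Lemma coh_map0 : phi 0 = 0.
Proof. by apply: (addrI (phi 0)); rewrite -phiD !addr0. Qed.

Lemma coh_map_graded : @graded_submod _ _ _ (dsum M N) [set u | u.2 = phi u.1]%classic.
Proof.
split=> //= [|[a b] [c d] /= -> ->|f [a b] /= ->|x [a b] /= ->].
- exact/esym/coh_map0.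
- exact/esym/phiD.
- exact/esym/phiZ.
- exact/esym/phiG.
Qed.

Lemma coh_map_dom m : evt (fun m => exists n, n = phi m) m.
Proof. by apply: evt_base; exists (phi m). Qed.

Lemma coh_map_ker n : n = phi 0 -> tor n.
Proof. by move=> ->; rewrite coh_map0; apply: (sub0 (submod_tor _)). Qed.

Definition coh_map : coh_hom M N := mkcoh coh_map_graded coh_map_dom coh_map_ker.

End Map.

Definition coh_quot M (A : M -> Prop) (hA : graded_submod A) : coh_hom M (quotgr hA) :=
  @coh_map M (quotgr hA) (qpi hA) (qpiD hA) (@qpiZ M A hA) (fun x m => esym (qgprE hA x m)).

Lemma graph_quot M (A : M -> Prop) (hA : graded_submod A) m a :
  graph (coh_quot hA) (m, a) = (a = qpi hA m).
Proof. by []. Qed.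

Section Biproduct.
Variables A B : grm.

Definition coh_inl : coh_hom A (dsum A B).
Proof.
refine (@coh_map A (dsum A B) (fun a => (a, 0)) _ _ _).
- by move=> m n; congr pair; rewrite addr0.
- by move=> m n; congr pair; rewrite scaler0.
- by move=> m n; congr pair; rewrite gpr0.
Defined.
Definition coh_inr : coh_hom B (dsum A B).
Proof.
refine (@coh_map B (dsum A B) (fun b => (0, b)) _ _ _).
- by move=> m n; congr pair; rewrite addr0.
- by move=> m n; congr pair; rewrite scaler0.
- by move=> m n; congr pair; rewrite gpr0.
Defined.
Definition coh_fst : coh_hom (dsum A B) A.
Proof. by refine (@coh_map (dsum A B) A fst _ _ _). Defined.
Definition coh_snd : coh_hom (dsum A B) B.
Proof. by refine (@coh_map (dsum A B) B snd _ _ _). Defined.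

Lemma graph_inl u : graph coh_inl u = (u.2 = (u.1, 0)). Proof. by []. Qed.
Lemma graph_inr u : graph coh_inr u = (u.2 = (0, u.1)). Proof. by []. Qed.
Lemma graph_fst u : graph coh_fst u = (u.2 = u.1.1). Proof. by []. Qed.
Lemma graph_snd u : graph coh_snd u = (u.2 = u.1.2). Proof. by []. Qed.
Definition graph_biprod := (graph_inl, graph_inr, graph_fst, graph_snd).

Definition inlH := cls coh_inl.
Definition inrH := cls coh_inr.
Definition fstH := cls coh_fst.
Definition sndH := cls coh_snd.
Local Open Scope coh_scope.

Lemma fst_inl : fstH ** inlH = hid A.
Proof. by rewrite -cls_comp; apply/clsP/coh_eq_sub => m n [a]; rewrite !graph_biprod => -[/= -> ->]. Qed.
Lemma snd_inr : sndH ** inrH = hid B.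
Proof. by rewrite -cls_comp; apply/clsP/coh_eq_sub => m n [a]; rewrite !graph_biprod => -[/= -> ->]. Qed.
Lemma fst_inr : fstH ** inrH = 0.
Proof. by rewrite -cls_comp -cls0; apply/clsP/coh_eq_sub => m n [a]; rewrite !graph_biprod => -[/= -> ->]. Qed.
Lemma snd_inl : sndH ** inlH = 0.
Proof. by rewrite -cls_comp -cls0; apply/clsP/coh_eq_sub => m n [a]; rewrite !graph_biprod => -[/= -> ->]. Qed.
Lemma dsum_id : inlH ** fstH + inrH ** sndH = hid (dsum A B).
Proof.
rewrite -!cls_comp clsD; apply/clsP/coh_eq_sub => -[a b] n.
move=> [n1 [n2 [/= ->]]] [a']; rewrite !graph_biprod => -[/= -> ->] [b'].
rewrite !graph_biprod => -[/= -> ->].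
by congr pair; rewrite /= ?addr0 ?add0r.
Qed.

End Biproduct.

(** Exactness in the quotient category in terms of elements, each condition holding up to large
    powers of the variables. The lemmas that follow derive the universal properties from it. *)
Record exact_at X Y Z (f : coh_hom X Y) (g : coh_hom Y Z) : Prop := ExactAt {
  ex_mono : forall x, graph f (x, 0) -> tor x;
  ex_zero : forall x y z, graph f (x, y) -> graph g (y, z) -> tor z;
  ex_mid : forall y, graph g (y, 0) -> evt (fun y => exists x, graph f (x, y)) y;
  ex_epi : forall z, evt (fun z => exists y, graph g (y, z)) z
}.

Lemma submod_range M N (f : coh_hom M N) : submod (fun n => exists m, graph f (m, n)).
Proof.
split; first by exists 0; apply: graph00.
- by move=> m m' [n hn] [n' hn']; exists (n + n'); apply: graphD.
- by move=> e m [n hn]; exists (e *: n); apply: graphZ.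
Qed.

Lemma mono_ann X Y W (f : coh_hom X Y) (a : coh_hom W X) :
  (forall x, graph f (x, 0) -> tor x) -> (cls f ** cls a)%coh = 0 -> cls a = 0.
Proof.
rewrite -cls_comp -!cls0 => fm /clsP/coh_eqE h; apply/clsP/coh_eqE => w x x' /= wx ->.
rewrite subr0; have [t ht] := coh_dom f x.
apply: (evt_pow (s := t) (submod0 _)) => v; have [y xy] := ht v.
have [|//|u hu] := h (('X_v : S) ^+ t *: w) y 0; first by exists ('X_v ^+ t *: x); split=> //; apply: graphZ.
apply: (evt_pow (s := u) (submod0 _)) => v'; apply: fm.
by have := graphZ ('X_v' ^+ u) xy; rewrite -[y]subr0 hu.
Qed.

Lemma epi_ann Y Z W (g : coh_hom Y Z) (a : coh_hom Z W) :
  (forall z, evt (fun z => exists y, graph g (y, z)) z) -> (cls a ** cls g)%coh = 0 -> cls a = 0.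
Proof.
rewrite -cls_comp -!cls0 => ge /clsP/coh_eqE h; apply/clsP/coh_eqE => z w w' /= zw ->.
rewrite subr0; have [t ht] := ge z.
apply: (evt_pow (s := t) (submod0 _)) => v; have [y yz] := ht v.
have := h y ('X_v ^+ t *: w) 0; rewrite subr0; apply=> //=.
by exists ('X_v ^+ t *: z); split=> //; apply: graphZ.
Qed.

Section Exact.
Variables (X Y Z : grm) (f : coh_hom X Y) (g : coh_hom Y Z).
Hypothesis fg : exact_at f g.
Local Open Scope coh_scope.

Lemma exact_zero : cls g ** cls f = 0.
Proof.
rewrite -cls_comp -cls0; apply/clsP/coh_eqE => x z z' [y /= [xy yz]] ->.
by rewrite subr0; apply: (ex_zero fg) xy yz.
Qed.

(** The lift is the composite of h with the inverse relation of f, which is single valued up to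
    torsion because f is mono. *)
Lemma ker_lift W (h : Hom W Y) : cls g ** h = 0 -> exists a : Hom W X, cls f ** a = h.
Proof.
rewrite -[h]repK -cls_comp -cls0; move: (rep h) => {}h /clsP/coh_eqE gh.
unshelve eexists (cls (@mkcoh k p' q' W X [set u | exists y, graph h (u.1, y) /\ graph f (u.2, y)]%classic _ _ _)).
- split=> /=.
  + by exists 0; split; apply: graph00.
  + by move=> [a b] [c d] [y /= [? ?]] [z /= [? ?]]; exists (y + z); split; apply: graphD.
  + by move=> e [a b] [y /= [? ?]]; exists (e *: y); split; apply: graphZ.
  + by move=> x [a b] [y /= [? ?]]; exists (gpr x y); split; apply: graphG.
- have sW : submod (fun w => exists x y, graph h (w, y) /\ graph f (x, y)).
    split; first by exists 0, 0; split; apply: graph00.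
    + by move=> m m' [n [y [? ?]]] [n' [y' [? ?]]]; exists (n + n'), (y + y'); split; apply: graphD.
    + by move=> e m [n [y [? ?]]]; exists (e *: n), (e *: y); split; apply: graphZ.
  move=> w; have [t ht] := coh_dom h w; apply: (evt_pow (s := t) sW) => v.
  have [y wy] := ht v; have [t' ht'] := coh_dom g y.
  apply: (evt_pow (s := t') sW) => v'; have [z yz] := ht' v'.
  have [|//|u hu] := gh (('X_v' : S) ^+ t' *: ('X_v ^+ t *: w)) z 0.
    by exists ('X_v' ^+ t' *: y); split=> //; apply: graphZ.
  apply: (evt_pow (s := u) sW) => v2.
  have := graphZ ('X_v2 ^+ u) yz; rewrite -[z]subr0 hu => /(ex_mid fg)[u' hu'].
  exists u' => v3; have [x xy] := hu' v3.
  by exists x; eexists; split; last exact: xy; do 3! apply: graphZ.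
- move=> x /= [y [/coh_ker[t ht] xy]].
  apply: (evt_pow (s := t) (submod0 _)) => v; apply: (ex_mono fg).
  by rewrite -(ht v); apply: graphZ.
rewrite -cls_comp; apply/clsP/coh_eqE => w y y' [x /= [[y2 [wy2 xy2]] xy]] wy'.
have := subD (submod_tor _) (coh_fun xy xy2) (coh_fun wy2 wy').
by rewrite addrA subrK.
Qed.

(** Dually, h after the inverse relation of g; its ambiguity is the kernel of g, on which h vanishes
    up to torsion. *)
Lemma coker_lift W (h : Hom Y W) : h ** cls f = 0 -> exists a : Hom Z W, a ** cls g = h.
Proof.
rewrite -[h]repK -cls_comp -cls0; move: (rep h) => {}h /clsP/coh_eqE hf.
unshelve eexists (cls (@mkcoh k p' q' Z W [set u | exists y, graph g (y, u.1) /\ graph h (y, u.2)]%classic _ _ _)).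
- split=> /=.
  + by exists 0; split; apply: graph00.
  + by move=> [a b] [c d] [y /= [? ?]] [z /= [? ?]]; exists (y + z); split; apply: graphD.
  + by move=> e [a b] [y /= [? ?]]; exists (e *: y); split; apply: graphZ.
  + by move=> x [a b] [y /= [? ?]]; exists (gpr x y); split; apply: graphG.
- have sZ : submod (fun z => exists w y, graph g (y, z) /\ graph h (y, w)).
    split; first by exists 0, 0; split; apply: graph00.
    + by move=> m m' [n [y [? ?]]] [n' [y' [? ?]]]; exists (n + n'), (y + y'); split; apply: graphD.
    + by move=> e m [n [y [? ?]]]; exists (e *: n), (e *: y); split; apply: graphZ.
  move=> z; have [t ht] := ex_epi fg z; apply: (evt_pow (s := t) sZ) => v.
  have [y yz] := ht v; have [t' ht'] := coh_dom h y.
  exists t' => v'; have [w yw] := ht' v'.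
  by exists w; eexists; split; last exact: yw; apply: graphZ.
- move=> w /= [y [/(ex_mid fg)[t ht] yw]].
  apply: (evt_pow (s := t) (submod0 _)) => v; have [x xy] := ht v.
  have := hf x ('X_v ^+ t *: w) 0; rewrite subr0; apply=> //=.
  by eexists; split; first exact: xy; apply: graphZ.
rewrite -cls_comp; apply/clsP/coh_eqE => y w w' [z /= [yz [y2 [y2z y2w]]]] yw'.
have := graphB yz y2z; rewrite subrr => /(ex_mid fg)[t ht].
apply: (evt_pow (s := t) (submod0 _)) => v; have [x xy] := ht v.
have := hf x ('X_v ^+ t *: (w' - w)) 0; rewrite subr0 => h1.
rewrite -[w - w']opprB scalerN; apply: (subN (submod_tor _)); apply: h1 => //=.
by eexists; split; first exact: xy; apply/graphZ/graphB.
Qed.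

Lemma exact_mono W (a : Hom W X) : cls f ** a = 0 -> a = 0.
Proof. by rewrite -[a]repK; apply: mono_ann; apply: ex_mono fg. Qed.

Lemma exact_epi W (a : Hom Z W) : a ** cls g = 0 -> a = 0.
Proof. by rewrite -[a]repK; apply: epi_ann; apply: ex_epi fg. Qed.

(** E consists of the pairs in Y (+) W with a common image in Z. It carries the passage from left to
    right almost split. *)
Lemma exact_pullback W (h : coh_hom W Z) : exists (E : grm) (i : coh_hom X E)
    (a : Hom E Y) (b : coh_hom E W),
  [/\ exact_at i b, a ** cls i = cls f & cls g ** a = cls h ** cls b].
Proof.
pose A (u : dsum Y W) : Prop := exists z, graph g (u.1, z) /\ graph h (u.2, z).
have hA : graded_submod A.
  split=> /=.
  - by exists 0; split; apply: graph00.
  - by move=> [a b] [c d] [y /= [? ?]] [z /= [? ?]]; exists (y + z); split; apply: graphD.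
  - by move=> e [a b] [y /= [? ?]]; exists (e *: y); split; apply: graphZ.
  - by move=> x [a b] [y /= [? ?]]; exists (gpr x y); split; apply: graphG.
pose E := subgr hA; exists E.
have pairE (y y' : Y) (w w' : W) : y = y' -> w = w' -> (y, w) = (y', w') by move=> -> ->.
have sX : submod (fun x => exists e : E, graph f (x, (subval e).1) /\ (subval e).2 = 0).
  split; first by exists 0; split=> //; apply: graph00.
  - move=> m m' [n [? e1]] [n' [? e2]]; exists (n + n'); split; first exact: graphD.
    by rewrite /= e1 e2 addr0.
  - move=> e m [n [? e1]]; exists (e *: n); split; first exact: graphZ.
    by rewrite /= e1 scaler0.
unshelve eexists (@mkcoh k p' q' X E [set u : X * E | graph f (u.1, (subval u.2).1) /\ (subval u.2).2 = 0]%classic _ _ _).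
- split=> /=.
  + by split=> //; apply: graph00.
  + move=> [a b] [c d] /= [h1 e1] [h2 e2]; split; first exact: graphD.
    by rewrite e1 e2 addr0.
  + move=> e [a b] /= [h1 e1]; split; first exact: graphZ.
    by rewrite e1 scaler0.
  + move=> x [a b] /= [h1 e1]; split; first exact: graphG.
    by rewrite e1 gpr0.
- move=> x; have [t ht] := coh_dom f x; apply: (evt_pow (s := t) sX) => v.
  have [y xy] := ht v; have [t' ht'] := coh_dom g y.
  apply: (evt_pow (s := t') sX) => v'; have [z yz] := ht' v'.
  have [u hu] := ex_zero fg (graphZ _ xy) yz.
  exists u => v2.
  have Ae : A ('X_v2 ^+ u *: ('X_v' ^+ t' *: y), 0).
    by exists 0; split; [rewrite /= -(hu v2); apply: graphZ | apply: graph00].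
  by exists (mksub hA Ae); split=> //=; do 2!apply: graphZ.
- move=> e /= [/coh_ker[t ht] e2]; exists t => v; apply/val_inj => /=.
  by rewrite [subval e]surjective_pairing e2; apply: pairE; rewrite /= ?scaler0.
exists (cls (@coh_map E Y (fun e => (subval e).1) (fun _ _ => erefl) (fun _ _ => erefl) (fun _ _ => erefl))).
exists (@coh_map E W (fun e => (subval e).2) (fun _ _ => erefl) (fun _ _ => erefl) (fun _ _ => erefl)).
split.
- split=> /=.
  + by move=> x [xy _]; apply: (ex_mono fg).
  + by move=> x e w [_ ->] ->; apply: (sub0 (submod_tor _)).
  + move=> e e0; have [z [yz]] := subcarP e; rewrite -e0 => /coh_ker[t ht].
    apply: (evt_pow (s := t)); last move=> v.
      split; first by exists 0; split=> //; apply: graph00.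
      + move=> m m' [n [? e1]] [n' [? e2]]; exists (n + n'); split; first exact: graphD.
        by rewrite /= e1 e2 addr0.
      + move=> a m [n [? e1]]; exists (a *: n); split; first exact: graphZ.
        by rewrite /= e1 scaler0.
    have := graphZ ('X_v ^+ t) yz; rewrite ht => /(ex_mid fg)[u hu].
    exists u => v'; have [x xy] := hu v'; exists x; split=> //=.
    by rewrite -e0 !scaler0.
  + have sW : submod (fun w => exists e : E, w = (subval e).2).
      split; first by exists 0.
      * by move=> m m' [n ->] [n' ->]; exists (n + n').
      * by move=> a m [n ->]; exists (a *: n).
    move=> w; have [t ht] := coh_dom h w; apply: (evt_pow (s := t) sW) => v.
    have [z wz] := ht v; have [u hu] := ex_epi fg z.
    exists u => v'; have [y yz] := hu v'.
    have Ae : A (y, 'X_v' ^+ u *: ('X_v ^+ t *: w)).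
      by eexists; split; first exact: yz; apply: graphZ.
    by exists (mksub hA Ae).
- by rewrite -cls_comp; apply/clsP/coh_eq_sub => x y [e /= [[xe _] ->]].
- rewrite -!cls_comp; apply/clsP/coh_eqE => e z z' [y /= [-> yz]] [w /= [-> wz']].
  have [z2 [yz2 wz2]] := subcarP e.
  have := subB (submod_tor _) (coh_fun yz yz2) (coh_fun wz' wz2).
  by rewrite opprB addrA subrK.
Qed.

End Exact.

End Constructions.

(** * Almost split sequences and irreducible morphisms *)

Section AbstractAR.
Variables (k : closedFieldType) (p' q' : nat).
Local Notation grm := (grmod k p'.+1 q'.+1).
Implicit Types (M N P W X Y Z : grm).
Local Open Scope coh_scope.

Definition isoH M N (f : Hom M N) := exists g : Hom N M, g ** f = hid M /\ f ** g = hid N.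
Definition smonoH M N (f : Hom M N) := exists r : Hom N M, r ** f = hid M.
Definition sepiH M N (f : Hom M N) := exists s : Hom N M, f ** s = hid N.
(** Zero objects are included on purpose: one middle term vanishes when X is a simple torsion
    sheaf. *)
Definition localH M := forall t : Hom M M, isoH t \/ isoH (hid M - t).
Definition irrH M N (f : Hom M N) :=
  [/\ ~ smonoH f, ~ sepiH f & forall W (h : Hom M W) (g : Hom W N),
    f = g ** h -> smonoH h \/ sepiH g].
Definition isoO M N := exists f : Hom M N, isoH f.
Definition zeroH M := hid M = 0.
Definition indecH M := ~ zeroH M /\ forall A B, isoO M (dsum A B) -> zeroH A \/ zeroH B.
Definition left_almost_split X Y (f : Hom X Y) :=
  ~ smonoH f /\ forall W (h : Hom X W), ~ smonoH h -> exists a : Hom Y W, h = a ** f.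

Lemma zero_to M N (f : Hom M N) : zeroH N -> f = 0.
Proof. by move=> z; rewrite -[f]h1cmp z h0cmp. Qed.
Lemma zero_from M N (f : Hom M N) : zeroH M -> f = 0.
Proof. by move=> z; rewrite -[f]hcmp1 z hcmp0. Qed.

Lemma local_idem M (e : Hom M M) : localH M -> e ** e = e -> e = hid M \/ e = 0.
Proof.
move=> lM ee; case: (lM e) => -[g [ge eg]]; [left|right].
  by rewrite -[e]h1cmp -ge -hcmpA ee.
by rewrite -[e]h1cmp -ge -hcmpA hcmpBl h1cmp ee subrr hcmp0.
Qed.

Section Right.
Variables (X Y Z : grm) (f : coh_hom X Y) (g : coh_hom Y Z).
Hypotheses (fg : exact_at f g) (fL : left_almost_split (cls f)) (lZ : localH Z).

(** Pull the sequence back along h. If the pulled back mono [i] splits, h factors through g.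
    Otherwise [i] factors through f, which yields w : Z -> W and v : Z -> Y with g v + h w = 1; as Z
    is local, h or g would be a split epi. *)
Lemma right_almost_split :
  ~ sepiH (cls g) /\ forall W (h : Hom W Z), ~ sepiH h -> exists a : Hom W Y, h = cls g ** a.
Proof.
have gN : ~ sepiH (cls g).
  move=> [s gs]; apply: (proj1 fL).
  have [|r fr] := ker_lift fg (h := hid Y - s ** cls g).
    by rewrite hcmpBr hcmp1 hcmpA gs h1cmp subrr.
  exists r; apply/eqP; rewrite -subr_eq0; apply/eqP/(exact_mono fg).
  by rewrite hcmpBr hcmpA fr hcmpBl h1cmp hcmp1 -hcmpA (exact_zero fg) hcmp0 subr0 subrr.
split=> // W h hN; have [E [i [a [b [ib ai gab]]]]] := exact_pullback fg (rep h).
rewrite repK in gab.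
have [[r ri]|iN] := pselect (smonoH (cls i)).
  have [|l lb] := coker_lift ib (h := a - cls f ** r).
    by rewrite hcmpBl ai -hcmpA ri hcmp1 subrr.
  exists l; apply/esym/eqP; rewrite -subr_eq0; apply/eqP/(exact_epi ib).
  by rewrite hcmpBl -hcmpA lb hcmpBr gab hcmpA (exact_zero fg) h0cmp subr0 subrr.
have [c ic] := proj2 fL _ _ iN.
have [|w wg] := coker_lift fg (h := cls b ** c).
  by rewrite -hcmpA -ic (exact_zero ib).
have [|v vg] := coker_lift fg (h := hid Y - a ** c).
  by rewrite hcmpBl h1cmp -hcmpA -ic ai subrr.
case: (lZ (h ** w)) => -[u [u1 u2]].
  by case: hN; exists (w ** u); rewrite hcmpA.
case: gN; exists (v ** u); rewrite hcmpA -u2; congr (_ ** _).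
apply/eqP; rewrite -subr_eq0; apply/eqP/(exact_epi fg).
rewrite hcmpBl -hcmpA vg hcmpBr hcmp1 hcmpA gab hcmpBl h1cmp -[h ** w ** _]hcmpA wg hcmpA.
by rewrite subrr.
Qed.

End Right.

Record biprod Y A B (iA : Hom A Y) (iB : Hom B Y) (pA : Hom Y A) (pB : Hom Y B) : Prop := Biprod {
  bp1 : pA ** iA = hid A; bp2 : pB ** iB = hid B; bp3 : pA ** iB = 0; bp4 : pB ** iA = 0;
  bp5 : iA ** pA + iB ** pB = hid Y }.

Lemma biprod_dsum A B : biprod (inlH A B) (inrH A B) (fstH A B) (sndH A B).
Proof. split; [exact: fst_inl|exact: snd_inr|exact: fst_inr|exact: snd_inl|exact: dsum_id]. Qed.

Lemma biprodC Y A B (iA : Hom A Y) (iB : Hom B Y) (pA : Hom Y A) (pB : Hom Y B) :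
  biprod iA iB pA pB -> biprod iB iA pB pA.
Proof. by case=> h1 h2 h3 h4 h5; split=> //; rewrite addrC. Qed.

(** The complement is taken as the cokernel of [a], which is an honest quotient module by the range
    of a representative. *)
Lemma split_summand M Y (a : Hom M Y) (r : Hom Y M) : r ** a = hid M ->
  exists K (s : Hom K Y) (c : Hom Y K),
    [/\ isoO Y (dsum M K) & a ** r + s ** c = hid Y].
Proof.
move=> ra; pose f := rep a.
have hA : graded_submod (fun y => exists m, graph f (m, y)).
  by have [A0 AD AZ] := submod_range f; split=> // x m [y hy]; exists (gpr x y); apply: graphG.
pose K := quotgr hA.
pose c : coh_hom Y K := coh_quot hA.
have cE y b : graph c (y, b) = (b = qpi hA y) by [].
have fc : exact_at f c.
  split.
  - move=> x x0; have e : cls f = a by apply: repK.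
    have : cls (coh_comp (rep r) f) = cls (coh_id M) by rewrite cls_comp !repK.
    move=> /clsP/coh_eqE h.
    have := h x 0 x; rewrite sub0r => h'; rewrite -[x]opprK; apply: (subN (submod_tor _)).
    by apply: h' => //; exists 0; split=> //; apply: graph00.
  - move=> x y z xy; rewrite cE => ->.
    suff -> : qpi hA y = 0 by apply: (sub0 (submod_tor _)).
    by apply/qpi0P; exists x.
  - by move=> y; rewrite cE => /esym/qpi0P h; apply: evt_base.
  - by move=> z; apply: evt_base; have [y ->] := qpi_surj z; exists y.
have cf : cls c ** a = 0 by rewrite -[a]repK; apply: exact_zero fc.
have [|s sc] := coker_lift fc (h := hid Y - a ** r).
  by rewrite hcmpBl h1cmp repK -hcmpA ra hcmp1 subrr.
exists K, s, (cls c); split; last by rewrite sc addrC subrK.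
have [h1 h2 h3 h4 h5] := biprod_dsum M K.
have rs : r ** s = 0.
  by apply: (exact_epi fc); rewrite -hcmpA sc hcmpBr hcmp1 hcmpA ra h1cmp subrr.
have cs : cls c ** s = hid K.
  apply/eqP; rewrite -subr_eq0; apply/eqP/(exact_epi fc).
  by rewrite hcmpBl -hcmpA sc hcmpBr hcmp1 hcmpA cf h0cmp subr0 h1cmp subrr.
exists (inlH M K ** r + inrH M K ** cls c), (a ** fstH M K + s ** sndH M K); split.
  rewrite hcmpDl !hcmpDr -!hcmpA ![_ ** (_ ** r)]hcmpA ![_ ** (_ ** cls c)]hcmpA h1 h2 h3 h4.
  by rewrite !hcmp0 !hcmp1 !h0cmp addr0 add0r sc addrC subrK.
rewrite hcmpDl !hcmpDr -!hcmpA (hcmpA r a) (hcmpA r s) (hcmpA (cls c) a) (hcmpA (cls c) s).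
by rewrite ra rs cf cs !(h0cmp, h1cmp, hcmp0) addr0 add0r.
Qed.

(** The ring identity (1 - ab)^(-1) = 1 + a (1 - ba)^(-1) b. *)
Lemma iso_subBA M N (a : Hom M N) (b : Hom N M) :
  isoH (hid M - b ** a) -> isoH (hid N - a ** b).
Proof.
move=> [u [u1 u2]]; exists (hid N + a ** u ** b); split.
  rewrite hcmpDl h1cmp hcmpBr hcmp1.
  have e : u ** (b ** a) = u - hid M by move: u1; rewrite hcmpBr hcmp1 => <-; rewrite subKr.
  rewrite -!hcmpA (hcmpA b a) (hcmpA u) e hcmpBl h1cmp hcmpBr.
  by rewrite subKr subrK.
rewrite hcmpDr hcmp1 hcmpBl h1cmp.
have e : b ** a ** u = u - hid M by move: u2; rewrite hcmpBl h1cmp => <-; rewrite subKr.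
by rewrite -!hcmpA (hcmpA b a) (hcmpA (b ** a) u) e hcmpBl h1cmp hcmpBr subKr subrK.
Qed.

(** With u inverse to b s, the endomorphism s u b of B is idempotent, hence 1; the value 0 would
    make Y zero. *)
Lemma iso_factor B Y (b : Hom B Y) (s : Hom Y B) : localH B -> ~ zeroH Y ->
  isoH (b ** s) -> isoO Y B.
Proof.
move=> lB Y0 [u [u1 u2]].
have e1 : b ** (s ** u) = hid Y by rewrite hcmpA.
case: (local_idem (e := s ** u ** b) lB) => [|e|e].
- by rewrite -!hcmpA (hcmpA b) (hcmpA (b ** _)) -(hcmpA b) e1 h1cmp.
- by exists (s ** u), b.
- case: Y0; rewrite /zeroH -[LHS]h1cmp -{1}e1 -[hid Y in LHS]e1.
  by rewrite -hcmpA (hcmpA _ b) e h0cmp hcmp0.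
Qed.

Section Irreducible.
Variables (X Y Z : grm) (f : coh_hom X Y) (g : coh_hom Y Z).
Hypotheses (fg : exact_at f g) (fL : left_almost_split (cls f)).

(** Let pA f = g' h with h not a split mono, so h = a f. If g' a iA is invertible, g' is a split
    epi. Otherwise 1 - g' a iA is, and then pA f is a multiple of pB f, which the rest refutes. *)
Lemma irr_component A B (iA : Hom A Y) (iB : Hom B Y) (pA : Hom Y A) (pB : Hom Y B) :
  biprod iA iB pA pB -> localH X -> localH A -> localH Z -> ~ zeroH A ->
  irrH (pA ** cls f).
Proof.
move=> [h1 h2 h3 h4 h5] lX lA lZ A0; have [fN fE] := fL; split.
- by move=> [r hr]; apply: fN; exists (r ** pA); rewrite -hcmpA.
- move=> [s hs]; case: (local_idem (e := s ** (pA ** cls f)) lX).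
  + by rewrite -hcmpA (hcmpA _ s) hs h1cmp.
  + by move=> e; apply: fN; exists (s ** pA); rewrite -hcmpA.
  + move=> e; apply: A0; rewrite /zeroH -[LHS]h1cmp -[in LHS]hs.
    by rewrite -hcmpA (hcmpA s) e h0cmp hcmp0.
- move=> W h g' e; have [|hN] := pselect (smonoH h); [by left | right].
  have [a ha] := fE _ _ hN.
  case: (lA (g' ** a ** iA)) => -[u [u1 u2]].
    by exists (a ** iA ** u); rewrite !hcmpA.
  exfalso.
  have e1 : pA ** cls f = u ** (g' ** a ** iB) ** (pB ** cls f).
    have e2 : pA ** cls f - g' ** a ** iA ** (pA ** cls f) = g' ** a ** iB ** (pB ** cls f).
      apply/eqP; rewrite subr_eq addrC -!hcmpA !(hcmpA iA) !(hcmpA iB) -!hcmpDr -hcmpDl h5 h1cmp.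
      by rewrite -ha e.
    by rewrite -hcmpA -e2 -[X in u ** (X - _)]h1cmp -hcmpBl hcmpA u1 h1cmp.
  (* By [e1] this difference kills f, so it factors through g, and the factor [v] is a retraction of
     [cls g ** iA]. *)
  have [|v hv] := coker_lift fg (h := pA - u ** (g' ** a ** iB) ** pB).
    by rewrite hcmpBl e1 hcmpA subrr.
  have vA : v ** (cls g ** iA) = hid A.
    by rewrite hcmpA hv hcmpBl h1 -hcmpA h4 hcmp0 subr0.
  case: (local_idem (e := cls g ** iA ** v) lZ) => [|e2|e2].
  + by rewrite -!hcmpA (hcmpA v) (hcmpA (v ** _)) -(hcmpA v) vA h1cmp.
  (* Now [cls g ** iA] is an isomorphism, so B can be corrected into the kernel of g; the resulting
     [r] makes f a split mono. *)
  + have [|r hr] := ker_lift fg (h := iB - iA ** v ** cls g ** iB).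
      by rewrite hcmpBr !hcmpA e2 h1cmp subrr.
    have rB : pB ** cls f ** r = hid B.
      by rewrite -hcmpA hr hcmpBr h2 !hcmpA h4 !h0cmp subr0.
    have e3 : cls g ** (iB ** (pB ** cls f)) = - (cls g ** (iA ** (pA ** cls f))).
      apply/eqP; rewrite -addr_eq0 addrC -hcmpDr (hcmpA iA) (hcmpA iB) -hcmpDl h5 h1cmp.
      by rewrite (exact_zero fg).
    apply: fN; exists (r ** pB); apply/eqP; rewrite -subr_eq0; apply/eqP/(exact_mono fg).
    rewrite hcmpBr hcmp1 -hcmpA hcmpA hr hcmpBl -!hcmpA e3 !hcmpN opprK.
    rewrite (hcmpA (cls g) iA) (hcmpA v) vA h1cmp [X in X - _]addrC.
    by rewrite (hcmpA iA) (hcmpA iB) -hcmpDl h5 h1cmp subrr.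
  + by apply: A0; rewrite /zeroH -[LHS]h1cmp -{1}vA -hcmpA -[hid A in LHS]vA hcmpA -hcmpA (hcmpA _ v) e2 h0cmp hcmp0.
Qed.

(** An irreducible phi is b f with b a split epi, so 1 on W is a sum of an endomorphism through A
    and one through B. Locality of A decides which summand recovers W. *)
Lemma irr_target A B (iA : Hom A Y) (iB : Hom B Y) (pA : Hom Y A) (pB : Hom Y B) W (phi : Hom X W) :
  biprod iA iB pA pB -> localH A -> localH B -> indecH W -> irrH phi ->
  isoO W A \/ isoO W B.
Proof.
move=> [h1 h2 h3 h4 h5] lA lB [W0 Wi] [n1 n2 n3]; have [fN fE] := fL.
have [b hb] := fE _ _ n1; case: (n3 _ _ _ hb) => // -[s bs].
have sumE : b ** iA ** (pA ** s) + b ** iB ** (pB ** s) = hid W.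
  by rewrite -!hcmpA -hcmpDr (hcmpA iA) (hcmpA iB) -hcmpDl h5 h1cmp.
have caseB : isoH (hid A - pA ** s ** (b ** iA)) -> isoO W B.
  move=> /iso_subBA; rewrite -sumE addrAC subrr add0r; exact: iso_factor.
case: (lA (pA ** s ** (b ** iA))) => [[u [u1 u2]]|/caseB h]; last by right.
have [K [t [c [wK e]]]] := split_summand (a := b ** iA) (r := u ** (pA ** s)) ltac:(by rewrite -hcmpA).
case: (Wi _ _ wK) => z.
  (* Here A is zero, so 1 = 0 on A and the second alternative holds as well. *)
  right; apply: caseB; exists 0; rewrite hcmp0 h0cmp.
  by split; apply/esym/(zero_to _ z).
left; exists (u ** (pA ** s)), (b ** iA).
by rewrite -e (zero_to c z) hcmp0 addr0 -(hcmpA u) u1.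
Qed.

Lemma irr_iso W W' V (phi : Hom W W') (th : Hom W' V) : isoH th -> irrH phi -> irrH (th ** phi).
Proof.
move=> [u [u1 u2]] [n1 n2 n3]; split.
- by move=> [r hr]; apply: n1; exists (r ** th); rewrite -hcmpA.
- move=> [s hs]; apply: n2; exists (s ** th).
  by rewrite hcmpA -[phi]h1cmp -u1 -!hcmpA (hcmpA th) (hcmpA _ s) hs h1cmp u1.
- move=> T h g' e; case: (n3 _ h (u ** g')) => [|//|[s hs]].
  + by rewrite -hcmpA -e hcmpA u1 h1cmp.
  + by left.
  + right; exists (s ** u); rewrite -[g']h1cmp -u2 -!hcmpA (hcmpA g') (hcmpA u) (hcmpA u) hs.
    by rewrite h1cmp.
Qed.

Lemma irr_iso_source W W' V (phi : Hom W W') (th : Hom V W) : isoH th -> irrH phi -> irrH (phi ** th).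
Proof.
move=> [u [u1 u2]] [n1 n2 n3]; split.
- move=> [r hr]; apply: n1; exists (th ** r).
  by rewrite -[LHS]hcmp1 -{1}u2 -!hcmpA (hcmpA phi) (hcmpA r) hr h1cmp.
- by move=> [s hs]; apply: n2; exists (th ** s); rewrite hcmpA.
- move=> T h g' e; case: (n3 _ (h ** u) g') => [|[r hr]|//].
  + by rewrite hcmpA -e -hcmpA u2 hcmp1.
  + left; exists (u ** r); rewrite -[LHS]hcmp1 -{1}u1 -!hcmpA (hcmpA h) (hcmpA r) hr.
    by rewrite h1cmp.
  + by right.
Qed.

End Irreducible.

End AbstractAR.

(** * Functionals on direct limits *)

Section Functional.
Variable k : closedFieldType.
Local Notation S := {mpoly k[2]}.

(** A subspace H maximal among those containing U and missing v is a complement of the line of v;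
    the functional is the coefficient of v modulo H. *)
Lemma separating_functional (M : lmodType S) (U : set M) (v : M) : ksub U -> ~ U v ->
  exists lam : M -> k, [/\ forall m n, lam (m + n) = lam m + lam n,
    forall c m, lam (c%:MP *: m) = c * lam m, forall m, U m -> lam m = 0 & lam v = 1].
Proof.
move=> hU Uv.
pose P (A : set M) := A = set0 \/ [/\ ksub A, (U `<=` A)%classic & ~ A v].
have [H [[H0|[hH UH Hv]] Hmax]] : exists A, P A /\ forall B, (A `<` B)%classic -> ~ P B.
- apply: Zorn_bigcup => F FP Ftot.
  have [[A0 FA0 [a A0a]]|none] := pselect (exists2 A, F A & exists a, A a); last first.
    left; apply/seteqP; split=> // m [A FA Am].
    by case: none; exists A => //; exists m.
  have ne A m : F A -> A m -> [/\ ksub A, (U `<=` A)%classic & ~ A v].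
    by move=> /FP[->//|].
  right; have [hA0 UA0 _] := ne _ _ FA0 A0a; split.
  + split.
    * by exists A0 => //; apply: ksub0 hA0.
    * move=> m n [A FA Am] [B FB Bn]; have [hA _ _] := ne _ _ FA Am; have [hB _ _] := ne _ _ FB Bn.
      have [AB|BA] := Ftot _ _ FA FB.
        by exists B => //; apply: (ksubD hB) => //; apply: AB.
      by exists A => //; apply: (ksubD hA) => //; apply: BA.
    * by move=> c m [A FA Am]; exists A => //; have [hA _ _] := ne _ _ FA Am; apply: (ksubZ hA).
  + by move=> m Um; exists A0 => //; apply: UA0.
  + by move=> [A FA Av]; have [_ _] := ne _ _ FA Av; apply.
- case: (Hmax U); last by right; split.
  by rewrite H0; split=> // /(_ 0); apply; apply: ksub0 hU.
have key m : exists c : k, H (m - c%:MP *: v).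
  have [Hm|Hm] := pselect (H m); first by exists 0; rewrite mpolyC0 scale0r subr0.
  pose H' : set M := [set x | exists c : k, H (x - c%:MP *: m)]%classic.
  have [c hc] : H' v.
  - apply: contrapT => H'v; apply: (Hmax H'); last first.
      right; split=> //; last first.
        by move=> x /UH Hx; exists 0; rewrite mpolyC0 scale0r subr0.
      split; first by exists 0; rewrite mpolyC0 scale0r subr0; apply: ksub0 hH.
      + move=> x y [c hc] [d hd]; exists (c + d).
        by rewrite mpolyCD scalerDl opprD addrACA; apply: (ksubD hH).
      + move=> e x [c hc]; exists (e * c).
        by rewrite mpolyCM -scalerA -scalerBr; apply: (ksubZ hH).
    split; first by move=> x Hx; exists 0; rewrite mpolyC0 scale0r subr0.
    move=> h; apply: Hm; apply: h; exists 1; rewrite mpolyC1 scale1r subrr.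
    exact: ksub0 hH.
  - have c0 : c != 0.
      by apply/eqP => c0; apply: Hv; move: hc; rewrite c0 mpolyC0 scale0r subr0.
    exists c^-1; have := ksubZ hH (- c^-1) hc.
    by rewrite scalerBr scalerA -mpolyCM mulNr mulVf // !mpolyCN mpolyC1 scaleN1r opprK
       scaleNr addrC.
have uniq_c m c d : H (m - c%:MP *: v) -> H (m - d%:MP *: v) -> c = d.
  move=> hc /(ksubN hH)/(ksubD hH hc); rewrite opprB addrC addrA subrK.
  rewrite -scalerBl -mpolyCB => h.
  apply/eqP; rewrite eq_sym -subr_eq0; apply/negP => /negP cd; apply: Hv.
  have := ksubZ hH (d - c)^-1 h.
  by rewrite scalerA -mpolyCM mulVf // mpolyC1 scale1r.
have [lam hlam] := choice key.
exists lam; split.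
- move=> m n; apply: (uniq_c (m + n)) => //.
  by rewrite mpolyCD scalerDl opprD addrACA; apply: (ksubD hH).
- move=> c m; apply: (uniq_c (c%:MP *: m)) => //.
  by rewrite mpolyCM -scalerA -scalerBr; apply: (ksubZ hH).
- move=> m /UH Hm; apply: (uniq_c m) => //.
  by rewrite mpolyC0 scale0r subr0.
- apply: (uniq_c v) => //; rewrite mpolyC1 scale1r subrr; exact: ksub0 hH.
Qed.

Section Colimit.
Variables (W : lmodType S) (th : S) (B : nat -> set W).
Hypothesis hB : forall N, ksub (B N).
Hypothesis thB : forall N m, B N m -> B N.+1 (th *: m).

Definition single (N : nat) (w : W) : nat -> W := fun n => if n == N then w else 0.

Lemma sum_single K N w (F : nat -> S) :
  \sum_(n < K) F n *: single N w n = if (N < K)%N then F N *: w else 0.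
Proof.
case: ltnP => h.
  rewrite (bigD1 (Ordinal h)) //= /single eqxx big1 ?addr0 // => i ih.
  rewrite (_ : (i == N :> nat) = false) ?scaler0 //.
  by apply/negP => /eqP e; case/eqP: ih; apply/val_inj.
rewrite big1 // => i _; rewrite /single (_ : (i == N :> nat) = false) ?scaler0 //.
by apply/negP => /eqP e; move: (ltn_ord i); rewrite e ltnNge h.
Qed.

(* The families (w_N) with sum 0 in colim (W / B 0 -th-> W / B 1 -th-> ...). *)
Definition colim_null (u : nat -> W) : Prop := exists K, (forall N, (K <= N)%N -> u N = 0) /\
  B K (\sum_(n < K) th ^+ (K - n) *: u n).

Lemma colim_null_le u K K' : (K <= K')%N -> (forall N, (K <= N)%N -> u N = 0) ->
  B K (\sum_(n < K) th ^+ (K - n) *: u n) -> B K' (\sum_(n < K') th ^+ (K' - n) *: u n).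
Proof.
move=> KK' u0 h; elim: K' KK' => [|K' IH]; first by rewrite leqn0 => /eqP K0; move: h; rewrite K0.
rewrite leq_eqVlt => /predU1P[<-//|]; rewrite ltnS => KK'.
rewrite big_ord_recr /= u0 // scaler0 addr0.
have := thB (IH KK'); congr B; rewrite scaler_sumr; apply: eq_bigr => i _.
by rewrite scalerA -exprS subSn // ltnW.
Qed.

(** The hypothesis says that e at stage M is nonzero in the colimit. The functional is found on all
    families [nat -> W], vanishing on the null ones, and is then read off on families concentrated
    at one stage. *)
Lemma colimit_functional M e : (forall K, ~ B (M + K) (th ^+ K *: e)) ->
  exists lam : nat -> W -> k, [/\ forall N m n, lam N (m + n) = lam N m + lam N n,
    forall N c m, lam N (c%:MP *: m) = c * lam N m,
    forall N m, lam N.+1 (th *: m) = lam N m,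
    forall N m, B N m -> lam N m = 0 & lam M e = 1].
Proof.
move=> eB.
have [||lam [lD lZ l0 l1]] := @separating_functional (nat -> W) colim_null (single M e).
- split.
  + exists 0%N; split=> //; rewrite big_ord0; exact: ksub0 (hB 0%N).
  + move=> u u' [K [uK hK]] [K' [uK' hK']].
    exists (maxn K K'); split.
      move=> N; rewrite geq_max => /andP[h1 h2].
      by rewrite [LHS](_ : _ = u N + u' N) // uK // uK' // addr0.
    under eq_bigr do rewrite scalerDr.
    rewrite big_split /=; apply: (ksubD (hB _)).
      exact: colim_null_le (leq_maxl _ _) uK hK.
    exact: colim_null_le (leq_maxr _ _) uK' hK'.
  + move=> c u [K [uK hK]]; exists K; split.
      by move=> N h; rewrite [LHS](_ : _ = c%:MP *: u N) // uK // scaler0.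
    have := ksubZ (hB K) c hK; congr B; rewrite scaler_sumr; apply: eq_bigr => i _.
    by rewrite [RHS](_ : _ = th ^+ (K - i) *: (c%:MP *: u i)) // !scalerA mulrC.
- move=> [K [h1 h2]]; move: h2; rewrite (sum_single _ _ _ (fun n => th ^+ (K - n))); case: ltnP => [MK|KM].
    by have := eB (K - M)%N; rewrite subnKC // ltnW.
  have e0 : e = 0 by have := h1 _ KM; rewrite /single eqxx.
  by have := eB 0%N; rewrite e0 scaler0 addn0 => h; case: h; apply: ksub0 (hB M).
have lN u : lam (- u) = - lam u.
  by rewrite -scaleN1r -mpolyC1 -mpolyCN lZ mulN1r.
exists (fun N w => lam (single N w)); split=> //.
- move=> N m n; rewrite -lD; congr lam; apply/funext => i.
  by rewrite [RHS](_ : _ = single N m i + single N n i) // /single; case: ifP => // _; rewrite addr0.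
- move=> N c m; rewrite -lZ; congr lam; apply/funext => i.
  by rewrite [RHS](_ : _ = c%:MP *: single N m i) // /single; case: ifP => // _; rewrite scaler0.
- move=> N m; apply/eqP; rewrite -subr_eq0 -lN -lD; apply/eqP/l0.
  exists N.+2; split.
    move=> i hi; rewrite [LHS](_ : _ = single N.+1 (th *: m) i + - single N m i) // /single.
    by rewrite !gtn_eqF ?subr0 // ltnW.
  have -> : \sum_(n < N.+2) th ^+ (N.+2 - n) *: (single N.+1 (th *: m) - single N m) n = 0.
    rewrite (eq_bigr (fun n : 'I_N.+2 => th ^+ (N.+2 - n) *: single N.+1 (th *: m) n -
      th ^+ (N.+2 - n) *: single N m n)) => [|i _]; last by rewrite -scalerBr.
    rewrite sumrB (sum_single _ _ _ (fun n => th ^+ (N.+2 - n))).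
    rewrite (sum_single _ _ _ (fun n => th ^+ (N.+2 - n))) ltnSn ltnW //.
    by rewrite subSnn expr1 scalerA subSn // subSnn expr2 subrr.
  exact: ksub0 (hB _).
- move=> N m Bm; apply: l0; exists N.+1; split.
    by move=> i hi; rewrite /single gtn_eqF.
  by rewrite (sum_single _ _ _ (fun n => th ^+ (N.+1 - n))) ltnSn subSnn expr1; apply: thB.
Qed.

End Colimit.

End Functional.

(* Local duality: a functional lam on colim_N W / (X_v^(nu N), X_w^N) is turned
   into a morphism W -> O(y), or into a quotient of O(y), which sends u to the
   polynomial with the coefficients lam_N (X_v^c X_w^e u). The slope a of nu is 1
   for line bundles; for torsion sheaves a = 0 and nu is the constant length. *)
Section DualRelation.
Variables (k : closedFieldType) (p' q' : nat).
Local Notation S := {mpoly k[2]}.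
Local Notation grm := (grmod k p'.+1 q'.+1).
Local Notation x_ := (xvec p'.+1 q'.+1).
Variables (v w : 'I_2).
Hypothesis vw : v != w.
Local Notation "'X^( a , b )" := (('X_v : S) ^+ a * ('X_w : S) ^+ b).
Variables (W : grm) (y : L p'.+1 q'.+1) (a j0 : nat) (lam : nat -> W -> k) (dg : nat -> L p'.+1 q'.+1).
Local Notation nu N := (a * N + j0)%N.
Hypothesis dgH : forall N, dg N + (y + (x_ v + x_ w)) = x_ v *+ nu N + x_ w *+ N.
Hypothesis lamD : forall N m n, lam N (m + n) = lam N m + lam N n.
Hypothesis lamZ : forall N c m, lam N (c%:MP *: m) = c * lam N m.
Hypothesis lamT : forall N m, lam N.+1 ('X^(a, 1) *: m) = lam N m.
Hypothesis lamV : forall N m, lam N ('X_v ^+ (nu N) *: m) = 0.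
Hypothesis lamG : forall N m, lam N m = lam N (gpr (dg N) m).

Lemma lam0 N : lam N 0 = 0.
Proof. by have := lamZ N 0 0; rewrite scaler0 mul0r. Qed.

Lemma lamTt N t m : lam (N + t) ('X^(a * t, t) *: m) = lam N m.
Proof.
elim: t m => [|t IH] m; first by rewrite addn0 muln0 !expr0 mul1r scale1r.
rewrite addnS -[RHS]IH -[RHS]lamT; congr (lam _ _); rewrite scalerA; congr (_ *: _).
by rewrite mulrACA -!exprD mulnS add1n.
Qed.

Lemma lam_homog u N c e m : gpr u m = m ->
  u + x_ v *+ c + x_ w *+ e <> dg N -> lam N ('X^(c, e) *: m) = 0.
Proof.
move=> um ne; rewrite lamG -um -scalerA -gprX -gprX gprK.
have -> : u + x_ w *+ e + x_ v *+ c = u + x_ v *+ c + x_ w *+ e by rewrite addrAC.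
by case: eqP => [e'|_]; [case: ne|rewrite lam0].
Qed.

(** [dg N] is the degree of the socle generator X_v^(nu N - 1) X_w^(N - 1) of O(y) / (X_v^(nu N),
    X_w^N). An element of degree u is moved there by a monomial exactly when the complementary
    monomial has degree u in O(y). *)
Lemma dgE u N c e a' b' : (nu N = a' + c.+1)%N -> (N = b' + e.+1)%N ->
  (u + x_ v *+ c + x_ w *+ e == dg N) = (x_ v *+ a' + x_ w *+ b' == y + u).
Proof.
move=> hv hw; rewrite -(inj_eq (addIr (y + (x_ v + x_ w)))) dgH hv hw !mulrnDr !mulrS.
have -> : x_ v *+ a' + (x_ v + x_ v *+ c) + (x_ w *+ b' + (x_ w + x_ w *+ e)) =
  (x_ v *+ a' + x_ w *+ b') + (x_ v + x_ v *+ c + (x_ w + x_ w *+ e)).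
  by rewrite addrACA.
have -> : u + x_ v *+ c + x_ w *+ e + (y + (x_ v + x_ w)) =
  (y + u) + (x_ v + x_ v *+ c + (x_ w + x_ w *+ e)).
  rewrite -[u + _ + _]addrA addrACA [u + y]addrC; congr (_ + _).
  by rewrite addrACA; congr (_ + _); apply: addrC.
by rewrite (inj_eq (addIr _)) eq_sym.
Qed.

(** Says that, at every stage, the functional on W is the residue pairing on O(y), which takes the
    coefficient of the socle monomial; hence the complementary exponents on the right. *)
Definition dual_rel (u : W * Oline k y) : Prop := forall N c e,
  lam N ('X^(c, e) *: u.1) =
  if (c < nu N)%N && (e < N)%N then cf v w u.2 (nu N - c.+1) (N - e.+1) else 0.

Lemma dual_rel_graded : @graded_submod _ _ _ (dsum W (Oline k y)) dual_rel.
Proof.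
have hs : @submod k (dsum W (Oline k y)) dual_rel.
  apply: (submod_gen vw).
  - by move=> N c e; rewrite scaler0 lam0 cf0 if_same.
  - move=> [m f] [m' f'] h h' N c e; rewrite scalerDr lamD h h' cfD.
    by case: ifP; rewrite ?addr0.
  - move=> r [m f] h N c e /=; rewrite scalerA mulrC -scalerA lamZ h.
    rewrite [in RHS](_ : r%:MP *: f = r *: (f : S)); last exact: mul_mpolyC.
    by rewrite cfZ; case: ifP => // _; rewrite mulr0.
  - move=> [m f] h N c e /=; rewrite scalerA mulrAC -exprSr h /=.
    rewrite (_ : ('X_v : S) *: f = 'X_v ^+ 1 * (f : S)) // cfXv // .
    case: (ltnP e N) => eN; rewrite ?andbF ?andbT //.
    case: ltnP => h1; first by rewrite ltnW // subn_gt0 h1 -subnDA addn1.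
    by case: ifP => // h2; rewrite subn_gt0 ltnNge h1.
  - move=> [m f] h N c e /=; rewrite scalerA -mulrA -exprSr h /=.
    rewrite (_ : ('X_w : S) *: f = 'X_w ^+ 1 * (f : S)) // cfXw //.
    case: (ltnP c (nu N)) => cN //=.
    case: ltnP => h1; first by rewrite ltnW // subn_gt0 h1 -subnDA addn1.
    by case: ifP => // h2; rewrite subn_gt0 ltnNge h1.
have [A0 AD AZ] := hs; split=> // u [m f] h N c e /=.
have hz : gpr u (gpr u m) = gpr u m by rewrite gprK eqxx.
case: (boolP ((c < nu N)%N && (e < N)%N)) => [/andP[cN eN]|nce].
  have hE := @dgE u N c e (nu N - c.+1) (N - e.+1).
  rewrite cf_hcomp // -hE ?subnK //.
  case: eqP => [hd|hd]; last exact: lam_homog hz hd.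
  rewrite -scalerA -gprX -gprX.
  have -> : u + x_ w *+ e + x_ v *+ c = dg N by rewrite -hd addrAC.
  by rewrite -lamG scalerA h /= cN eN.
have [hd|hd] := pselect (u + x_ v *+ c + x_ w *+ e = dg N); last exact: lam_homog hz hd.
rewrite -scalerA -gprX -gprX.
have -> : u + x_ w *+ e + x_ v *+ c = dg N by rewrite -hd addrAC.
by rewrite -lamG scalerA h /= (negPf nce).
Qed.

(** The extra hypothesis stands for vanishing on X_w^N W, which is available for line bundles but
    for torsion sheaves holds only after multiplication by a power of X_w. *)
Lemma dual_rel_dom u (m : W) : gpr u m = m ->
  (forall N c e, (c < nu N)%N -> (N <= e)%N -> lam N ('X^(c, e) *: m) = 0) ->
  exists f, dual_rel (m, f).
Proof.
move=> um hm.
(* The coefficient does not depend on the stage, by [lamTt]; this one is large enough when a >= 1.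
   When a = 0 the guard is a' < j0. *)
pose g a' b' := let N := (a' + b').+1 in
  if (a' < nu N)%N then lam N ('X^(nu N - a'.+1, N - b'.+1) *: m) else 0.
have [B hB] := @xvec_bound p'.+1 q'.+1 isT isT v w vw (y + u).
(* Only monomials of degree y + u pair nontrivially with m, so B bounds both exponents. *)
exists (mkpoly v w B g) => N c e /=.
have g0 a' b' : ~~ ((a' < B)%N && (b' < B)%N) -> g a' b' = 0.
  move=> nB; rewrite /g; case: ifP => // h; apply: lam_homog um _ => /eqP.
  have e1 : (nu (a' + b').+1 = a' + (nu (a' + b').+1 - a'.+1).+1)%N by move: h; lia.
  have e2 : ((a' + b').+1 = b' + ((a' + b').+1 - b'.+1).+1)%N by lia.
  by rewrite (dgE _ e1 e2) => /eqP/hB; rewrite (negPf nB).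
rewrite cf_mkpoly //; case: (ltnP c (nu N)) => cN /=; last first.
  by rewrite -(subnK cN) addnC exprD -mulrA -scalerA lamV.
case: ltnP => eN; last exact: hm.
rewrite /g; set a' := (nu N - c.+1)%N; set b' := (N - e.+1)%N; set M := (a' + b').+1.
have aM : (a' < nu M)%N.
  rewrite /M; case: (posnP a) => [a0|a_gt0].
    by rewrite a0 mul0n add0n /a' a0 mul0n add0n ltn_subrL //=; move: cN; rewrite a0; lia.
  by nia.
rewrite aM -(lamTt N M) -(lamTt M N) addnC; congr (lam _ _); rewrite !scalerA.
congr (_ *: _); rewrite mulrACA [RHS]mulrACA -!exprD; congr (_ ^+ _ * _ ^+ _).
  by move: aM; rewrite /a'; nia.
by rewrite /M /b'; lia.
Qed.

End DualRelation.

(** * Line bundles *)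

Section Polys.
Variables (k : closedFieldType) (v w : 'I_2).
Hypothesis vw : v != w.
Local Notation S := {mpoly k[2]}.

Lemma cfC (f : S) a b : cf v w f a b = cf w v f b a.
Proof. by rewrite /cf /mon addmC. Qed.

Lemma Xpow_eq0 t (f : S) : 'X_v ^+ t * f = 0 -> f = 0.
Proof.
move=> e; apply: (cfP vw) => a b; rewrite cf0.
have := cfXv vw f t (a + t) b; rewrite e cf0 leq_addl addnK => <- //.
Qed.

Lemma Xpow_inj t (f g : S) : 'X_v ^+ t * f = 'X_v ^+ t * g -> f = g.
Proof.
move=> e; apply/eqP; rewrite -subr_eq0; apply/eqP/(@Xpow_eq0 t).
by rewrite mulrBr e subrr.
Qed.

End Polys.

Section Coprime.
Variables (k : closedFieldType) (v w : 'I_2).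
Hypothesis vw : v != w.
Local Notation S := {mpoly k[2]}.

Lemma Xpow_coprime s t (f g : S) : 'X_v ^+ s * f = 'X_w ^+ t * g ->
  exists h : S, f = 'X_w ^+ t * h /\ g = 'X_v ^+ s * h.
Proof.
move=> e; have wv : w != v by rewrite eq_sym.
have [h fh] : exists h, f = 'X_w ^+ t * h.
  apply: (dvd_Xv wv) => a b lt.
  rewrite cfC; have := cfXv vw f s (b + s) a; rewrite leq_addl addnK => <-.
  by rewrite e cfC cfXv // leqNgt lt.
exists h; split=> //; apply: (Xpow_inj wv (t := t)).
by rewrite -e fh mulrCA.
Qed.

End Coprime.

Section Lines.
Variables (k : closedFieldType) (p' q' : nat).
Local Notation S := {mpoly k[2]}.
Local Notation grm := (grmod k p'.+1 q'.+1).
Local Notation L := (L p'.+1 q'.+1).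
Local Notation x_ := (xvec p'.+1 q'.+1).
Local Notation O := (@Oline k p'.+1 q'.+1).
Implicit Types (W : grm).

Lemma gpr_scale_homog W (e u : L) (f : S) (m : W) : gpr e m = m ->
  gpr u (f *: m) = hcomp (u - e) f *: m.
Proof.
move=> em; rewrite {1}[f]mpolyE scaler_suml gpr_sum_big.
rewrite /hcomp scaler_suml [RHS]big_mkcond /=; apply: eq_bigr => i _.
rewrite -!mul_mpolyC -scalerA gprC -[u in LHS](subrK (degL p'.+1 q'.+1 i)).
rewrite gprZ; last by move=> j; rewrite msuppX inE => /eqP ->.
rewrite -em gprK em subr_eq [degL _ _ i == _]eq_sym subr_eq addrC.
by case: ifP => _; rewrite ?scaler0 // scalerA.
Qed.

Lemma tor_line y (s : O y) : tor s -> s = 0.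
Proof. by move=> [t /(_ ord0)]; apply: (Xpow_eq0 (w := ord_max)). Qed.

Variables (v w : 'I_2).
Hypothesis vw : v != w.
Let wv : w != v. Proof. by rewrite eq_sym. Qed.

Lemma hcomp_homog e (f : S) : homogen (e : L) f -> hcomp e f = f.
Proof.
move=> hf; apply/mpolyP => m; rewrite mcoeff_hcomp; case: (boolP (m \in msupp f)) => [/hf ->|].
  by rewrite eqxx.
by move=> /memN_msupp_eq0 ->; rewrite if_same.
Qed.

Lemma homogen_hcomp e (f : S) : hcomp e f = f -> homogen (e : L) f.
Proof.
move=> ef m; rewrite mcoeff_msupp -ef mcoeff_hcomp; by case: (_ =P e) => // _ /eqP.
Qed.

Lemma gpr_lineX y t (u : 'I_2) : gpr (x_ u *+ t - y) ('X_u ^+ t : O y) = 'X_u ^+ t :> O y.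
Proof. by rewrite /= addrC subrK; apply/hcomp_homog/homogen_X. Qed.

(** Both sides of the last equation are images of X_v^t X_w^t, hence equal up to torsion only;
    enlarging t makes them equal, and projecting makes [al] and [be] homogeneous. *)
Lemma line_pts y W (h : coh_hom (O y) W) : exists t (al be : W),
  [/\ graph h ('X_v ^+ t, al), graph h ('X_w ^+ t, be),
      gpr (x_ v *+ t - y) al = al, gpr (x_ w *+ t - y) be = be &
      ('X_w : S) ^+ t *: al = ('X_v : S) ^+ t *: be].
Proof.
have [t ht] := coh_dom h (1 : S).
have [al0 hal0] := ht v; have [be0 hbe0] := ht w.
have hal := graphG (x_ v *+ t - y) hal0; have hbe := graphG (x_ w *+ t - y) hbe0.
pose al := gpr (x_ v *+ t - y) al0; pose be := gpr (x_ w *+ t - y) be0.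
have {}hal : graph h ('X_v ^+ t, al).
  by move: hal; rewrite -/al [_ *: _](mulr1 ('X_v ^+ t)) gpr_lineX.
have {}hbe : graph h ('X_w ^+ t, be).
  by move: hbe; rewrite -/be [_ *: _](mulr1 ('X_w ^+ t)) gpr_lineX.
have gal : gpr (x_ v *+ t - y) al = al by rewrite gprK eqxx.
have gbe : gpr (x_ w *+ t - y) be = be by rewrite gprK eqxx.
have := graphZ ('X_w ^+ t) hal; rewrite [_ *: _]mulrC => h1.
have [u hu] := coh_fun h1 (graphZ ('X_v ^+ t) hbe).
exists (t + u)%N, (('X_v : S) ^+ u *: al), (('X_w : S) ^+ u *: be); split.
- by rewrite addnC exprD; apply: graphZ.
- by rewrite addnC exprD; apply: graphZ.
- by rewrite gprX' mulrnDr addrAC addrK gal.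
- by rewrite gprX' mulrnDr addrAC addrK gbe.
- have /eqP := hu w; rewrite scalerBr subr_eq0 !scalerA => /eqP hw.
  have := congr1 (fun m => ('X_v : S) ^+ u *: m) hw; rewrite !scalerA => h2.
  rewrite !exprD (_ : 'X_w ^+ t * 'X_w ^+ u * 'X_v ^+ u = 'X_v ^+ u * ('X_w ^+ u * 'X_w ^+ t)); last by ring.
  by rewrite h2; congr (_ *: _); ring.
Qed.

(* A morphism O(y) -> W amounts to the images al, be of X_v^t, X_w^t for large t,
   subject to X_w^t al = X_v^t be. *)
Section LineMk.
Variables (y : L) (W : grm) (t : nat) (al be : W).
Hypotheses (gal : gpr (x_ v *+ t - y) al = al) (gbe : gpr (x_ w *+ t - y) be = be).
Hypothesis (e : ('X_w : S) ^+ t *: al = ('X_v : S) ^+ t *: be).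

Definition line_graph : set (O y * W) := [set u | exists f g : S,
  u.1 = 'X_v ^+ t * f + 'X_w ^+ t * g :> S /\ u.2 = f *: al + g *: be]%classic.

Lemma line_graph_graded : @graded_submod _ _ _ (dsum (O y) W) line_graph.
Proof.
split.
- by exists 0, 0; rewrite !mulr0 !scale0r /= !addr0.
- move=> [a b] [c d] [f [g /= [-> ->]]] [f' [g' /= [-> ->]]].
  exists (f + f'), (g + g'); rewrite /= !mulrDr !scalerDl; split; exact: addrACA.
- move=> r [a b] [f [g /= [-> ->]]]; exists (r * f), (r * g).
  split; last by rewrite /= scalerDr !scalerA.
  by rewrite [LHS]mulrDr; congr (_ + _); rewrite mulrCA.
- move=> u [a b] [f [g /= [-> ->]]].
  exists (hcomp (y + u - x_ v *+ t) f), (hcomp (y + u - x_ w *+ t) g); split.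
    rewrite /= hcompD -(hcomp_mul _ _ (@homogen_X k p'.+1 q'.+1 t v)).
    by rewrite -(hcomp_mul _ _ (@homogen_X k p'.+1 q'.+1 t w)) !subrK.
  rewrite /= gprD (gpr_scale_homog _ _ gal) (gpr_scale_homog _ _ gbe).
  by rewrite !opprB !addrA [u + y]addrC.
Qed.

Lemma line_graph_dom m : evt (fun m => exists n, line_graph (m, n)) m.
Proof.
exists t => u; have [->|->] := ord2E vw u.
  by exists ((m : S) *: al); exists m, 0; rewrite mulr0 scale0r !addr0.
by exists ((m : S) *: be); exists 0, m; rewrite mulr0 scale0r !add0r.
Qed.

Lemma line_graph_ker n : line_graph (0, n) -> tor n.
Proof.
move=> [f [g /= [e0 ->]]].
have /(Xpow_coprime vw)[h [-> eg]] : 'X_v ^+ t * f = 'X_w ^+ t * (- g).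
  by apply/eqP; rewrite mulrN -addr_eq0 -e0.
rewrite -[g]opprK eg mulrC -scalerA e scaleNr scalerA mulrC subrr.
exact: (sub0 (submod_tor _)).
Qed.

Definition line_mk : coh_hom (O y) W := mkcoh line_graph_graded line_graph_dom line_graph_ker.

Lemma line_mk_v : graph line_mk ('X_v ^+ t, al).
Proof. by exists 1, 0; rewrite mulr1 mulr0 scale1r scale0r !addr0. Qed.

Lemma line_mk_w : graph line_mk ('X_w ^+ t, be).
Proof. by exists 0, 1; rewrite mulr1 mulr0 scale1r scale0r !add0r. Qed.

End LineMk.

Lemma line_eq y W (f g : coh_hom (O y) W) t al be :
  graph f ('X_v ^+ t, al) -> graph g ('X_v ^+ t, al) ->
  graph f ('X_w ^+ t, be) -> graph g ('X_w ^+ t, be) -> coh_eq f g.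
Proof.
move=> fv gv fw gw; apply: coh_eq_evt => m; exists t => u.
have [->|->] := ord2E vw u.
  exists ((m : S) *: al); rewrite [_ *: _](mulrC ('X_v ^+ t)).
  by split; apply: graphZ.
exists ((m : S) *: be); rewrite [_ *: _](mulrC ('X_w ^+ t)).
by split; apply: graphZ.
Qed.

Section Omul.
Variables (y z : L) (e : S).
Hypothesis he : homogen (z - y) e.

Lemma omulG u (m : O y) : e * gpr u m = gpr u (e * m : O z).
Proof. by rewrite /= -(hcomp_mul _ _ he) addrC addrA subrK addrC. Qed.

Definition omul : coh_hom (O y) (O z) :=
  @coh_map k p' q' (O y) (O z) (fun s => e * s) (mulrDr e) (fun f m => mulrCA e f m) omulG.

Lemma graph_omul s s' : graph omul (s, s') = (s' = e * s).
Proof. by []. Qed.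

End Omul.

(** Passing to the quotient category creates no new maps between line bundles: X_w^t al = X_v^t be
    forces al = X_v^t c and be = X_w^t c by coprimality. *)
Lemma line_hom y z (h : coh_hom (O y) (O z)) :
  exists c (hc : homogen (z - y) c), coh_eq h (omul hc).
Proof.
have [t [al [be [hal hbe gal gbe e]]]] := line_pts h.
have [c [ec1 ec2]] := Xpow_coprime wv e.
have hc : homogen (z - y) c.
  apply/homogen_hcomp/(Xpow_inj vw (t := t)).
  rewrite -(hcomp_mul _ _ (@homogen_X k p'.+1 q'.+1 t v)) -ec1 -[RHS]gal /=.
  by congr (hcomp _ _); rewrite [RHS]addrA addrAC.
exists c, hc; apply: (line_eq hal _ hbe); rewrite graph_omul mulrC //.
Qed.

(** A monomial of degree -x_v would give a relation between x_v and x_w with nonnegative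
    coefficients, not both zero. *)
Lemma line_neg y z (c : S) : homogen (z - y) c -> z - y = - x_ v \/ z - y = - x_ w -> c = 0.
Proof.
move=> hc hz; apply: (cfP vw) => a b; rewrite cf0; apply/eqP/negPn/negP.
rewrite /cf -mcoeff_msupp => /hc; rewrite degL_mon // => e.
have h1 : x_ v *~ (a%:Z + 1) + x_ w *~ b%:Z = 0 \/ x_ v *~ a%:Z + x_ w *~ (b%:Z + 1) = 0.
  case: hz => hz; rewrite hz in e; [left|right].
    by rewrite mulrzDr mulr1z addrAC -!pmulrn e addNr.
  by rewrite mulrzDr mulr1z addrA -!pmulrn e addNr.
by case: h1 => /(xvec_indep (isT : (0 < p'.+1)%N) (isT : (0 < q'.+1)%N) vw)[]; lia.
Qed.

Lemma line_end y (c : S) : homogen (y - y : L) c -> exists d : k, c = d%:MP.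
Proof.
move=> hc; exists (cf v w c 0 0); apply: (cfP vw) => a b.
rewrite [RHS](_ : _ = cf v w (cf v w c 0 0 *: ('X_v ^+ 0 * 'X_w ^+ 0)) a b); last first.
  by rewrite !expr0 mulr1 -mul_mpolyC mulr1.
rewrite cfZ cf_mon //; case: (boolP ((0 == a)%N && (0 == b)%N)) => [/andP[/eqP <- /eqP <-]|ne].
  by rewrite mulr1.
rewrite mulr0; apply/eqP/negPn/negP; rewrite /cf -mcoeff_msupp => /hc.
rewrite degL_mon // subrr !pmulrn.
move=> /(xvec_indep (isT : (0 < p'.+1)%N) (isT : (0 < q'.+1)%N) vw)[//|//|[a0] [b0]].
by rewrite a0 b0 in ne.
Qed.

Lemma local_line y : localH (O y).
Proof.
move=> T; have [c [hc e]] := line_hom (rep T).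
have {}e : T = cls (omul hc) by rewrite -[T]repK; apply/clsP.
have [d ed] := line_end hc.
have [d0|d0] := eqVneq d 0.
  right; exists (hid (O y)); rewrite hcmp1 h1cmp.
  suff -> : T = 0 by rewrite subr0.
  rewrite e -cls0; apply/clsP/coh_eq_sub => s s'.
  by rewrite graph_omul ed d0 mpolyC0 mul0r.
left; have hd : homogen (y - y : L) (d^-1)%:MP by rewrite subrr; apply: homogen_C.
exists (cls (omul hd)); rewrite e -!cls_comp; split; apply/clsP/coh_eq_sub => s s' [a []];
  rewrite !graph_omul /= => -> ->.
- by rewrite ed mulrA -mpolyCM mulVf // mpolyC1 mul1r.
- by rewrite ed mulrA -mpolyCM divff // mpolyC1 mul1r.
Qed.

Lemma line_nonzero y : ~ zeroH (O y).
Proof.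
rewrite /zeroH -cls0 => /clsP/coh_eqE/(_ (1 : S) (1 : S) 0 erefl erefl).
by rewrite subr0 => /tor_line/eqP; rewrite oner_eq0.
Qed.

End Lines.

(** * The dual relation at the image of a line bundle *)

Section LineRetract.
Variables (k : closedFieldType) (p' q' : nat).
Local Notation S := {mpoly k[2]}.
Local Notation grm := (grmod k p'.+1 q'.+1).
Local Notation L := (L p'.+1 q'.+1).
Local Notation x_ := (xvec p'.+1 q'.+1).
Variables (v w : 'I_2).
Hypothesis vw : v != w.
Local Notation "'X^( a , b )" := (('X_v : S) ^+ a * ('X_w : S) ^+ b).
Variable y : L.
Variables (W : grm) (t : nat) (al be : W) (lam : nat -> W -> k) (dg : nat -> L).
Hypothesis dgH : forall N, dg N + (y + (x_ v + x_ w)) = x_ v *+ N + x_ w *+ N.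
Hypothesis lamZ : forall N c m, lam N (c%:MP *: m) = c * lam N m.
Hypothesis lamT : forall N m, lam N.+1 ('X^(1, 1) *: m) = lam N m.
Hypothesis lamV : forall N m, lam N (('X_v : S) ^+ N *: m) = 0.
Hypothesis lamW : forall N m, lam N (('X_w : S) ^+ N *: m) = 0.
Hypothesis lamG : forall N m, lam N m = lam N (gpr (dg N) m).
Hypothesis gal : gpr (x_ v *+ t - y) al = al.
Hypothesis e : ('X_w : S) ^+ t *: al = ('X_v : S) ^+ t *: be.
Hypothesis lam1 : lam t.+1 (('X_w : S) ^+ t *: al) = 1.

Lemma lamT_line N s m : lam (N + s) ('X^(s, s) *: m) = lam N m.
Proof. by have := lamTt lamT N s m; rewrite mul1n. Qed.

Lemma lamVt N s m : (N <= s)%N -> lam N (('X_v : S) ^+ s *: m) = 0.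
Proof. by move=> /subnK <-; rewrite addnC exprD -scalerA lamV. Qed.
Lemma lamWt N s m : (N <= s)%N -> lam N (('X_w : S) ^+ s *: m) = 0.
Proof. by move=> /subnK <-; rewrite addnC exprD -scalerA lamW. Qed.

(** Says that the dual relation sends al = h(X_v^t) back to X_v^t. Used again with v and w exchanged
    for [be], it shows that the dual morphism is a retraction of h. *)
Lemma dual_point N c e' : lam N ('X^(c, e') *: al) =
  if (c < N)%N && (e' < N)%N then cf v w ('X_v ^+ t : S) (N - c.+1) (N - e'.+1) else 0.
Proof.
have XvE a b : cf v w ('X_v ^+ t : S) a b = ((t == a) && (0 == b)%N)%:R.
  by rewrite -[X in cf v w X]mulr1 -(expr0 'X_w) cf_mon.
rewrite XvE; case: (ltnP e' N) => eN; last first.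
  by rewrite andbF mulrC -scalerA lamWt.
rewrite andbT; case: (leqP N (c + t)) => ct.
  (* Moving t stages up produces the factor X_w^t, which [e] trades for X_v^t; then X_v has exponent
     at least N + t, where the functional vanishes. *)
  rewrite -(lamT_line N t).
  have -> : 'X^(t, t) *: ('X^(c, e') *: al) = ('X_v : S) ^+ (c + t + t) *: (('X_w : S) ^+ e' *: be).
    rewrite scalerA (_ : 'X^(t, t) * 'X^(c, e') = 'X^(c + t, e') * 'X_w ^+ t); last first.
      by rewrite exprD; ring.
    by rewrite -scalerA e !scalerA; congr (_ *: _); rewrite !exprD; ring.
  rewrite lamVt ?leq_add2r //; case: ltnP => // cN.
  by rewrite (_ : (t == _) = false) //; apply/eqP; move: ct cN; clear; lia.
have cN : (c < N)%N by move: ct; clear; lia.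
have dgH' N' : dg N' + (y + (x_ v + x_ w)) = x_ v *+ (1 * N' + 0) + x_ w *+ N'.
  by rewrite mul1n addn0.
have hE : (x_ v *+ t - y + x_ v *+ c + x_ w *+ e' == dg N) =
    (x_ v *+ (N - c.+1) + x_ w *+ (N - e'.+1) == y + (x_ v *+ t - y)).
  by apply: (dgE dgH'); rewrite ?mul1n ?addn0 subnK.
rewrite [y + _]addrC subrK in hE.
rewrite cN; have [hd|hd] := eqVneq (x_ v *+ t - y + x_ v *+ c + x_ w *+ e') (dg N); last first.
  rewrite (lam_homog lamZ lamG gal); last exact/eqP.
  rewrite (negPf hd) in hE; case: eqP => // tE; case: eqP => // eE.
  by move: hE; rewrite -tE -eE mulr0n addr0 eqxx.
rewrite hd eqxx in hE; move/esym/eqP: hE => hE.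
have tN : (t <= N - c.+1)%N by move: ct; clear; lia.
(* In the right degree, independence leaves only c = N - t - 1 and e' = N - 1, the case normalised
   by [lam1]. *)
have [h1 h2] : (N - c.+1 - t)%N%:Z = 0 /\ (N - e'.+1)%N%:Z = 0.
  apply: (xvec_indep (isT : (0 < p'.+1)%N) (isT : (0 < q'.+1)%N) vw) => //.
  by rewrite -!pmulrn mulrnBr // addrAC hE subrr.
have tE : t = (N - c.+1)%N by move: h1 tN; clear; lia.
have eE : 0%N = (N - e'.+1)%N by move: h2; clear; lia.
rewrite -tE -eE !eqxx /= -lam1.
have e't : e' = (c + t)%N by move: tE eE eN ct; clear; lia.
rewrite -(lamT_line t.+1 c) (_ : t.+1 + c = N)%N; last by move: tE eE eN ct; clear; lia.
by congr (lam _ _); rewrite scalerA e't exprD mulrA.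
Qed.

End LineRetract.

(** * The Koszul sequence of a line bundle is almost split *)

Section LineAR.
Variables (k : closedFieldType) (p' q' : nat).
Local Notation S := {mpoly k[2]}.
Local Notation grm := (grmod k p'.+1 q'.+1).
Local Notation L := (L p'.+1 q'.+1).
Local Notation x_ := (xvec p'.+1 q'.+1).
Local Notation O := (@Oline k p'.+1 q'.+1).
Implicit Types (W : grm).
Variables (v w : 'I_2).
Hypothesis vw : v != w.
Let wv : w != v. Proof. by rewrite eq_sym. Qed.
Local Notation "'X^( a , b )" := (('X_v : S) ^+ a * ('X_w : S) ^+ b).
Variable y : L.
Let yv := y + x_ v.
Let yw := y + x_ w.
Let yz := y + x_ v + x_ w.

Lemma homX1 (u : 'I_2) z : homogen (z + x_ u - z : L) ('X_u : S).
Proof. by rewrite addrAC subrr add0r -[x_ u]mulr1n -['X_u]expr1; apply: homogen_X. Qed.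

Lemma homX1' : homogen (yz - yw : L) ('X_v : S).
Proof. by rewrite /yz [y + _ + _]addrAC; apply: homX1. Qed.

(** With [line_g_fun] this is the Koszul complex of (X_v, X_w). As modules it fails to be exact only
    at the right, where the cokernel S / (X_v, X_w) is one dimensional. *)
Definition line_f_fun (s : O y) : dsum (O yw) (O yv) := ('X_w * s, 'X_v * s).
Definition line_g_fun (s : dsum (O yw) (O yv)) : O yz := 'X_v * s.1 - 'X_w * s.2.

Lemma line_f_D s s' : line_f_fun (s + s') = line_f_fun s + line_f_fun s'.
Proof. by congr pair; apply: mulrDr. Qed.
Lemma line_f_Z (r : S) s : line_f_fun (r *: s) = r *: line_f_fun s.
Proof. by congr pair; apply: mulrCA. Qed.
Lemma line_f_G u s : line_f_fun (gpr u s) = gpr u (line_f_fun s).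
Proof. by congr pair; [exact: (omulG (@homX1 w y)) | exact: (omulG (@homX1 v y))]. Qed.
Lemma line_g_D s s' : line_g_fun (s + s') = line_g_fun s + line_g_fun s'.
Proof. by rewrite /line_g_fun /= !mulrDr opprD addrACA. Qed.
Lemma line_g_Z (r : S) s : line_g_fun (r *: s) = r *: line_g_fun s.
Proof. by rewrite /line_g_fun /= [RHS]mulrBr; congr (_ - _); apply: mulrCA. Qed.
Lemma line_g_G u s : line_g_fun (gpr u s) = gpr u (line_g_fun s).
Proof.
rewrite /line_g_fun [in RHS]gprB; congr (_ - _).
  exact: (omulG homX1').
exact: (omulG (@homX1 w yv)).
Qed.

Definition line_f : coh_hom (O y) (dsum (O yw) (O yv)) := coh_map line_f_D line_f_Z line_f_G.
Definition line_g : coh_hom (dsum (O yw) (O yv)) (O yz) := coh_map line_g_D line_g_Z line_g_G.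

Lemma graph_line_f s s' : graph line_f (s, s') = (s' = line_f_fun s).
Proof. by []. Qed.
Lemma graph_line_g s s' : graph line_g (s, s') = (s' = line_g_fun s).
Proof. by []. Qed.

Lemma line_exact : exact_at line_f line_g.
Proof.
split.
- move=> s; rewrite graph_line_f => h.
  have {}h : 'X_v * (s : S) = 0 := esym (congr1 snd h).
  rewrite (@Xpow_eq0 _ v w vw 1 s h).
  exact: (sub0 (submod_tor _)).
- move=> s a b; rewrite graph_line_f graph_line_g => -> ->.
  rewrite /line_g_fun /= mulrCA subrr; exact: (sub0 (submod_tor _)).
- move=> [a b]; rewrite graph_line_g /line_g_fun /= => /esym/subr0_eq.
  rewrite -['X_v]expr1 -['X_w]expr1 => /(Xpow_coprime vw)[h [-> ->]].
  by apply: evt_base; exists h.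
- move=> z; exists 1%N => u; rewrite expr1; have [->|->] := ord2E vw u.
    have h : line_g_fun ((z : S), (0 : S)) = ('X_v : S) *: z by rewrite /line_g_fun /= mulr0 subr0.
    by exists ((z : S), 0 : S); apply: esym h.
  have h : line_g_fun ((0 : S), - (z : S)) = ('X_w : S) *: z.
    by rewrite /line_g_fun /= mulr0 sub0r mulrN opprK.
  by exists (0 : S, - (z : S)); apply: esym h.
Qed.

(** A retraction would have components of degrees -x_w and -x_v, both zero. *)
Lemma line_not_split : ~ smonoH (cls line_f).
Proof.
move=> [r hr]; have [h1 h2 h3 h4 h5] := biprod_dsum (O yw) (O yv).
have E z (h : Hom (O z) (O y)) : z = yw \/ z = yv -> h = 0.
  move=> hz; have [c [hc e]] := line_hom vw (rep h).
  have c0 : c = 0.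
    apply: (line_neg vw hc); case: hz => ->; [right|left];
    by rewrite opprD addrA subrr add0r.
  rewrite -[h]repK -cls0; apply/clsP/(coh_eq_trans e)/coh_eq_sub => s s'.
  by rewrite graph_omul c0 mul0r.
apply: (@line_nonzero k p' q' y); rewrite /zeroH -hr -[r]hcmp1 -h5 hcmpDr !hcmpA.
by rewrite (E _ (r ** inlH _ _)%coh) ?(E _ (r ** inrH _ _)%coh) ?h0cmp ?addr0 ?h0cmp //; [right|left].
Qed.

Lemma line_left_almost_split : left_almost_split (cls line_f).
Proof.
split=> [|W h hN]; first exact: line_not_split.
have [t [al [be [hal hbe gal gbe e]]]] := line_pts v w (rep h).
pose dg (N : nat) : L := x_ v *+ N + x_ w *+ N - (y + (x_ v + x_ w)).
have dgH N : dg N + (y + (x_ v + x_ w)) = x_ v *+ N + x_ w *+ N by rewrite subrK.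
have dgS N : dg N.+1 = dg N + x_ w *+ 1 + x_ v *+ 1.
  apply: (addIr (y + (x_ v + x_ w))); rewrite dgH addrAC [_ + x_ w *+ 1 + _]addrAC dgH.
  by rewrite !mulrSr !mulr0n !add0r -[RHS]addrA [x_ w + x_ v]addrC addrACA.
(* Only the component of degree [dg N] is tested, so the functional vanishes on (X_v^N, X_w^N) W and
   in all other degrees. *)
pose B (N : nat) (m : W) := exists a b : W,
  gpr (dg N) m = ('X_v : S) ^+ N *: a + ('X_w : S) ^+ N *: b.
have hB N : ksub (B N).
  split.
  - by exists 0, 0; rewrite gpr0 !scaler0 addr0.
  - move=> m n [a [b h1]] [a' [b' h2]]; exists (a + a'), (b + b').
    by rewrite gprD h1 h2 !scalerDr addrACA.
  - move=> c m [a [b h1]]; exists (c%:MP *: a), (c%:MP *: b).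
    by rewrite gprC h1 scalerDr !scalerA ![c%:MP * _]mulrC.
have thB N m : B N m -> B N.+1 ('X^(1, 1) *: m).
  move=> [a [b h1]]; exists (('X_w : S) *: a), (('X_v : S) *: b).
  rewrite dgS -scalerA gprX gprX h1 !scalerDr !scalerA; congr (_ *: _ + _ *: _).
    by rewrite !expr1 !exprS; ring.
  by rewrite !expr1 !exprS; ring.
have thK K m : 'X^(1, 1) ^+ K *: m = 'X^(K, K) *: m.
  by rewrite !expr1 exprMn.
have dgE1 K : dg (t + K).+1 = x_ v *+ t - y + x_ v *+ K + x_ w *+ (t + K).
  have dgH' N' : dg N' + (y + (x_ v + x_ w)) = x_ v *+ (1 * N' + 0) + x_ w *+ N'.
    by rewrite mul1n addn0 dgH.
  apply/esym/eqP; rewrite (@dgE _ _ _ _ _ _ _ _ dgH' _ _ _ _ t 0%N) ?mul1n ?addn0 ?addnS //.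
  by rewrite mulr0n addr0 [y + _]addrC subrK.
have ge K : gpr (dg (t + K).+1) ('X^(K, K) *: (('X_w : S) ^+ t *: al)) =
    'X^(K, K) *: (('X_w : S) ^+ t *: al).
  have -> : 'X^(K, K) *: (('X_w : S) ^+ t *: al) = ('X_w : S) ^+ (t + K) *: (('X_v : S) ^+ K *: al).
    by rewrite !scalerA exprD; congr (_ *: _); ring.
  by rewrite dgE1 !gprX gal.
(* At stage t + 1 the socle generator is X_v^t X_w^t, and X_w^t al is its image under h. The case
   distinction is whether this class dies in the colimit. *)
have [[K [a0 [b0 hab]]]|nB] := pselect (exists K, B (t.+1 + K)%N ('X^(1, 1) ^+ K *: (('X_w : S) ^+ t *: al))).
  pose N := (t + K).+1; rewrite addSn -/N in hab.
  pose a := gpr (dg N - x_ v *+ N) a0; pose b := gpr (dg N - x_ w *+ N) b0.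
  have M : 'X^(K, K) *: (('X_w : S) ^+ t *: al) = ('X_v : S) ^+ N *: a + ('X_w : S) ^+ N *: b.
    by rewrite -!gprX' -gprD -hab gprK eqxx thK ge.
  have E1 u : x_ u *+ N - (y + x_ u) - x_ u *+ K = x_ u *+ t - y.
    by rewrite /N mulrSr mulrnDr opprD [- y - _]addrC addrA addrK addrAC addrK.
  have F1 : dg N - x_ w *+ N = x_ v *+ N - (y + (x_ v + x_ w)) by rewrite /dg addrAC addrK.
  have F2 : dg N - x_ v *+ N = x_ w *+ N - (y + (x_ v + x_ w)).
    by rewrite /dg addrAC [x_ v *+ N + _]addrC addrK.
  (* [g1] to [g4], [e1] and [e2] are the data of two maps: on O(y + x_v), X_v^N goes to X_v^K al -
     X_w b and X_w^N to X_w a; on O(y + x_w), X_v^N goes to X_v b and X_w^N to X_w^K be - X_v a. The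
     corrections a and b cancel after composing with f. *)
  have g1 : gpr (x_ v *+ N - yv) (('X_v : S) ^+ K *: al - ('X_w : S) ^+ 1 *: b) =
      ('X_v : S) ^+ K *: al - ('X_w : S) ^+ 1 *: b.
    rewrite gprB !gprX' E1 gal /b; congr (_ - _ *: _); rewrite gprK F1 /yv mulr1n -addrA -opprD.
    by rewrite -addrA eqxx.
  have g2 : gpr (x_ w *+ N - yv) (('X_w : S) ^+ 1 *: a) = ('X_w : S) ^+ 1 *: a.
    rewrite gprX' /a; congr (_ *: _); rewrite gprK F2 /yv mulr1n -addrA -opprD.
    by rewrite -addrA eqxx.
  have g3 : gpr (x_ v *+ N - yw) (('X_v : S) ^+ 1 *: b) = ('X_v : S) ^+ 1 *: b.
    rewrite gprX' /b; congr (_ *: _); rewrite gprK F1 /yw mulr1n -addrA -opprD.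
    by rewrite -addrA [x_ w + _]addrC eqxx.
  have g4 : gpr (x_ w *+ N - yw) (('X_w : S) ^+ K *: be - ('X_v : S) ^+ 1 *: a) =
      ('X_w : S) ^+ K *: be - ('X_v : S) ^+ 1 *: a.
    rewrite gprB !gprX' E1 gbe /a; congr (_ - _ *: _); rewrite gprK F2 /yw mulr1n -addrA -opprD.
    by rewrite -addrA [x_ w + _]addrC eqxx.
  have e1 : ('X_w : S) ^+ N *: (('X_v : S) ^+ K *: al - ('X_w : S) ^+ 1 *: b) =
      ('X_v : S) ^+ N *: (('X_w : S) ^+ 1 *: a).
    apply/eqP; rewrite scalerBr subr_eq; apply/eqP.
    have := congr1 (fun m => ('X_w : S) *: m) M; rewrite scalerDr !scalerA expr1 => M'.
    rewrite (_ : 'X_w ^+ N * 'X_v ^+ K = 'X_w * 'X^(K, K) * 'X_w ^+ t); last first.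
      by rewrite /N exprS exprD; ring.
    by rewrite M'; congr (_ *: _ + _ *: _); ring.
  have e2 : ('X_w : S) ^+ N *: (('X_v : S) ^+ 1 *: b) =
      ('X_v : S) ^+ N *: (('X_w : S) ^+ K *: be - ('X_v : S) ^+ 1 *: a).
    apply/eqP; rewrite scalerBr eq_sym subr_eq; apply/eqP.
    have := congr1 (fun m => ('X_v : S) *: m) M.
    rewrite e scalerDr !scalerA expr1 [RHS]addrC => M'.
    rewrite (_ : 'X_v ^+ N * 'X_w ^+ K = 'X_v * 'X^(K, K) * 'X_v ^+ t); last first.
      by rewrite /N exprS exprD; ring.
    by rewrite M'; congr (_ *: _ + _ *: _); ring.
  have sw (m : W) : ('X_v : S) *: (('X_w : S) *: m) = ('X_w : S) *: (('X_v : S) *: m).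
    by rewrite !scalerA mulrC.
  pose A1 := line_mk vw g1 g2 e1; pose A2 := line_mk vw g3 g4 e2.
  exists (cls (coh_add (coh_comp A1 (coh_snd (O yw) (O yv))) (coh_comp A2 (coh_fst (O yw) (O yv))))).
  rewrite -[h]repK -cls_comp; apply/clsP.
  apply: (@line_eq _ _ _ _ _ vw _ _ _ _ N (('X_v : S) *: (('X_v : S) ^+ K *: al))
     (('X_w : S) *: (('X_w : S) ^+ K *: be))).
  - have hX : 'X_v * 'X_v ^+ K * 'X_v ^+ t = 'X_v ^+ N :> S by rewrite /N exprS exprD; ring.
    by rewrite -hX scalerA; apply: graphZ.
  - exists (line_f_fun ('X_v ^+ N : S)); split; first exact: erefl.
    exists (('X_v : S) *: (('X_v : S) ^+ K *: al - ('X_w : S) ^+ 1 *: b)), (('X_w : S) *: (('X_v : S) ^+ 1 *: b)).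
    split.
    + by rewrite /= !expr1 scalerBr sw subrK.
    + exists ('X_v * 'X_v ^+ N : S); split; first exact: erefl.
      by have := line_mk_v vw g1 g2 e1 => /(graphZ 'X_v).
    + exists ('X_w * 'X_v ^+ N : S); split; first exact: erefl.
      by have := line_mk_v vw g3 g4 e2 => /(graphZ 'X_w).
  - have hX : 'X_w * 'X_w ^+ K * 'X_w ^+ t = 'X_w ^+ N :> S by rewrite /N exprS exprD; ring.
    by rewrite -hX scalerA; apply: graphZ.
  - exists (line_f_fun ('X_w ^+ N : S)); split; first exact: erefl.
    exists (('X_v : S) *: (('X_w : S) ^+ 1 *: a)), (('X_w : S) *: (('X_w : S) ^+ K *: be - ('X_v : S) ^+ 1 *: a)).
    split.
    + by rewrite /= !expr1 scalerBr sw addrC subrK.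
    + exists ('X_v * 'X_w ^+ N : S); split; first exact: erefl.
      by have := line_mk_w vw g1 g2 e1 => /(graphZ 'X_v).
    + exists ('X_w * 'X_w ^+ N : S); split; first exact: erefl.
      by have := line_mk_w vw g3 g4 e2 => /(graphZ 'X_w).
have [|lam [lD lZ lT lB l1]] := @colimit_functional k W 'X^(1, 1) B hB thB t.+1 (('X_w : S) ^+ t *: al).
  by move=> K hK; apply: nB; exists K.
(* The class survives, so the dual morphism of the functional will be a retraction of h. *)
exfalso; apply: hN.
have lamG N m : lam N m = lam N (gpr (dg N) m).
  apply/eqP; rewrite -subr_eq0; apply/eqP.
  have -> : lam N m - lam N (gpr (dg N) m) = lam N (m - gpr (dg N) m).
    by rewrite lD -scaleN1r -mpolyC1 -mpolyCN lZ mulN1r.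
  apply: lB; exists 0, 0; rewrite !scaler0 addr0 gprB gprK eqxx subrr //.
have lamV N m : lam N (('X_v : S) ^+ N *: m) = 0.
  by apply: lB; exists (gpr (dg N - x_ v *+ N) m), 0; rewrite scaler0 addr0 gprX'.
have lamW N m : lam N (('X_w : S) ^+ N *: m) = 0.
  by apply: lB; exists 0, (gpr (dg N - x_ w *+ N) m); rewrite scaler0 add0r gprX'.
have wT N m : lam N.+1 (('X_w ^+ 1 * 'X_v ^+ 1 : S) *: m) = lam N m by rewrite mulrC lT.
have dgHw N : dg N + (y + (x_ w + x_ v)) = x_ w *+ N + x_ v *+ N.
  by rewrite [x_ w + x_ v]addrC dgH addrC.
have pv := dual_point vw dgH lZ lT lamV lamW lamG gal e l1.
have l1' : lam t.+1 (('X_v : S) ^+ t *: be) = 1 by rewrite -e.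
have pw := dual_point wv dgHw lZ wT lamW lamV lamG gbe (esym e) l1'.
have dgH' N' : dg N' + (y + (x_ v + x_ w)) = x_ v *+ (1 * N' + 0) + x_ w *+ N'.
  by rewrite mul1n addn0.
have lamV' N m : lam N (('X_v : S) ^+ (1 * N + 0) *: m) = 0 by rewrite mul1n addn0.
have hG := dual_rel_graded vw dgH' lD lZ lamG.
have sW : submod (fun m => exists f : O y, dual_rel v w 1 0 lam (m, f)).
  have [G0 GD GZ GP] := hG; split.
  - by exists 0.
  - by move=> m m' [f hf] [f' hf']; exists (f + f'); apply: (GD (m, f) (m', f')).
  - by move=> r m [f hf]; exists (r *: f); apply: (GZ r (m, f)).
have hd m : evt (fun m => exists f : O y, dual_rel v w 1 0 lam (m, f)) m.
  suff key u : exists f : O y, dual_rel v w 1 0 lam (gpr u m, f).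
    exact: evt_base (@graded_gpr_all _ _ _ W _ m sW key).
  apply: (dual_rel_dom vw dgH' lZ lT lamV' lamG (u := u)); first by rewrite gprK eqxx.
  by move=> N c e' _ /subnK <-; rewrite addnC exprD mulrCA -scalerA lamW.
have hk (f : O y) : dual_rel v w 1 0 lam (0, f) -> tor f.
  move=> hf; suff -> : f = 0 :> S by apply: (sub0 (submod_tor (O y))).
  apply: (cfP vw) => a b; rewrite cf0.
  (* At stage a + b + 1 the exponents complementary to (a, b) are (b, a), so every coefficient of f
     is a value of the functional at 0. *)
  have := hf (a + b).+1 b a; rewrite /= scaler0 mul1n addn0 !ltnS leq_addl leq_addr /= !subSS addnK addKn.
  by move=> <-; have := lZ (a + b).+1 0 0; rewrite scaler0 mul0r.
exists (cls (mkcoh hG hd hk)); rewrite -[h]repK -cls_comp; apply/clsP.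
apply: (@line_eq k p' q' v w vw y (O y) _ _ t ('X_v ^+ t : S) ('X_w ^+ t : S)) => //.
- by exists al; split=> // N c e'; rewrite /= mul1n addn0; apply: pv.
- exists be; split=> // N c e'; rewrite /= mul1n addn0 mulrC pw cfC andbC.
  by case: ifP.
Qed.

End LineAR.

(** * Torsion sheaves *)

Section BijIso.
Variables (k : closedFieldType) (p' q' : nat).
Local Notation grm := (grmod k p'.+1 q'.+1).
Variables (X Y : grm) (f : coh_hom X Y).
Hypothesis fm : forall x, graph f (x, 0) -> tor x.
Hypothesis fe : forall y, evt (fun y => exists x, graph f (x, y)) y.

Lemma bij_iso_graded : @graded_submod _ _ _ (dsum Y X) [set u | graph f (u.2, u.1)]%classic.
Proof.
split.
- exact: graph00.
- by move=> [a b] [c d]; apply: graphD.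
- by move=> e [a b]; apply: graphZ.
- by move=> x [a b]; apply: graphG.
Qed.

Definition coh_inv : coh_hom Y X := mkcoh bij_iso_graded fe fm.

(** The two hypotheses are exactly what the inverse relation needs in order to be a morphism. *)
Lemma bij_iso : isoH (cls f).
Proof.
exists (cls coh_inv); rewrite -!cls_comp; split; apply/clsP/coh_eqE.
- move=> x x' x2 [y [xy x'y]] e; rewrite -(e : x = x2).
  by apply: fm; have := graphB (x'y : graph f (x', y)) xy; rewrite subrr.
- move=> y y' y2 [x [xy xy']] e; rewrite -(e : y = y2).
  exact: coh_fun (xy' : graph f (x, y')) (xy : graph f (x, y)).
Qed.

End BijIso.

Section Tube.
Variables (k : closedFieldType) (p' q' : nat).
Local Notation S := {mpoly k[2]}.
Local Notation grm := (grmod k p'.+1 q'.+1).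
Local Notation L := (L p'.+1 q'.+1).
Local Notation x_ := (xvec p'.+1 q'.+1).
Local Notation O := (@Oline k p'.+1 q'.+1).
Implicit Types (W : grm).
Variables (v w : 'I_2).
Hypothesis vw : v != w.
Let wv : w != v. Proof. by rewrite eq_sym. Qed.

(* Uo i j = O(i x_v) / X_v^j is a model of S_{infinity,i}^(j), resp. S_{0,i}^(j). *)
Definition Uideal (i : int) (j : nat) (s : O (x_ v *~ i)) : Prop := exists g : S, s = 'X_v ^+ j * g.

Lemma Uideal_graded i j : @graded_submod _ _ _ (O (x_ v *~ i)) (@Uideal i j).
Proof.
split.
- by exists 0; rewrite mulr0.
- by move=> s s' [g ->] [g' ->]; exists (g + g'); rewrite mulrDr.
- by move=> f s [g ->]; exists (f * g); rewrite [LHS]mulrCA.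
- move=> x s [g ->]; exists (hcomp (x_ v *~ i + x - x_ v *+ j) g).
  by rewrite /= -(hcomp_mul _ _ (@homogen_X k p'.+1 q'.+1 j v)) subrK.
Qed.

Definition Uo (i : int) (j : nat) : grm := quotgr (Uideal_graded i j).
Definition upi (i : int) (j : nat) (s : S) : Uo i j := qpi (Uideal_graded i j) s.

Lemma upiP i j s s' : upi i j s = upi i j s' <-> exists g : S, s - s' = 'X_v ^+ j * g.
Proof. exact: qpiP. Qed.
Lemma upi0P i j s : upi i j s = 0 <-> exists g : S, s = 'X_v ^+ j * g.
Proof. exact: qpi0P. Qed.
Lemma upiD i j s s' : upi i j (s + s') = upi i j s + upi i j s'.
Proof. exact: qpiD. Qed.
Lemma upiZ i j (f s : S) : upi i j (f * s) = f *: upi i j s.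
Proof. exact: qpiZ. Qed.
Lemma upi0 i j : upi i j 0 = 0.
Proof. by apply/upi0P; exists 0; rewrite mulr0. Qed.
Lemma upiN i j s : upi i j (- s) = - upi i j s.
Proof. by apply: (addrI (upi i j s)); rewrite -upiD !subrr upi0. Qed.
Lemma upi_surj i j (a : Uo i j) : exists s : S, a = upi i j s.
Proof. by have [s ->] := qpi_surj a; exists s. Qed.
Lemma gpr_upi i j x s : gpr x (upi i j s) = upi i j (hcomp (x_ v *~ i + x) s).
Proof. exact: qgprE. Qed.

Lemma upi_coef i j s : upi i j s = 0 <-> forall a b, (a < j)%N -> cf v w s a b = 0.
Proof.
split=> [/upi0P[g ->] a b aj|h]; first by rewrite cfXv // leqNgt aj.
exact/upi0P/(dvd_Xv vw).
Qed.

Lemma U_Xv i j n (a : Uo i j) : (j <= n)%N -> ('X_v : S) ^+ n *: a = 0.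
Proof.
move=> jn; have [s ->] := upi_surj a; rewrite -upiZ; apply/upi0P.
by exists ('X_v ^+ (n - j) * s); rewrite mulrA -exprD subnKC.
Qed.

Lemma U_Xw i j n (a : Uo i j) : ('X_w : S) ^+ n *: a = 0 -> a = 0.
Proof.
have [s ->] := upi_surj a; rewrite -upiZ => /upi0P[g /(Xpow_coprime wv)[h [-> _]]].
by apply/upi0P; exists h.
Qed.

Lemma U_tor i j (a : Uo i j) : tor a -> a = 0.
Proof. by move=> [t /(_ w)/U_Xw]. Qed.

Lemma graph_U_fun W i j (h : coh_hom W (Uo i j)) m a b : graph h (m, a) -> graph h (m, b) -> a = b.
Proof. by move=> h1 h2; apply/subr0_eq/U_tor/coh_fun/h2. Qed.

(** On a torsion sheaf at X_v = 0 powers of X_v die, so only X_w has to be tested. *)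
Lemma U_evt i j (A : Uo i j -> Prop) (a : Uo i j) t : submod A ->
  A (('X_w : S) ^+ t *: a) -> evt A a.
Proof.
move=> hA h; exists (maxn t j) => u; have [->|->] := ord2E vw u.
  by rewrite U_Xv ?leq_maxr //; apply: sub0 hA.
exact: submod_exp hA (leq_maxl _ _) h.
Qed.

(* X_w acts bijectively on U_{i,j} in the quotient category, so a morphism
   U_{i,j} -> W amounts to the image al of X_w^M for large M, with X_v^j al = 0. *)
Section UMk.
Variables (W : grm) (i : int) (j M : nat) (al : W).
Hypotheses (gal : gpr (x_ w *+ M - x_ v *~ i) al = al) (e : ('X_v : S) ^+ j *: al = 0).

Definition U_graph : set (Uo i j * W) := [set u | exists f : S,
  u.1 = upi i j ('X_w ^+ M * f) /\ u.2 = f *: al]%classic.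

Lemma U_graph_graded : @graded_submod _ _ _ (dsum (Uo i j) W) U_graph.
Proof.
split.
- by exists 0; rewrite mulr0 scale0r upi0.
- move=> [a b] [c d] [f [/= -> ->]] [g [/= -> ->]].
  by exists (f + g); rewrite mulrDr upiD /= scalerDl.
- move=> r [a b] [f [/= -> ->]]; exists (r * f).
  by rewrite mulrCA; split; [apply: esym (upiZ _ _ r _) | apply: scalerA].
- move=> u [a b] [f [/= -> ->]]; exists (hcomp (x_ v *~ i + u - x_ w *+ M) f).
  rewrite -(hcomp_mul _ _ (@homogen_X k p'.+1 q'.+1 M w)) subrK; split; first exact: gpr_upi.
  by rewrite (gpr_scale_homog _ _ gal) opprB addrA [u + _]addrC.
Qed.

Lemma U_graph_dom m : evt (fun m => exists n, U_graph (m, n)) m.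
Proof.
have [s ->] := upi_surj m; exists (maxn M j) => u; have [->|->] := ord2E vw u.
  by rewrite U_Xv ?leq_maxr //; exists 0, 0; rewrite mulr0 upi0 scale0r.
exists (('X_w ^+ (maxn M j - M) * s) *: al), ('X_w ^+ (maxn M j - M) * s).
by split=> //=; rewrite -upiZ mulrA -exprD subnKC ?leq_maxl.
Qed.

Lemma U_graph_ker n : U_graph (0, n) -> tor n.
Proof.
move=> [f [/= /esym/upi0P[g /(Xpow_coprime wv)[h [-> _]]] ->]].
by rewrite mulrC -scalerA e scaler0; apply: (sub0 (submod_tor _)).
Qed.

Definition U_mk : coh_hom (Uo i j) W := mkcoh U_graph_graded U_graph_dom U_graph_ker.

Lemma U_mkE : graph U_mk (upi i j ('X_w ^+ M), al).
Proof. by exists 1; rewrite mulr1 scale1r. Qed.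

End UMk.

Lemma U_pts W i j (h : coh_hom (Uo i j) W) : exists M (al : W),
  [/\ graph h (upi i j ('X_w ^+ M), al), gpr (x_ w *+ M - x_ v *~ i) al = al &
      ('X_v : S) ^+ j *: al = 0].
Proof.
have [t /(_ w)[al0]] := coh_dom h (upi i j 1); rewrite -upiZ mulr1 => hal0.
have := graphG (x_ w *+ t - x_ v *~ i) hal0.
rewrite gpr_upi addrC subrK hcomp_homog; last exact: homogen_X.
set al := gpr _ al0 => hal; have gal : gpr (x_ w *+ t - x_ v *~ i) al = al by rewrite gprK eqxx.
have := graphZ ('X_v ^+ j) hal; rewrite U_Xv // => /coh_ker[u /(_ w) hu].
exists (t + u)%N, (('X_w : S) ^+ u *: al); split.
- by rewrite addnC exprD upiZ; apply: graphZ.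
- by rewrite gprX' mulrnDr addrAC addrK gal.
- by rewrite scalerA mulrC -scalerA.
Qed.

Lemma U_eq W i j (f g : coh_hom (Uo i j) W) M al :
  graph f (upi i j ('X_w ^+ M), al) -> graph g (upi i j ('X_w ^+ M), al) -> coh_eq f g.
Proof.
move=> hf hg; apply: coh_eq_evt => m; apply: (@U_evt _ _ _ _ M).
  split; first by exists 0; split; apply: graph00.
  - by move=> a b [n [? ?]] [n' [? ?]]; exists (n + n'); split; apply: graphD.
  - by move=> r a [n [? ?]]; exists (r *: n); split; apply: graphZ.
have [s ->] := upi_surj m; exists (s *: al); rewrite -upiZ mulrC upiZ.
by split; apply: graphZ.
Qed.

(** Up to finite dimension every subobject is X_v^t U, with t the least X_v-order occurring in B,
    capped at j; this is where uniseriality comes from. *)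
Lemma U_sub i j (B : Uo i j -> Prop) : graded_submod B -> exists t, [/\ (t <= j)%N,
  forall a, B a -> exists f : S, a = upi i j ('X_v ^+ t * f) &
  exists M, B (upi i j ('X_v ^+ t * 'X_w ^+ M))].
Proof.
move=> hB; have sB := graded_is_submod hB.
have exE : exists t, (t == j) || `[< exists s b, B (upi i j s) /\ cf v w s t b != 0 >].
  by exists j; rewrite eqxx.
case: (ex_minnP exE) => t ht tmin; exists t.
have tj : (t <= j)%N by apply: tmin; apply/orP; left; apply/eqP.
have dv a : B a -> exists f : S, a = upi i j ('X_v ^+ t * f).
  have [s ->] := upi_surj a => Bs.
  have [f ->] : exists f, s = 'X_v ^+ t * f; last by exists f.
  apply: (dvd_Xv vw) => a' b lt; apply/eqP/negPn/negP => ne.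
  suff : (t <= a')%N by rewrite leqNgt lt.
  by apply: tmin; apply/orP; right; apply/asboolP; exists s, b.
have Bj : exists M, B (upi i j ('X_v ^+ j * 'X_w ^+ M)).
  exists 0%N; have -> : upi i j ('X_v ^+ j * 'X_w ^+ 0) = 0.
    by apply/upi0P; exists ('X_w ^+ 0).
  exact: sub0 sB.
split=> //; case/orP: ht => [/eqP -> //|/asboolP[s [b [Bs sb]]]].
case: (ltnP t j) => [tj'|jt]; last first.
  by have -> : t = j by apply/eqP; rewrite eqn_leq tj.
(* Distinct powers of X_w have distinct degrees, so among the terms of X_v-order t this component
   keeps only X_v^t X_w^b. *)
pose s1 := hcomp (x_ v *+ t + x_ w *+ b) s.
have Bs1 : B (upi i j s1).
  have := gsub_gpr hB (x_ v *+ t + x_ w *+ b - x_ v *~ i) Bs.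
  by rewrite gpr_upi addrC subrK.
have [f hf] := dv _ Bs1; have {hf}[g hg] := proj1 (upiP _ _ _ _) hf.
have s1E : s1 = 'X_v ^+ t * (f + 'X_v ^+ (j - t) * g).
  by rewrite mulrDr mulrA -exprD subnKC // -hg addrC subrK.
move: (f + _) s1E => {f g hg} f s1E.
have f0 b' : cf v w f 0 b' = if b' == b then cf v w s t b else 0.
  have := cf_hcomp v w (x_ v *+ t + x_ w *+ b) s t b'; rewrite -/s1 s1E cfXv // leqnn subnn => ->.
  rewrite (inj_eq (addrI _)) !pmulrn (inj_eq (@xvec_inj p'.+1 q'.+1 isT isT w v wv)) eqz_nat.
  by case: eqP => [->|].
pose c := cf v w s t b.
have [h hE] : exists h, 'X_w ^+ b - c^-1 *: f = 'X_v ^+ 1 * h.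
  apply: (dvd_Xv vw) => a' b'; rewrite ltnS leqn0 => /eqP ->.
  rewrite cfD cfN cfZ f0 -['X_w ^+ b]mul1r -(expr0 'X_v) cf_mon // eqxx eq_sym /=.
  by case: eqP => _; rewrite ?mulr0 ?subr0 // mulVf ?subrr.
(* (X_w^M - X_v^(2^n) h) (X_w^M + X_v^(2^n) h) doubles the order of the error
   term, so that X_v^t X_w^M lies in B for some M. *)
have key n : exists M h, B (upi i j ('X_v ^+ t * ('X_w ^+ M - 'X_v ^+ (2 ^ n) * h))).
  elim: n => [|n [M [h' Bh]]].
    exists b, h; rewrite -hE opprB addrC subrK -scalerAr -s1E -mul_mpolyC upiZ.
    exact: (gsubZ hB).
  exists (M + M)%N, (h' * h').
  rewrite (_ : _ * _ = ('X_w ^+ M + 'X_v ^+ (2 ^ n) * h') * ('X_v ^+ t * ('X_w ^+ M - 'X_v ^+ (2 ^ n) * h'))).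
    by rewrite upiZ; apply: (gsubZ hB).
  by rewrite expnS mul2n -addnn !exprD; ring.
(* Since 2^j > j, the error term is now zero in [Uo i j]. *)
have [M [h' Bh]] := key j; exists M.
rewrite (_ : upi i j _ = upi i j ('X_v ^+ t * ('X_w ^+ M - 'X_v ^+ (2 ^ j) * h'))) //.
apply/upiP; exists ('X_v ^+ t * 'X_v ^+ (2 ^ j - j) * h').
have -> : 'X_v ^+ (2 ^ j) = 'X_v ^+ j * 'X_v ^+ (2 ^ j - j) :> S.
  by rewrite -exprD subnKC // ltnW // ltn_expl.
ring.
Qed.

(** The socle of U is spanned up to torsion by multiples of X_v^j. A nonzero kernel would contain
    it, so T is mono; if the range lay in X_v U, then X_v^j would kill it and T would vanish on the
    socle. *)
Lemma U_iso i j M (T : coh_hom (Uo i j.+1) (Uo i j.+1)) a :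
  graph T (upi i j.+1 ('X_v ^+ j * 'X_w ^+ M), a) -> a <> 0 -> isoH (cls T).
Proof.
move=> Ta a0.
have hK : graded_submod (fun x => graph T (x, 0)).
  split; first exact: graph00.
  - by move=> m n h h'; have := graphD h h'; rewrite addr0.
  - by move=> f m /(graphZ f); rewrite scaler0.
  - by move=> x m /(graphG x); rewrite gpr0.
have Kn n : ~ graph T (upi i j.+1 ('X_v ^+ j * 'X_w ^+ n), 0).
  move=> h; apply: a0; apply: (@U_Xw _ _ n).
  have h1 := graphZ ('X_w ^+ n) Ta; have h2 := graphZ ('X_w ^+ M) h.
  rewrite scaler0 -upiZ in h2; rewrite -upiZ in h1.
  apply: (graph_U_fun h1); move: h2; congr (graph T (upi _ _ _, _)); ring.
have fm x : graph T (x, 0) -> tor x.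
  have [t [tj Kt [n Ktn]]] := U_sub hK => /Kt[f ->].
  have tE : t = j.+1.
    apply/eqP; rewrite eqn_leq tj /=; case: ltnP => // h; case: (Kn n).
    have := gsubZ hK ('X_v ^+ (j - t)) Ktn; rewrite -upiZ mulrA -exprD subnK //.
  by rewrite tE upiZ U_Xv //; apply: (sub0 (submod_tor _)).
have hR : graded_submod (fun y => exists x, graph T (x, y)).
  by have [A0 AD AZ] := submod_range T; split=> // x m [y hy]; exists (gpr x y); apply: graphG.
apply: bij_iso => // y.
have [t [tj Rt [n [x Rtn]]]] := U_sub hR.
case: t => [|t] in tj Rt Rtn; last first.
  have [M' [al [h1 _ _]]] := U_pts T.
  have [|f hf] := Rt al; first by exists (upi i j.+1 ('X_w ^+ M')).
  have z : ('X_v : S) ^+ j *: al = 0.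
    rewrite hf -upiZ.
    have -> : 'X_v ^+ j * ('X_v ^+ t.+1 * f) = 'X_v ^+ j.+1 * ('X_v ^+ t * f).
      by rewrite !exprS; ring.
    by rewrite upiZ; apply: U_Xv.
  by case: (Kn M'); have := graphZ ('X_v ^+ j) h1; rewrite -upiZ z.
have [s ->] := upi_surj y; apply: (@U_evt _ _ _ _ n); first exact: submod_range.
by exists (s *: x); rewrite -upiZ mulrC upiZ; apply: graphZ; rewrite expr0 mul1r in Rtn.
Qed.

Lemma U_zero i : zeroH (Uo i 0).
Proof.
rewrite /zeroH -cls0; apply/clsP/coh_eqE => a b b' /= _ _.
suff -> : b - b' = 0 by apply: (sub0 (submod_tor _)).
by rewrite -[LHS]scale1r -(expr0 'X_v) U_Xv.
Qed.

Lemma upi_nonzero i j a b : (a < j)%N -> upi i j ('X_v ^+ a * 'X_w ^+ b) <> 0.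
Proof. by move=> aj /upi_coef/(_ a b aj)/eqP; rewrite cf_mon // !eqxx oner_eq0. Qed.

Lemma U_nonzero i j : ~ zeroH (Uo i j.+1).
Proof.
rewrite /zeroH -cls0 => /clsP/coh_eqE/(_ (upi i j.+1 1) (upi i j.+1 1) 0 erefl erefl).
by rewrite subr0 => /U_tor; have := @upi_nonzero i j.+1 0 0 isT; rewrite !expr0 mulr1.
Qed.

(** If T does not vanish on the socle it is invertible; if it does, 1 - T is the identity there and
    is invertible instead. *)
Lemma local_U i j : localH (Uo i j).
Proof.
case: j => [|j] T.
  by left; exists 0; rewrite hcmp0 h0cmp; split; apply/esym/(zero_to _ (U_zero i)).
have [M /(_ w)[a]] := coh_dom (rep T) (upi i j.+1 ('X_v ^+ j)).
rewrite -upiZ mulrC => Ta; have [a0|a0] := eqVneq a 0; last first.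
  by left; rewrite -[T]repK; apply: (U_iso Ta); apply/eqP.
right; rewrite -[T]repK clsN clsD; apply: (@U_iso i j M _ (upi i j.+1 ('X_v ^+ j * 'X_w ^+ M))).
  by exists (upi i j.+1 ('X_v ^+ j * 'X_w ^+ M)), 0; rewrite addr0; split=> //=; rewrite oppr0 -a0.
exact: upi_nonzero.
Qed.

End Tube.

(** * The almost split sequences of torsion sheaves *)

Section TubeAR.
Variables (k : closedFieldType) (p' q' : nat).
Local Notation S := {mpoly k[2]}.
Local Notation grm := (grmod k p'.+1 q'.+1).
Local Notation L := (L p'.+1 q'.+1).
Local Notation x_ := (xvec p'.+1 q'.+1).
Local Notation O := (@Oline k p'.+1 q'.+1).
Implicit Types (W : grm).
Variables (v w : 'I_2).
Hypothesis vw : v != w.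
Let wv : w != v. Proof. by rewrite eq_sym. Qed.
Local Notation "'X^( a , b )" := (('X_v : S) ^+ a * ('X_w : S) ^+ b).
Local Notation Uo := (@Uo k p' q' v).
Local Notation upi := (@upi k p' q' v).

Section Umap.
Variables (i i' : int) (j j' : nat) (e : S).
Hypothesis he : homogen (x_ v *~ i' - x_ v *~ i) e.
Hypothesis hj : exists g : S, e * 'X_v ^+ j = 'X_v ^+ j' * g.

Definition umap (a : Uo i j) : Uo i' j' := upi i' j' (e * sval (cid (upi_surj a))).

Lemma umapE s : umap (upi i j s) = upi i' j' (e * s).
Proof.
rewrite /umap; case: cid => s' /= /esym/upiP[h hh]; apply/upiP.
by have [g hg] := hj; exists (g * h); rewrite -mulrBr hh [RHS]mulrA -hg mulrA.
Qed.

Lemma umapD a b : umap (a + b) = umap a + umap b.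
Proof.
have [s ->] := upi_surj a; have [s' ->] := upi_surj b.
by rewrite -upiD !umapE -upiD mulrDr.
Qed.

Lemma umapZ (r : S) a : umap (r *: a) = r *: umap a.
Proof. by have [s ->] := upi_surj a; rewrite -upiZ !umapE -upiZ mulrCA. Qed.

Lemma umapG x a : umap (gpr x a) = gpr x (umap a).
Proof.
have [s ->] := upi_surj a; rewrite umapE !gpr_upi umapE; congr upi.
by rewrite -(hcomp_mul _ _ he) addrC addrA subrK.
Qed.

Definition coh_umap : coh_hom (Uo i j) (Uo i' j') := coh_map umapD umapZ umapG.

Lemma graph_umap a b : graph coh_umap (a, b) = (b = umap a).
Proof. by []. Qed.

End Umap.

Lemma hom1 i : homogen (x_ v *~ i - x_ v *~ i : L) (1 : S).
Proof. by rewrite subrr -mpolyC1; apply: homogen_C. Qed.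

Lemma homXv i : homogen (x_ v *~ (i + 1) - x_ v *~ i : L) ('X_v : S).
Proof. by rewrite mulrzDr mulr1z addrAC subrr add0r -[x_ v]mulr1n -['X_v]expr1; apply: homogen_X. Qed.

Lemma hj1 j : exists g : S, 1 * 'X_v ^+ j.+1 = 'X_v ^+ j * g.
Proof. by exists 'X_v; rewrite mul1r exprSr. Qed.
Lemma hjv j : exists g : S, 'X_v * 'X_v ^+ j = 'X_v ^+ j.+1 * g.
Proof. by exists 1; rewrite mulr1 exprS. Qed.

Variables (i : int) (j : nat).

(** The projection onto the quotient by the socle and the embedding as the radical. The length of X
    is j + 1, so j = 0 gives a zero summand. *)
Definition tube_f_fun (a : Uo i j.+1) : dsum (Uo i j) (Uo (i + 1) j.+2) :=
  (umap i j 1 a, umap (i + 1) j.+2 'X_v a).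
Definition tube_g_fun (a : dsum (Uo i j) (Uo (i + 1) j.+2)) : Uo (i + 1) j.+1 :=
  umap (i + 1) j.+1 'X_v a.1 - umap (i + 1) j.+1 1 a.2.

Lemma tube_fE s : tube_f_fun (upi i j.+1 s) = (upi i j s, upi (i + 1) j.+2 ('X_v * s)).
Proof. by rewrite /tube_f_fun (umapE _ _ (hj1 j)) (umapE _ _ (hjv j.+1)) mul1r. Qed.
Lemma tube_gE s s' : tube_g_fun (upi i j s, upi (i + 1) j.+2 s') = upi (i + 1) j.+1 ('X_v * s - s').
Proof. by rewrite /tube_g_fun (umapE _ _ (hjv j)) (umapE _ _ (hj1 j.+1)) mul1r upiD upiN. Qed.

Lemma tube_f_D a b : tube_f_fun (a + b) = tube_f_fun a + tube_f_fun b.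
Proof. by congr pair; [exact: umapD (hj1 j) _ _ | exact: umapD (hjv j.+1) _ _]. Qed.
Lemma tube_f_Z (r : S) a : tube_f_fun (r *: a) = r *: tube_f_fun a.
Proof. by congr pair; [exact: umapZ (hj1 j) _ _ | exact: umapZ (hjv j.+1) _ _]. Qed.
Lemma tube_f_G x a : tube_f_fun (gpr x a) = gpr x (tube_f_fun a).
Proof.
by congr pair; [exact: umapG (hom1 i) (hj1 j) _ _ | exact: umapG (homXv i) (hjv j.+1) _ _].
Qed.
Lemma tube_g_D a b : tube_g_fun (a + b) = tube_g_fun a + tube_g_fun b.
Proof.
rewrite /tube_g_fun (umapD _ (hjv j) a.1 b.1) (umapD _ (hj1 j.+1) a.2 b.2) opprD.
exact: addrACA.
Qed.
Lemma tube_g_Z (r : S) a : tube_g_fun (r *: a) = r *: tube_g_fun a.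
Proof.
by rewrite /tube_g_fun (umapZ _ (hjv j) r a.1) (umapZ _ (hj1 j.+1) r a.2) scalerBr.
Qed.
Lemma tube_g_G x a : tube_g_fun (gpr x a) = gpr x (tube_g_fun a).
Proof.
rewrite /tube_g_fun gprB; congr (_ - _).
  exact: umapG (homXv i) (hjv j) _ _.
exact: umapG (hom1 (i + 1)) (hj1 j.+1) _ _.
Qed.

Definition tube_f : coh_hom (Uo i j.+1) (dsum (Uo i j) (Uo (i + 1) j.+2)) :=
  coh_map tube_f_D tube_f_Z tube_f_G.
Definition tube_g : coh_hom (dsum (Uo i j) (Uo (i + 1) j.+2)) (Uo (i + 1) j.+1) :=
  coh_map tube_g_D tube_g_Z tube_g_G.
Lemma graph_tube_f a b : graph tube_f (a, b) = (b = tube_f_fun a).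
Proof. by []. Qed.
Lemma graph_tube_g a b : graph tube_g (a, b) = (b = tube_g_fun a).
Proof. by []. Qed.

Lemma tube_exact : exact_at tube_f tube_g.
Proof.
split.
- move=> a; rewrite graph_tube_f; have [s ->] := upi_surj a; rewrite tube_fE => h.
  have /upi0P[g] : upi (i + 1) j.+2 ('X_v * s) = 0 by apply: esym (congr1 snd h).
  rewrite exprS -mulrA -['X_v in LHS]expr1 => /(Xpow_inj vw (t := 1)) ->.
  by rewrite upiZ U_Xv //; apply: (sub0 (submod_tor _)).
- move=> a b c; rewrite graph_tube_f graph_tube_g => -> ->.
  have [s ->] := upi_surj a; rewrite tube_fE tube_gE subrr upi0.
  exact: (sub0 (submod_tor _)).
- move=> [a b]; rewrite graph_tube_g; have [s ->] := upi_surj a; have [s' ->] := upi_surj b.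
  rewrite tube_gE => /esym/upi0P[h hh]; apply: evt_base.
  exists (upi i j.+1 (s - 'X_v ^+ j * h)); rewrite graph_tube_f tube_fE.
  have -> : 'X_v * (s - 'X_v ^+ j * h) = s' by rewrite mulrBr mulrA -exprS -hh subKr.
  congr pair; apply/upiP; exists h; by rewrite subKr.
- move=> c; have [s ->] := upi_surj c; apply: evt_base.
  exists (upi i j 0, upi (i + 1) j.+2 (- s)); rewrite graph_tube_g tube_gE.
  by rewrite mulr0 sub0r opprK.
Qed.

(** On the socle, f is (0, X_v^(j+1) X_w^M), a multiple by X_v^(j+1); any map to a sheaf of length j
    + 1 kills that. *)
Lemma tube_not_split : ~ smonoH (cls tube_f).
Proof.
move=> [r hr]; have : cls (coh_comp (rep r) tube_f) = cls (coh_id (Uo i j.+1)) by rewrite cls_comp repK.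
move=> /clsP/coh_eqE h.
have [M /(_ w)[c hc]] := coh_dom (rep r) (0, upi (i + 1) j.+2 1).
have := graphZ ('X_v ^+ j.+1) hc.
rewrite [_ *: c]U_Xv // => hc'.
have := h (upi i j.+1 ('X_v ^+ j * 'X_w ^+ M)) 0 (upi i j.+1 ('X_v ^+ j * 'X_w ^+ M)).
rewrite sub0r => h1; apply: (@upi_nonzero k p' q' v w vw i j.+1 j M (ltnSn j)).
apply: oppr_inj; rewrite oppr0; apply: (U_tor vw); apply: h1 => //.
exists (tube_f_fun (upi i j.+1 ('X_v ^+ j * 'X_w ^+ M))); split; first by [].
move: hc'; congr (graph (rep r) (_, _)); rewrite tube_fE; congr pair.
  by rewrite /= !scaler0; apply/esym/upi0P; exists ('X_w ^+ M).
rewrite /= -(@upiZ k p' q' v (i + 1) j.+2 ('X_w ^+ M) 1) mulr1.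
by rewrite -(@upiZ k p' q' v (i + 1) j.+2 ('X_v ^+ j.+1) ('X_w ^+ M)) mulrA -exprS.
Qed.

Lemma tube_left_almost_split : left_almost_split (cls tube_f).
Proof.
split=> [|W h hN]; first exact: tube_not_split.
have [M [al [hal gal al0]]] := U_pts w (rep h).
(* X_v^j al is the image of the socle. If it becomes divisible by X_v^(j+1), then X_w^K al - X_v s
   and s define maps on the two middle terms, and X_v s cancels after composing with f. *)
have [[K [s0 hs]]|nB] := pselect (exists K s, ('X_w : S) ^+ K *: (('X_v : S) ^+ j *: al) = ('X_v : S) ^+ j.+1 *: s).
  pose s := gpr (x_ w *+ (M + K) - x_ v *~ (i + 1)) s0.
  have {}hs : ('X_w : S) ^+ K *: (('X_v : S) ^+ j *: al) = ('X_v : S) ^+ j.+1 *: s.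
    rewrite /s -gprX -hs.
    have -> : x_ w *+ (M + K) - x_ v *~ (i + 1) + x_ v *+ j.+1 = x_ w *+ M - x_ v *~ i + x_ v *+ j + x_ w *+ K.
      rewrite mulrzDr mulr1z opprD mulrS [_ + (_ - _)]addrA [_ + (x_ v + _)]addrA subrK mulrnDr.
      by rewrite [_ *+ M + _ - _]addrAC [LHS]addrAC.
    by rewrite !gprX gal.
  have gs : gpr (x_ w *+ (M + K) - x_ v *~ (i + 1)) s = s by rewrite gprK eqxx.
  have s0' : ('X_v : S) ^+ j.+2 *: s = 0.
    rewrite exprS -scalerA -hs scalerA scalerA.
    have -> : 'X_v * 'X_w ^+ K * 'X_v ^+ j = 'X_w ^+ K * 'X_v ^+ j.+1 :> S by rewrite exprS; ring.
    by rewrite -scalerA al0 scaler0.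
  have gu : gpr (x_ w *+ (M + K) - x_ v *~ i) (('X_w : S) ^+ K *: al - ('X_v : S) ^+ 1 *: s) =
      ('X_w : S) ^+ K *: al - ('X_v : S) ^+ 1 *: s.
    rewrite gprB !gprX' mulrnDr [_ *+ M + _ - _]addrAC addrK gal; congr (_ - _ *: _).
    rewrite gprK; case: eqP => // -[]; rewrite mulrnDr mulrzDr mulr1z opprD addrA mulr1n //.
    by rewrite [_ *+ M + _ *+ K - _]addrAC.
  have u0 : ('X_v : S) ^+ j *: (('X_w : S) ^+ K *: al - ('X_v : S) ^+ 1 *: s) = 0.
    by rewrite scalerBr !scalerA -exprD addn1 -hs scalerA [_ ^+ j * _]mulrC subrr.
  pose A1 := U_mk vw gu u0; pose A2 := U_mk vw gs s0'.
  exists (cls (coh_add (coh_comp A1 (coh_fst (Uo i j) (Uo (i + 1) j.+2)))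
                       (coh_comp A2 (coh_snd (Uo i j) (Uo (i + 1) j.+2))))).
  rewrite -[h]repK -cls_comp; apply/clsP.
  apply: (@U_eq k p' q' v w vw W i j.+1 _ _ (M + K) (('X_w : S) ^+ K *: al)).
    by have := graphZ ('X_w ^+ K) hal; rewrite -upiZ -exprD addnC.
  exists (tube_f_fun (upi i j.+1 ('X_w ^+ (M + K)))); split; first exact: erefl.
  exists (('X_w : S) ^+ K *: al - ('X_v : S) ^+ 1 *: s), (('X_v : S) *: s); split.
  - by rewrite /= expr1 subrK.
  - exists (upi i j ('X_w ^+ (M + K))); split; first by rewrite tube_fE.
    exact: U_mkE.
  - exists (upi (i + 1) j.+2 ('X_v * 'X_w ^+ (M + K))); split; first by rewrite tube_fE.
    by rewrite upiZ; apply: graphZ; apply: U_mkE.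
exfalso; apply: hN.
pose y := x_ v *~ i.
(* The slope is 0: the exponent of X_v stays j + 1, and the colimit inverts only X_w on W /
   X_v^(j+1) W. *)
pose dg (N : nat) : L := x_ v *+ j.+1 + x_ w *+ N - (y + (x_ v + x_ w)).
have dgH' N : dg N + (y + (x_ v + x_ w)) = x_ v *+ (0 * N + j.+1) + x_ w *+ N by rewrite subrK mul0n.
have dgS N : dg N.+1 = dg N + x_ w *+ 1.
  by rewrite /dg [x_ w *+ N.+1]mulrSr addrA [LHS]addrAC mulr1n.
pose B (N : nat) (m : W) := exists s : W, gpr (dg N) m = ('X_v : S) ^+ j.+1 *: s.
have hB N : ksub (B N).
  split.
  - by exists 0; rewrite gpr0 scaler0.
  - by move=> m n [a h1] [a' h2]; exists (a + a'); rewrite gprD h1 h2 scalerDr.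
  - by move=> c m [a h1]; exists (c%:MP *: a); rewrite gprC h1 !scalerA mulrC.
have thB N m : B N m -> B N.+1 ('X^(0, 1) *: m).
  move=> [a h1]; exists (('X_w : S) *: a).
  by rewrite expr0 mul1r dgS gprX h1 !scalerA expr1 mulrC.
have dgM t : dg (M + t).+1 = x_ w *+ M - y + x_ v *+ j + x_ w *+ t.
  apply/esym/eqP; rewrite (@dgE _ _ _ _ _ _ _ _ dgH' _ _ _ _ 0%N M) ?mul0n ?addnS //.
  by rewrite mulr0n add0r [y + _]addrC subrK.
have thK K m : 'X^(0, 1) ^+ K *: m = ('X_w : S) ^+ K *: m by rewrite expr0 mul1r expr1.
have gXX t : gpr (dg (M + t).+1) (('X_w : S) ^+ t *: (('X_v : S) ^+ j *: al)) = ('X_w : S) ^+ t *: (('X_v : S) ^+ j *: al).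
  by rewrite dgM !gprX gal.
have [|lam [lD lZ lT lB l1]] := @colimit_functional k W 'X^(0, 1) B hB thB M.+1 (('X_v : S) ^+ j *: al).
  by move=> K [s]; rewrite thK addSn gXX => hs; apply: nB; exists K, s.
have lamG N m : lam N m = lam N (gpr (dg N) m).
  apply/eqP; rewrite -subr_eq0; apply/eqP.
  have -> : lam N m - lam N (gpr (dg N) m) = lam N (m - gpr (dg N) m).
    by rewrite lD -scaleN1r -mpolyC1 -mpolyCN lZ mulN1r.
  by apply: lB; exists 0; rewrite scaler0 gprB gprK eqxx subrr.
have lamV0 N m : lam N (('X_v : S) ^+ j.+1 *: m) = 0.
  by apply: lB; exists (gpr (dg N - x_ v *+ j.+1) m); rewrite gprX'.
have lamV N m : lam N (('X_v : S) ^+ (0 * N + j.+1) *: m) = 0 by rewrite mul0n lamV0.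
have hG := dual_rel_graded vw dgH' lD lZ lamG.
have [G0 GD GZ GP] := hG.
pose G : set (W * Uo i j.+1) := [set u | exists f : O y, dual_rel v w 0 j.+1 lam (u.1, f) /\ u.2 = upi i j.+1 f]%classic.
have hG' : @graded_submod _ _ _ (dsum W (Uo i j.+1)) G.
  split.
  - by exists 0; split=> //; rewrite upi0.
  - move=> [a b] [c d] [f [h1 /= h2]] [f' [h3 /= h4]]; exists (f + f'); split; first exact: GD _ _ h1 h3.
    by rewrite /= h2 h4 -upiD.
  - move=> r [a b] [f [h1 /= h2]]; exists (r *: f); split; first exact: GZ r _ h1.
    by rewrite /= h2 -upiZ.
  - move=> u [a b] [f [h1 /= h2]]; exists (gpr u f); split; first exact: GP u _ h1.
    by rewrite -[LHS]/(gpr u b) h2 gpr_upi.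
have sG : submod (fun m => exists b, G (m, b)).
  have [H0 HD HZ HP] := hG'; split.
  - by exists 0.
  - by move=> m m' [f hf] [f' hf']; exists (f + f'); apply: (HD (m, f) (m', f')).
  - by move=> r m [f hf]; exists (r *: f); apply: (HZ r (m, f)).
have dg0 N : dg N = dg 0%N + x_ w *+ N by rewrite /dg mulr0n addr0 addrAC.
have domu u m : gpr u m = m -> exists K, exists b, G (('X_w : S) ^+ K *: m, b).
  move=> um.
  have /choice[bd hbd] c := @xvec_bound1 p'.+1 q'.+1 isT isT w v wv (dg 0%N - (u + x_ v *+ c)).
  (* For each c <= j the degrees match for at most one value of K + e - N, of absolute value below
     [bd c]. This K excludes every e >= N at once. *)
  pose K := (\sum_(c < j.+1) bd c)%N.
  have gK : gpr (u + x_ w *+ K) (('X_w : S) ^+ K *: m) = ('X_w : S) ^+ K *: m by rewrite gprX um.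
  have [|f hf] := dual_rel_dom vw dgH' lZ lT lamV lamG gK; last by exists K, (upi i j.+1 f), f.
  move=> N c e; rewrite mul0n add0n => cj Ne; apply: (lam_homog lZ lamG gK) => hd.
  have cK : (bd c <= K)%N by rewrite /K (bigD1 (Ordinal cj)) //= leq_addr.
  have := hbd c (K%:Z + e%:Z - N%:Z); rewrite mulrzBr mulrzDr -!pmulrn.
  have -> : x_ w *+ K + x_ w *+ e - x_ w *+ N = dg 0%N - (u + x_ v *+ c).
    apply/eqP; rewrite subr_eq addrAC eq_sym subr_eq -dg0 -hd; apply/eqP.
    by rewrite [RHS]addrACA -[LHS]addrA; congr (_ + _); rewrite addrC.
  by move=> /(_ erefl); move: Ne cK; clear; lia.
have hd m : evt (fun m => exists b, G (m, b)) m.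
  apply: (@graded_gpr_all _ _ _ W _ m (submod_evt sG)) => u.
  have [|K [b hb]] := domu u (gpr u m); first by rewrite gprK eqxx.
  exists (maxn K j.+1) => u'; have [->|->] := ord2E vw u'.
    rewrite -(subnK (leq_maxr K j.+1)) addnC exprD -scalerA.
    exists 0; exists 0; split; last by rewrite upi0.
    by move=> N c e /=; rewrite scalerA mulrC -scalerA lamV0 cf0 if_same.
  exact: (submod_exp sG (leq_maxl _ _)) (ex_intro _ b hb).
have hk b : G (0, b) -> tor b.
  move=> [f [/= hf ->]]; suff -> : upi i j.+1 f = 0 by apply: (sub0 (submod_tor _)).
  apply: (proj2 (@upi_coef k p' q' v w vw i j.+1 f)) => a b' aj.
  have := hf b'.+1 (j - a)%N 0%N; rewrite scaler0 mul0n add0n ltnS leq_subr /= subSS subn1 /=.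
  rewrite subKn // => <-.
  by have := lZ b'.+1 0 0; rewrite scaler0 mul0r.
pose r := mkcoh hG' hd hk.
(* The functional is controlled on the socle only, so r h need not be the identity; being nonzero on
   the socle it is invertible by [U_iso], which still splits h. *)
have [t [b hb]] := domu (dg M.+1) (('X_v : S) ^+ j *: al) ltac:(by have := gXX 0%N; rewrite addn0 expr0 scale1r).
have hT : graph (coh_comp r (rep h)) (upi i j.+1 ('X_v ^+ j * 'X_w ^+ (M + t)), b).
  exists (('X_w : S) ^+ t *: (('X_v : S) ^+ j *: al)); split=> //=.
  have := graphZ ('X_w ^+ t) (graphZ ('X_v ^+ j) hal); congr (graph _ (_, _)).
  by rewrite -!upiZ exprD; congr (upi _ _ _); ring.
have b0 : b <> 0.
  have [f [hf /= ->]] := hb; move=> /(@upi_coef k p' q' v w vw i j.+1 f)/(_ j (M + t)%N (ltnSn j)).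
  have := hf (M + t).+1 0%N 0%N; rewrite /= expr0 mul1r expr0 scale1r mul0n add0n subSS subn0 subn1 /=.
  move=> <- h0.
  have := lamTt lT M.+1 t (('X_v : S) ^+ j *: al); rewrite mul0n expr0 mul1r addSn h0 l1.
  by move=> /eqP; rewrite eq_sym oner_eq0.
have [u [u1 u2]] := U_iso vw hT b0.
exists (u ** cls r)%coh; rewrite -hcmpA -u1; congr (_ ** _)%coh.
by rewrite cls_comp repK.
Qed.

End TubeAR.

(** * Representatives and classes *)

Section Bridge.
Variables (k : closedFieldType) (p' q' : nat).
Local Notation grm := (grmod k p'.+1 q'.+1).
Implicit Types (M N P W X Y Z A B : grm).
Local Open Scope coh_scope.

Lemma split_monoE X Y (f : coh_hom X Y) : split_mono f <-> smonoH (cls f).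
Proof.
split=> [[r /clsP]|[r]]; first by rewrite cls_comp => h; exists (cls r).
by rewrite -[r]repK -cls_comp => /clsP h; exists (rep r).
Qed.

Lemma split_epiE X Y (f : coh_hom X Y) : split_epi f <-> sepiH (cls f).
Proof.
split=> [[r /clsP]|[r]]; first by rewrite cls_comp => h; exists (cls r).
by rewrite -[r]repK -cls_comp => /clsP h; exists (rep r).
Qed.

Lemma is_isoE X Y (f : coh_hom X Y) : is_iso f <-> isoH (cls f).
Proof.
split=> [[g [/clsP h1 /clsP h2]]|[g]].
  by exists (cls g); rewrite -!cls_comp.
by rewrite -[g]repK -!cls_comp => -[/clsP h1 /clsP h2]; exists (rep g).
Qed.

Lemma isoE X Y : iso X Y <-> isoO X Y.
Proof.
split=> [[f /is_isoE h]|[f]]; first by exists (cls f).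
by rewrite -[f]repK => /is_isoE h; exists (rep f).
Qed.

Lemma is_zeroE X : is_zero X <-> zeroH X.
Proof. exact: iff_sym (clsP _ _). Qed.

Lemma indecE X : indecomposable X -> indecH X.
Proof.
move=> [h1 h2]; split=> [/is_zeroE//|A B /isoE/h2[]/is_zeroE h]; by [left|right].
Qed.

Lemma irreducibleE X Y (f : coh_hom X Y) : irreducible_morphism f <-> irrH (cls f).
Proof.
split=> -[h1 h2 h3]; split.
- by move/split_monoE.
- by move/split_epiE.
- move=> W h g; rewrite -[h]repK -[g]repK -cls_comp => /clsP/h3[]; last by move/split_epiE; right.
  by move/split_monoE; left.
- by move/split_monoE.
- by move/split_epiE.
- move=> W h g /clsP; rewrite cls_comp => /h3[]; last by move/split_epiE; right.
  by move/split_monoE; left.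
Qed.

Lemma isoO_refl X : isoO X X.
Proof. by exists (hid X), (hid X); rewrite hcmp1. Qed.

Lemma isoO_sym X Y : isoO X Y -> isoO Y X.
Proof. by move=> [f [g [h1 h2]]]; exists g, f. Qed.

Lemma isoH_comp X Y Z (g : Hom Y Z) (f : Hom X Y) : isoH g -> isoH f -> isoH (g ** f).
Proof.
move=> [g' [g1 g2]] [f' [f1 f2]]; exists (f' ** g'); split.
  by rewrite -hcmpA (hcmpA g') g1 h1cmp.
by rewrite -hcmpA (hcmpA f) f2 h1cmp.
Qed.

Definition shortH X Y Z (f : Hom X Y) (g : Hom Y Z) :=
  [/\ g ** f = 0, forall W (a : Hom W X), f ** a = 0 -> a = 0,
    forall W (h : Hom W Y), g ** h = 0 -> exists a : Hom W X, f ** a = h,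
    forall W (a : Hom Z W), a ** g = 0 -> a = 0 &
    forall W (h : Hom Y W), h ** f = 0 -> exists a : Hom Z W, a ** g = h].

Lemma exact_short X Y Z (f : coh_hom X Y) (g : coh_hom Y Z) : exact_at f g -> shortH (cls f) (cls g).
Proof.
move=> fg; split; first exact: exact_zero fg.
- by move=> W a; apply: (exact_mono fg).
- by move=> W a; apply: (ker_lift fg).
- by move=> W a; apply: (exact_epi fg).
- by move=> W a; apply: (coker_lift fg).
Qed.

Lemma subr_inj0 X Y (a b : Hom X Y) : a - b = 0 -> a = b.
Proof. by move/eqP; rewrite subr_eq0 => /eqP. Qed.

Lemma shortHE X Y Z (f : coh_hom X Y) (g : coh_hom Y Z) :
  shortH (cls f) (cls g) -> short_exact f g.
Proof.
move=> [h1 h2 h3 h4 h5]; split; split.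
- by apply/clsP; rewrite cls_comp.
- move=> W h /clsP; rewrite cls_comp => /h3[a]; rewrite -[a]repK -cls_comp => /clsP ha.
  exists (rep a) => // b /clsP hb; apply/clsP/subr_inj0/h2.
  by move/clsP: ha => ha; rewrite hcmpBr -!cls_comp hb ha subrr.
- by apply/clsP; rewrite cls_comp.
- move=> W h /clsP; rewrite cls_comp => /h5[a]; rewrite -[a]repK -cls_comp => /clsP ha.
  exists (rep a) => // b /clsP hb; apply/clsP/subr_inj0/h4.
  by move/clsP: ha => ha; rewrite hcmpBl -!cls_comp hb ha subrr.
Qed.

Definition ARH X Y Z (f : Hom X Y) (g : Hom Y Z) := [/\ shortH f g, left_almost_split f &
  ~ sepiH g /\ forall W (h : Hom W Z), ~ sepiH h -> exists a : Hom W Y, h = g ** a].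

Lemma ARHE X Y Z (f : coh_hom X Y) (g : coh_hom Y Z) : ARH (cls f) (cls g) -> AR_sequence f g.
Proof.
move=> [h1 [h2 h3] [h4 h5]]; split; first exact: shortHE.
- split=> [/split_monoE//|W h nh].
  have [/split_monoE//|a] := h3 _ (cls h); rewrite -[a]repK -cls_comp => /clsP ha.
  by exists (rep a).
- split=> [/split_epiE//|W h nh].
  have [/split_epiE//|a] := h5 _ (cls h); rewrite -[a]repK -cls_comp => /clsP ha.
  by exists (rep a).
Qed.

Lemma ARH_source X X' Y Z (f : Hom X Y) (g : Hom Y Z) (th : Hom X' X) :
  isoH th -> ARH f g -> ARH (f ** th) g.
Proof.
move=> [u [u1 u2]] [[h1 h2 h3 h4 h5] [h6 h7] h8]; split=> //; split=> //.
- by rewrite hcmpA h1 h0cmp.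
- by move=> W a; rewrite -hcmpA => /h2 ha; rewrite -[a]h1cmp -u1 -hcmpA ha hcmp0.
- by move=> W h /h3[a <-]; exists (u ** a); rewrite -hcmpA (hcmpA th) u2 h1cmp.
- move=> W h hf; apply: h5.
  by rewrite -[f]hcmp1 -u2 (hcmpA f) (hcmpA h) hf h0cmp.
- move=> [r hr]; apply: h6; exists (th ** r).
  by rewrite -[LHS]hcmp1 -{1}u2 -!hcmpA (hcmpA f) (hcmpA r) hr h1cmp.
- move=> W h nh; have [|a ha] := h7 _ (h ** u).
    move=> [r hr]; apply: nh; exists (u ** r).
    by rewrite -[LHS]hcmp1 -{1}u1 -!hcmpA (hcmpA h) (hcmpA r) hr h1cmp.
  by exists a; rewrite hcmpA -ha -hcmpA u1 hcmp1.
Qed.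

Lemma ARH_middle X Y Y' Z (f : Hom X Y) (g : Hom Y Z) (s : Hom Y Y') (u : Hom Y' Y) :
  u ** s = hid Y -> s ** u = hid Y' -> ARH f g -> ARH (s ** f) (g ** u).
Proof.
move=> u1 u2 [[h1 h2 h3 h4 h5] [h6 h7] [h8 h9]]; split; split.
- by rewrite -hcmpA (hcmpA u) u1 h1cmp.
- by move=> W a; rewrite -hcmpA => e; apply: h2; rewrite -[LHS]h1cmp -u1 -hcmpA e hcmp0.
- move=> W h; rewrite -hcmpA => /h3[a ha]; exists a.
  by rewrite -hcmpA ha hcmpA u2 h1cmp.
- by move=> W a; rewrite hcmpA => e; apply: h4; rewrite -[LHS]hcmp1 -u1 hcmpA e h0cmp.
- move=> W h; rewrite hcmpA => /h5[a ha]; exists a.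
  by rewrite hcmpA ha -hcmpA u2 hcmp1.
- by move=> [r hr]; apply: h6; exists (r ** s); rewrite -hcmpA.
- move=> W h /h7[a ->]; exists (a ** u).
  by rewrite -hcmpA (hcmpA u) u1 h1cmp.
- by move=> [r hr]; apply: h8; exists (u ** r); rewrite hcmpA.
- move=> W h /h9[a ->]; exists (s ** a).
  by rewrite -hcmpA (hcmpA u) u1 h1cmp.
Qed.

Definition AR_conclusion X A B Z :=
  (forall Y, indecomposable Y ->
    (exists f : coh_hom X Y, irreducible_morphism f) <-> (iso Y A \/ iso Y B)) /\
  exists (f : coh_hom X (dsum A B)) (g : coh_hom (dsum A B) Z), AR_sequence f g.

(** Both orders of the middle terms are provided: moving the starting point shortens the sheaf on
    the inner boundary and lengthens it on the outer one. *)
Lemma AR_conclude X X0 A B Z (f : coh_hom X0 (dsum A B)) (g : coh_hom (dsum A B) Z) :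
  isoO X X0 -> exact_at f g -> left_almost_split (cls f) ->
  localH X0 -> localH A -> localH B -> localH Z ->
  AR_conclusion X A B Z /\ AR_conclusion X B A Z.
Proof.
move=> [th hth] fg fL lX lA lB lZ.
have bp := biprod_dsum A B; have bp' := biprod_dsum B A.
have irr Y : indecomposable Y ->
    (exists f : coh_hom X Y, irreducible_morphism f) <-> (iso Y A \/ iso Y B).
  move=> /indecE hY; split=> [[phi /irreducibleE hphi]|].
    have [u [u1 u2]] := hth.
    have hphi' : irrH (cls phi ** u) by apply: irr_iso_source hphi; exists th.
    by case: (irr_target fL bp lA lB hY hphi') => /isoE; [left|right].
  have comp V (g' : Hom X0 V) : isoO Y V -> irrH g' -> exists f : coh_hom X Y, irreducible_morphism f.
    move=> /isoO_sym[s hs] hg; exists (rep (s ** g' ** th)); apply/irreducibleE; rewrite repK.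
    by apply: irr_iso_source hth _; apply: irr_iso hs hg.
  have nz V : isoO Y V -> ~ zeroH V.
    move=> [s [u [u1 u2]]] z; case: hY => hY _; apply: hY.
    by rewrite /zeroH -u1 (zero_to s z) hcmp0.
  case=> /isoE h; apply: comp (h) _.
    by apply: (irr_component fg fL bp lX lA lZ (nz _ h)).
  by apply: (irr_component fg fL (biprodC bp) lX lB lZ (nz _ h)).
have AR : ARH (cls f) (cls g).
  split; [exact: exact_short | exact: fL | exact: (right_almost_split fg fL lZ)].
split; split=> //.
- exists (rep (cls f ** th)), g; apply: ARHE; rewrite repK; exact: ARH_source.
- move=> Y hY; have := irr Y hY; tauto.
pose s := inlH B A ** sndH A B + inrH B A ** fstH A B.
pose u := inlH A B ** sndH B A + inrH A B ** fstH B A.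
have [a1 a2 a3 a4 a5] := bp; have [b1 b2 b3 b4 b5] := bp'.
have us : u ** s = hid (dsum A B).
  rewrite /u /s hcmpDl !hcmpDr -!hcmpA !(hcmpA (sndH B A)) !(hcmpA (fstH B A)).
  by rewrite b1 b2 b3 b4 !h1cmp !h0cmp !hcmp0 add0r addr0.
have su : s ** u = hid (dsum B A).
  rewrite /u /s hcmpDl !hcmpDr -!hcmpA !(hcmpA (sndH A B)) !(hcmpA (fstH A B)).
  by rewrite a1 a2 a3 a4 !h1cmp !h0cmp !hcmp0 add0r addr0.
exists (rep (s ** cls f ** th)), (rep (cls g ** u)); apply: ARHE; rewrite !repK.
by apply: ARH_source hth _; apply: ARH_middle.
Qed.

End Bridge.

(** * Subobjects compared by their ranges, and invariance under isomorphism *)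

Section Subobjects.
Variables (k : closedFieldType) (p' q' : nat).
Local Notation S := {mpoly k[2]}.
Local Notation grm := (grmod k p'.+1 q'.+1).
Local Notation L := (L p'.+1 q'.+1).
Local Notation O := (@Oline k p'.+1 q'.+1).
Implicit Types (M N W X Y Z A B T : grm).
Local Open Scope coh_scope.

Definition range M N (f : coh_hom M N) (n : N) : Prop := exists m, graph f (m, n).

Lemma graded_range M N (f : coh_hom M N) : graded_submod (range f).
Proof.
have [A0 AD AZ] := submod_range f; split=> // x m [y hy].
by exists (gpr x y); apply: graphG.
Qed.

Lemma graded_kernel M N (f : coh_hom M N) : graded_submod (fun m => graph f (m, 0)).
Proof.
split; first exact: graph00.
- by move=> m n h /(graphD h); rewrite addr0.
- by move=> e m /(graphZ e); rewrite scaler0.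
- by move=> x m /(graphG x); rewrite gpr0.
Qed.

(** Line bundles detect elements: a homogeneous m of degree x in the kernel is the image of 1 under
    a map O(-x) -> M that f annihilates. *)
Lemma mono_kernel M N (f : coh_hom M N) : mono f <-> forall m, graph f (m, 0) -> tor m.
Proof.
split=> [fm m fm0|h W a b /clsP].
  apply: (graded_gpr_all (submod_tor M)) => x.
  have hx : gpr x (gpr x m) = gpr x m by rewrite gprK eqxx.
  have fx := gsub_gpr (graded_kernel f) x fm0.
  move: (gpr x m) hx fx => {fm0}m xm fm0.
  pose phi (s : O (- x)) : M := (s : S) *: m.
  have phiD s s' : phi (s + s') = phi s + phi s' by apply: scalerDl.
  have phiZ (r : S) s : phi (r *: s) = r *: phi s by rewrite /phi scalerA.
  have phiG y s : phi (gpr y s) = gpr y (phi s).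
    by rewrite /phi (gpr_scale_homog _ _ xm) [in RHS]addrC.
  pose g := coh_map phiD phiZ phiG.
  have /coh_eqE/(_ (1 : S) m 0) : coh_eq g (coh_zero _ _).
    apply: fm; apply/coh_eqE => s n n' [a [ga fa]] [b [gb fb]].
    have ea : a = (s : S) *: m := ga; have eb : b = 0 := gb.
    have h1 := graphB fa (graphZ s fm0); rewrite ea subrr scaler0 subr0 in h1.
    rewrite eb in fb; apply: (subB (submod_tor _)); [exact: coh_ker h1|exact: coh_ker fb].
  by rewrite subr0; apply => //; apply: esym (scale1r m).
rewrite !cls_comp => e; apply/clsP/subr_inj0; rewrite clsN clsD; apply: (mono_ann h).
by rewrite -clsD -clsN hcmpBr e subrr.
Qed.

(** The factorisation is u followed by the inverse relation of v. *)
Lemma range_sub_le A B X (u : coh_hom A X) (v : coh_hom B X) : mono v ->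
  (forall x, range u x -> evt (range v) x) -> sub_le u v.
Proof.
move=> /mono_kernel vm uv.
unshelve eexists (@mkcoh k p' q' A B [set w | exists c, graph u (w.1, c) /\ graph v (w.2, c)]%classic _ _ _).
- split.
  + by exists 0; split; apply: graph00.
  + by move=> [a b] [c d] [y /= [? ?]] [z /= [? ?]]; exists (y + z); split; apply: graphD.
  + by move=> e [a b] [y /= [? ?]]; exists (e *: y); split; apply: graphZ.
  + by move=> x [a b] [y /= [? ?]]; exists (gpr x y); split; apply: graphG.
- have sA : submod (fun a => exists b c, graph u (a, c) /\ graph v (b, c)).
    split; first by exists 0, 0; split; apply: graph00.
    + by move=> m m' [n [y [? ?]]] [n' [y' [? ?]]]; exists (n + n'), (y + y'); split; apply: graphD.
    + by move=> e m [n [y [? ?]]]; exists (e *: n), (e *: y); split; apply: graphZ.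
  move=> a; have [t ht] := coh_dom u a; apply: (evt_pow (s := t) sA) => i.
  have [c hc] := ht i; have [|t' ht'] := uv c; first by eexists; exact: hc.
  exists t' => i'; have [b hb] := ht' i'; exists b; eexists; split; last exact: hb.
  exact: graphZ.
- move=> b [c [/coh_ker[t ht] vb]]; apply: (evt_pow (s := t) (submod0 _)) => i; apply: vm.
  by rewrite -(ht i); apply: graphZ.
apply/coh_eqE => a c c' uc [b [[c2 [/= uc2 vc2]] vc']].
have := subD (submod_tor _) (coh_fun uc uc2) (coh_fun vc2 vc').
by rewrite addrA subrK.
Qed.

Lemma sub_le_range A B X (u : coh_hom A X) (v : coh_hom B X) x :
  sub_le u v -> range u x -> evt (range v) x.
Proof.
move=> [w /coh_eqE uw] [a ua]; have sR := submod_range v.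
have [t ht] := coh_dom (coh_comp v w) a; apply: (evt_pow (s := t) sR) => i.
have [c hc] := ht i; have [b [_ vb]] := hc.
have [s hs] := uw _ _ _ (graphZ _ ua) hc.
exists s => j; exists ('X_j ^+ s *: b).
have -> : ('X_j : S) ^+ s *: (('X_i : S) ^+ t *: x) = ('X_j : S) ^+ s *: c.
  by apply/eqP; rewrite -subr_eq0 -scalerBr; apply/eqP.
exact: graphZ.
Qed.

Lemma zero_tor X : is_zero X <-> forall x : X, tor x.
Proof.
split=> [/coh_eqE h x|h]; last by apply/coh_eqE => x y z _ _; apply: h.
by have := h x x 0 erefl erefl; rewrite subr0.
Qed.

Lemma mono_iso X A (u : coh_hom A X) : mono u -> (forall x, evt (range u) x) -> is_iso u.
Proof. by move=> /mono_kernel um ue; apply/is_isoE; apply: bij_iso. Qed.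

Lemma iso_range X A (u : coh_hom A X) x : is_iso u -> evt (range u) x.
Proof.
move=> [g [_ /coh_eq_sym ug]].
have := @sub_le_range X A X (coh_id X) u x; apply; last by exists x.
by exists g.
Qed.

Lemma is_kernelH X Y Z (f : coh_hom X Y) (g : coh_hom Y Z) : is_kernel f g ->
  [/\ cls g ** cls f = 0, forall W (a : Hom W X), cls f ** a = 0 -> a = 0 &
    forall W (h : Hom W Y), cls g ** h = 0 -> exists a : Hom W X, cls f ** a = h].
Proof.
move=> [/clsP h1 h2]; rewrite cls_comp in h1; split=> // W.
- move=> a; rewrite -[a]repK => fa.
  have [|b _ hb] := h2 W (coh_zero W Y); first by apply/clsP; rewrite cls_comp cls0 hcmp0.
  have /clsP -> : coh_eq (rep a) b by apply: hb; apply/clsP; rewrite cls_comp fa.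
  by apply/esym; rewrite -cls0; apply/clsP; apply: hb; apply/clsP; rewrite cls_comp !cls0 hcmp0.
- move=> h; rewrite -[h]repK => gh.
  have [|a /clsP ha _] := h2 W (rep h); first by apply/clsP; rewrite cls_comp gh.
  by exists (cls a); rewrite -cls_comp.
Qed.

Lemma is_cokernelH X Y Z (f : coh_hom X Y) (g : coh_hom Y Z) : is_cokernel f g ->
  [/\ cls g ** cls f = 0, forall W (a : Hom Z W), a ** cls g = 0 -> a = 0 &
    forall W (h : Hom Y W), h ** cls f = 0 -> exists a : Hom Z W, a ** cls g = h].
Proof.
move=> [/clsP h1 h2]; rewrite cls_comp in h1; split=> // W.
- move=> a; rewrite -[a]repK => fa.
  have [|b _ hb] := h2 W (coh_zero Y W); first by apply/clsP; rewrite cls_comp cls0 h0cmp.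
  have /clsP -> : coh_eq (rep a) b by apply: hb; apply/clsP; rewrite cls_comp fa.
  by apply/esym; rewrite -cls0; apply/clsP; apply: hb; apply/clsP; rewrite cls_comp !cls0 h0cmp.
- move=> h; rewrite -[h]repK => gh.
  have [|a /clsP ha _] := h2 W (rep h); first by apply/clsP; rewrite cls_comp gh.
  by exists (cls a); rewrite -cls_comp.
Qed.

Lemma kernel_iso X X' Y Z (f : Hom X Y) (f' : Hom X' Y) (g : Hom Y Z) :
  g ** f = 0 -> (forall W (a : Hom W X), f ** a = 0 -> a = 0) ->
  (forall W (h : Hom W Y), g ** h = 0 -> exists a : Hom W X, f ** a = h) ->
  g ** f' = 0 -> (forall W (a : Hom W X'), f' ** a = 0 -> a = 0) ->
  (forall W (h : Hom W Y), g ** h = 0 -> exists a : Hom W X', f' ** a = h) -> isoO X X'.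
Proof.
move=> h1 h2 h3 h1' h2' h3'; have [a ha] := h3' _ f h1; have [b hb] := h3 _ f' h1'.
exists a, b; split; apply: subr_inj0.
  by apply: h2; rewrite hcmpBr hcmp1 hcmpA hb ha subrr.
by apply: h2'; rewrite hcmpBr hcmp1 hcmpA ha hb subrr.
Qed.

Lemma cokernel_iso X Y Z Z' (f : Hom X Y) (g : Hom Y Z) (g' : Hom Y Z') :
  g ** f = 0 -> (forall W (a : Hom Z W), a ** g = 0 -> a = 0) ->
  (forall W (h : Hom Y W), h ** f = 0 -> exists a : Hom Z W, a ** g = h) ->
  g' ** f = 0 -> (forall W (a : Hom Z' W), a ** g' = 0 -> a = 0) ->
  (forall W (h : Hom Y W), h ** f = 0 -> exists a : Hom Z' W, a ** g' = h) ->
  exists t : Hom Z Z', isoH t.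
Proof.
move=> h1 h2 h3 h1' h2' h3'; have [a ha] := h3 _ g' h1'; have [b hb] := h3' _ g h1.
exists a, b; split; apply: subr_inj0.
  by apply: h2; rewrite hcmpBl h1cmp -hcmpA ha hb subrr.
by apply: h2'; rewrite hcmpBl h1cmp -hcmpA hb ha subrr.
Qed.

Lemma mono_iso_comp A X X' (th : coh_hom X X') (u : coh_hom A X) : is_iso th ->
  mono (coh_comp th u) <-> mono u.
Proof.
move=> /is_isoE[g [g1 _]]; split=> um W a b /clsP h; apply/clsP; move: h.
  rewrite !cls_comp => h; apply/clsP; apply: um; apply/clsP.
  by rewrite !cls_comp -!hcmpA h.
rewrite !cls_comp -!hcmpA => h; apply/clsP; apply: um; apply/clsP.
rewrite !cls_comp; have := congr1 (fun z => g ** z) h.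
by rewrite !(hcmpA g) g1 !h1cmp.
Qed.

Lemma uniserial_iso X X' : isoO X X' -> uniserial X -> uniserial X'.
Proof.
move=> /isoO_sym[th hth] uX A B u v um vm.
have ith : is_iso (rep th) by apply/is_isoE; rewrite repK.
have [g [g1 _]] := hth.
have le C D (a : coh_hom C X') (b : coh_hom D X') :
    sub_le (coh_comp (rep th) a) (coh_comp (rep th) b) -> sub_le a b.
  move=> [w /clsP h]; exists w; apply/clsP; move: h; rewrite !cls_comp repK => h.
  have := congr1 (fun z => g ** z) h.
  by rewrite !hcmpA g1 !h1cmp.
have um' := proj2 (mono_iso_comp u ith) um; have vm' := proj2 (mono_iso_comp v ith) vm.
by case: (uX A B _ _ um' vm') => /le; [left|right].
Qed.

Lemma simple_iso X X' : isoO X X' -> simple X -> simple X'.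
Proof.
move=> XX' [X0 sX]; split.
  move/is_zeroE => z; apply: X0; apply/is_zeroE; have [f [g [h1 _]]] := XX'.
  by rewrite /zeroH -h1 (zero_from g z) h0cmp.
have /isoO_sym[th hth] := XX'.
have ith : is_iso (rep th) by apply/is_isoE; rewrite repK.
move=> A u um; have [|hA|/is_isoE] := sX A (coh_comp (rep th) u); [exact/mono_iso_comp|by left|].
rewrite cls_comp repK; have [g [g1 g2]] := hth => hu; right; apply/is_isoE.
rewrite -[cls u]h1cmp -g1 -hcmpA; apply: isoH_comp hu; by exists th.
Qed.

Lemma length_iso X X' n : isoO X X' -> has_length X n -> has_length X' n.
Proof.
move=> XX'; case: n => [/is_zeroE z|n [A [T [u [c [[uK cC] sT lA]]]]]].
  apply/is_zeroE; have [f [g [_ h1]]] := XX'.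
  by rewrite /zeroH -h1 (zero_to g z) hcmp0.
have [th [g [g1 g2]]] := XX'.
have [k1 k2 k3] := is_kernelH uK; have [_ c2 c3] := is_cokernelH cC.
exists A, T, (rep (th ** cls u)), (rep (cls c ** g)); split=> //.
apply: shortHE; rewrite !repK; split.
- by rewrite -hcmpA (hcmpA g) g1 h1cmp.
- by move=> W a; rewrite -hcmpA => e; apply: k2; rewrite -[LHS]h1cmp -g1 -hcmpA e hcmp0.
- by move=> W h; rewrite -hcmpA => /k3[a ha]; exists a; rewrite -hcmpA ha hcmpA g2 h1cmp.
- by move=> W a; rewrite hcmpA => e; apply: c2; rewrite -[LHS]hcmp1 -g1 hcmpA e h0cmp.
- by move=> W h; rewrite hcmpA => /c3[a ha]; exists a; rewrite hcmpA ha -hcmpA g2 hcmp1.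
Qed.

End Subobjects.

(** * Uniserial sheaves *)

Section TubeObjects.
Variables (k : closedFieldType) (p' q' : nat).
Local Notation S := {mpoly k[2]}.
Local Notation grm := (grmod k p'.+1 q'.+1).
Local Notation L := (L p'.+1 q'.+1).
Local Notation x_ := (xvec p'.+1 q'.+1).
Local Notation O := (@Oline k p'.+1 q'.+1).
Implicit Types (M N W X Y Z A B T : grm).
Variables (v w : 'I_2).
Hypothesis vw : v != w.
Let wv : w != v. Proof. by rewrite eq_sym. Qed.
Local Notation Uo := (@Uo k p' q' v).
Local Notation upi := (@upi k p' q' v).
Local Open Scope coh_scope.

Definition Xdiv i j t (a : Uo i j) : Prop := exists f : S, a = upi i j ('X_v ^+ t * f).

Lemma U_range W i j (u : coh_hom W (Uo i j)) : exists t, [/\ (t <= j)%N,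
  forall a, range u a -> Xdiv t a & forall a, Xdiv t a -> evt (range u) a].
Proof.
have [t [tj ut [M [m hm]]]] := U_sub vw (graded_range u); exists t; split=> // a [f ->].
apply: (U_evt vw (t := M)); first exact: submod_range.
exists (f *: m); rewrite -upiZ.
have -> : 'X_w ^+ M * ('X_v ^+ t * f) = f * ('X_v ^+ t * 'X_w ^+ M) by ring.
by rewrite upiZ; apply: graphZ.
Qed.

Lemma Xdiv0 i j (a : Uo i j) : Xdiv 0 a.
Proof. by have [s ->] := upi_surj a; exists s; rewrite expr0 mul1r. Qed.

Lemma Xdiv_le i j s t (a : Uo i j) : (s <= t)%N -> Xdiv t a -> Xdiv s a.
Proof.
by move=> /subnKC <- [f ->]; exists ('X_v ^+ (t - s) * f); rewrite mulrA -exprD.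
Qed.

Lemma Xdiv_max i j (a : Uo i j) : Xdiv j a -> a = 0.
Proof. by move=> [f ->]; apply/upi0P; exists f. Qed.

Lemma U_uniserial i j : uniserial (Uo i j).
Proof.
move=> A B a b am bm; have [s [_ as1 as2]] := U_range a; have [t [_ bt1 bt2]] := U_range b.
by case/orP: (leq_total s t) => st; [right|left]; apply: range_sub_le => // x;
  [move/bt1/(Xdiv_le st)/as2 | move/as1/(Xdiv_le st)/bt2].
Qed.

Lemma U_simple i : simple (Uo i 1).
Proof.
split; first by move/is_zeroE => /(U_nonzero vw).
move=> A u um; have [[|t] [tj u1 u2]] := U_range u.
  by right; apply: mono_iso => // x; apply/u2/Xdiv0.
left; apply/zero_tor => a; have [s hs] := coh_dom u a.
apply: (evt_pow (s := s) (submod0 _)) => i'; have [b hb] := hs i'.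
have b0 : b = 0 by apply/Xdiv_max/(@Xdiv_le _ _ 1 t.+1) => //; apply: u1; eexists; exact: hb.
by rewrite b0 in hb; apply: (proj1 (mono_kernel u)).
Qed.

Lemma hjp j t : exists g : S, 1 * 'X_v ^+ (t + j) = 'X_v ^+ t * g.
Proof. by exists ('X_v ^+ j); rewrite mul1r exprD. Qed.

Definition U_incl i j : coh_hom (Uo i j) (Uo (i + 1) j.+1) := coh_umap (@homXv k p' q' v i) (hjv k v j).
Definition U_proj i t j : coh_hom (Uo i (t + j)) (Uo i t) := coh_umap (@hom1 k p' q' v i) (hjp j t).

Lemma U_inclE i j s b : graph (U_incl i j) (upi i j s, b) <-> b = upi (i + 1) j.+1 ('X_v * s).
Proof. by rewrite graph_umap (umapE _ _ _ _ (hjv k v j)). Qed.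
Lemma U_projE i t j s b : graph (U_proj i t j) (upi i (t + j) s, b) <-> b = upi i t s.
Proof. by rewrite graph_umap (umapE _ _ _ _ (hjp j t)) mul1r. Qed.

Lemma U_incl_mono i j : mono (U_incl i j).
Proof.
apply/mono_kernel => a; have [s ->] := upi_surj a => /U_inclE/esym/upi0P[g].
rewrite exprS -mulrA -['X_v in LHS]expr1 => /(Xpow_inj vw (t := 1)) ->.
by rewrite upiZ U_Xv //; apply: (sub0 (submod_tor _)).
Qed.

Lemma U_incl_range i j a : range (U_incl i j) a <-> Xdiv 1 a.
Proof.
split=> [[b]|[f ->]]; last by exists (upi i j f); apply/U_inclE.
by have [s ->] := upi_surj b => /U_inclE ->; exists s.
Qed.

Lemma U_proj_exact X i t j (u : coh_hom X (Uo i (t + j))) : mono u ->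
  (forall a, range u a -> Xdiv t a) -> (forall a, Xdiv t a -> evt (range u) a) ->
  exact_at u (U_proj i t j).
Proof.
move=> um u1 u2; split; first exact/mono_kernel.
- move=> x y z xy; have [|f hf] := u1 y; first by eexists; exact: xy.
  rewrite hf => /U_projE ->; rewrite upiZ U_Xv //; exact: (sub0 (submod_tor _)).
- move=> y; have [s ->] := upi_surj y => /U_projE/esym/upi0P[g ->].
  by apply: u2; exists g.
- move=> z; apply: evt_base; have [s ->] := upi_surj z.
  by exists (upi i (t + j) s); apply/U_projE.
Qed.

Lemma U_incl_exact i j : exact_at (U_incl i j) (U_proj (i + 1) 1 j).
Proof.
apply: (@U_proj_exact (Uo i j) (i + 1) 1 j (U_incl i j)); first exact: U_incl_mono.
  by move=> a /U_incl_range.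
by move=> a h; apply: evt_base; apply/U_incl_range.
Qed.

Lemma U_length i j : has_length (Uo i j) j.
Proof.
elim: j i => [|j IH] i; first exact/is_zeroE/U_zero.
rewrite -[i](subrK 1); exists (Uo (i - 1) j), (Uo (i - 1 + 1) 1), (U_incl (i - 1) j), (U_proj (i - 1 + 1) 1 j).
split; [exact/shortHE/exact_short/U_incl_exact | exact: U_simple | exact: IH].
Qed.

Lemma U_incl_not_iso i j : ~ is_iso (U_incl i j).
Proof.
move=> /(iso_range (upi (i + 1) j.+1 1))[t /(_ w)/U_incl_range[f]].
rewrite -upiZ => /upiP[g]; rewrite mulr1 => e.
have := congr1 (fun f => cf v w f 0 t) e.
rewrite cfD cfN -['X_w ^+ t]mul1r -(expr0 'X_v) cf_mon // !cfXv // !eqxx subr0 => /eqP.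
by rewrite oner_eq0.
Qed.

(** A subobject either is everything or lies in X_v U, so X_v U is the only maximal one. *)
Lemma U_radical i j : is_radical (U_incl i j).
Proof.
have iM := @U_incl_mono i j; have nI := @U_incl_not_iso i j.
have le B (b : coh_hom B (Uo (i + 1) j.+1)) : mono b ->
    is_iso b \/ sub_le b (U_incl i j).
  move=> bm; have [[|t] [_ b1 b2]] := U_range b.
    by left; apply: mono_iso => // x; apply/b2/Xdiv0.
  right; apply: range_sub_le => // x /b1/(@Xdiv_le _ _ 1 t.+1 _ isT) h.
  by apply: evt_base; apply/U_incl_range.
split=> //.
- move=> B b [bm bi bmax]; have [//|bl] := le _ _ bm.
  by have [|//] := bmax _ _ iM bl.
- move=> B b bm; apply; split=> // C c cm _.
  by have [|] := le _ _ cm; [right|left].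
Qed.

(** Identifies [Uo i 1] with the simple sheaf at i. *)
Lemma mulX_exact i : exact_at (coh_mulX k p'.+1 q'.+1 v i)
  (coh_quot (Uideal_graded k p' q' v i 1)).
Proof.
split.
- move=> s e; have {}e : 'X_v ^+ 1 * (s : S) = 0 := esym e.
  by rewrite (Xpow_eq0 vw e); apply: (sub0 (submod_tor _)).
- move=> s s' a e; have {}e : s' = 'X_v * (s : S) := e.
  rewrite graph_quot => ->; suff -> : qpi (Uideal_graded k p' q' v i 1) s' = 0.
    exact: (sub0 (submod_tor _)).
  by apply/qpi0P; rewrite e; exists s.
- move=> s; rewrite graph_quot => /esym/qpi0P[g e].
  by apply: evt_base; exists g; apply: e.
- by move=> a; apply: evt_base; have [s ->] := qpi_surj a; exists s.
Qed.

Lemma U_uniserial_at i j : is_uniserial_at v (i + 1) j.+1 (Uo (i + 1) j.+1).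
Proof.
split; [exact: U_uniserial | exact: U_length |].
exists (Uo (i + 1) 1).
  by eexists; apply: (proj2 (shortHE (exact_short (mulX_exact (i + 1))))).
exists (Uo i j), (U_incl i j), (U_proj (i + 1) 1 j); split; first exact: U_radical.
exact: (proj2 (shortHE (exact_short (U_incl_exact i j)))).
Qed.

(** Replaces Jordan-Hoelder: a subobject is X_v^s U with quotient [Uo _ s], simple only for s = 1,
    so every composition series is forced. *)
Lemma U_length_uniq i t n : has_length (Uo i t) n -> t = n.
Proof.
elim: n i t => [|n IH] i t.
  by case: t => // t /is_zeroE/(U_nonzero vw).
rewrite -(subrK 1 i); move: (i - 1) => {}i [A [T [u [c [[uK cC] sT lA]]]]].
have [k1 k2 k3] := is_kernelH uK; have [_ c2 c3] := is_cokernelH cC.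
have um : mono u.
  move=> W a b /clsP; rewrite !cls_comp => e; apply/clsP/subr_inj0/k2.
  by rewrite hcmpBr e subrr.
have [s [st u1 u2]] := U_range u.
(* Writing the length as s + m makes [U_proj] a second cokernel of u, to be compared with c. *)
rewrite -(subnKC st) in u c uK cC k1 k2 k3 c2 c3 um u1 u2 *.
move: (t - s)%N u c uK cC k1 k2 k3 c2 c3 um u1 u2 => m u c uK cC k1 k2 k3 c2 c3 um u1 u2.
have [e1 e2 e3 e4 e5] := exact_short (U_proj_exact um u1 u2).
have [th hth] := cokernel_iso k1 c2 c3 e1 e4 e5.
have [nz sS] : simple (Uo (i + 1) s) by apply: simple_iso sT; exists th.
case: s => [|[|s]] in st u c uK cC k1 k2 k3 c2 c3 um u1 u2 e1 e2 e3 e4 e5 th hth nz sS *.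
- by case: nz; apply/is_zeroE/U_zero.
- have [f1 f2 f3 _ _] := exact_short (U_incl_exact i m).
  rewrite add1n; congr _.+1; apply: (IH i); apply: length_iso lA.
  exact: kernel_iso e1 e2 e3 f1 f2 f3.
- case: (sS _ _ (@U_incl_mono i s.+1)).
    by move/is_zeroE/(U_nonzero vw).
  by move/U_incl_not_iso.
Qed.

Section Classify.
Variables (X : grm) (i : int) (n : nat).
Hypothesis Xu : uniserial X.

(** O(y - x_v) and O(y - x_w) are incomparable subobjects of O(y). This removes the line bundle
    alternative when gamma is peripheral. *)
Lemma line_not_uniserial : ~ line_bundle X.
Proof.
move=> [y /isoE/uniserial_iso/(_ Xu)uO].
have hX (u : 'I_2) : homogen (y - (y - x_ u) : L) ('X_u : S).
  by rewrite subKr -[x_ u]mulr1n -['X_u]expr1; apply: homogen_X.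
have M (u u' : 'I_2) : u != u' -> mono (omul (hX u)).
  move=> uu'; apply/mono_kernel => s; rewrite graph_omul => e.
  rewrite (@Xpow_eq0 _ u u' uu' 1 s); first by apply: (sub0 (submod_tor _)).
  exact: esym e.
have N (u u' : 'I_2) : u != u' -> ~ sub_le (omul (hX u)) (omul (hX u')).
  move=> uu' le; have [|t /(_ u)[s]] := @sub_le_range k p' q' _ _ (O y) (omul (hX u)) (omul (hX u')) ('X_u : S) le.
    by exists (1 : S); rewrite graph_omul mulr1.
  rewrite graph_omul => e; have := congr1 (fun f : S => cf u u' f t.+1 0) e.
  have -> : ('X_u : S) ^+ t *: ('X_u : O y) = 'X_u ^+ t.+1 * 'X_u' ^+ 0 :> S.
    by rewrite expr0 mulr1 exprSr.
  rewrite cf_mon // -['X_u' in RHS]expr1 cfXw // !eqxx => /eqP.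
  by rewrite oner_eq0.
by have [] := uO _ _ _ _ (M _ _ vw) (M _ _ wv); [apply: N|apply: N].
Qed.

Lemma torsion_tor u : torsion_at u X -> exists n, forall x : X, tor (('X_u : S) ^+ n *: x).
Proof.
move=> [n0 h]; exists n0 => x.
have hA : @graded_submod k p'.+1 q'.+1 X (fun m => exists m', m = ('X_u : S) ^+ n0 *: m').
  split.
  - by exists 0; rewrite scaler0.
  - by move=> m m' [a ->] [b ->]; exists (a + b); rewrite scalerDr.
  - by move=> f m [a ->]; exists (f *: a); rewrite !scalerA mulrC.
  - by move=> y m [a ->]; exists (gpr (y - x_ u *+ n0) a); rewrite gprX'.
by apply: (proj1 (fin_dimE (isT : (0 < p'.+1)%N) (isT : (0 < q'.+1)%N) hA) h); exists x.
Qed.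

Lemma uniserial_classify : has_length X n -> torsion_at v X \/ torsion_at w X ->
  (exists2 T, is_simple_at v i T & is_top X T) -> isoO X (Uo i n).
Proof.
move=> lX tX [T [c0 c0T] [A [r [c [[rm _ _] cr]]]]].
have [s1 s2 s3] := is_cokernelH c0T; have [c1 c2 c3] := is_cokernelH cr.
have [e1 _ _ e4 e5] := exact_short (mulX_exact i).
have [th [th' [t1 t2]]] := cokernel_iso s1 s2 s3 e1 e4 e5.
pose C := rep (th ** cls c).
have Cr : cls C ** cls r = 0 by rewrite repK -hcmpA c1 hcmp0.
(* The quotient map by the range of r factors through C, so the kernel of C is no larger than the
   radical. *)
have Cker x : graph C (x, 0) -> evt (range r) x.
  move=> Cx; pose pr := coh_quot (graded_range r).
  have [|a ha] := c3 _ (cls pr).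
    rewrite -cls_comp -cls0; apply/clsP/coh_eq_sub => m b [y [/= ry yb]].
    by rewrite (yb : b = qpi (graded_range r) y); apply/qpi0P; exists m.
  have [d hd] : exists d, d ** cls C = cls pr.
    by exists (a ** th'); rewrite repK -hcmpA (hcmpA th') t1 h1cmp.
  move: hd; rewrite -[d]repK -cls_comp => /clsP/coh_eqE/(_ x 0 (qpi (graded_range r) x)).
  rewrite sub0r => h; have [|//|t ht] := h; first by exists 0; split=> //; apply: graph00.
  exists t => u; apply/(qpi0P (graded_range r)).
  by have := ht u; rewrite scalerN -qpiZ => /eqP; rewrite oppr_eq0 => /eqP.
have Cepi W (a : Hom (Uo i 1) W) : a ** cls C = 0 -> a = 0.
  rewrite repK hcmpA => /c2 e; by rewrite -[a]hcmp1 -t2 hcmpA e h0cmp.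
have [N [xi gxi Cxi]] : exists N : nat, exists2 xi : X,
    gpr (x_ w *+ N - x_ v *~ i) xi = xi & graph C (xi, upi i 1 ('X_w ^+ N)).
  have [[|t] [_ ct1 ct2]] := U_range C; last first.
    case: (@U_nonzero k p' q' v w vw i 0); apply: Cepi; rewrite h1cmp -cls0.
    apply/clsP/coh_eqE => m b b' Cb /= ->; rewrite subr0.
    have [|f ->] := ct1 b; first by exists m.
    rewrite exprS -mulrA upiZ -['X_v]expr1 U_Xv //; exact: (sub0 (submod_tor _)).
  have [N /(_ w)[xi0]] := ct2 _ (Xdiv0 (upi i 1 1)); rewrite -upiZ mulr1 => h.
  exists N, (gpr (x_ w *+ N - x_ v *~ i) xi0); first by rewrite gprK eqxx.
  have := graphG (x_ w *+ N - x_ v *~ i) h.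
  by rewrite gpr_upi [_ + (_ - _)]addrC subrK hcomp_homog //; apply: homogen_X.
have xiw m : ('X_w : S) ^+ m *: xi <> 0.
  move=> e; have := graphZ ('X_w ^+ m) Cxi; rewrite e => /coh_ker/(U_tor vw)/(U_Xw vw).
  by rewrite -['X_w ^+ N]mul1r -(expr0 'X_v); apply: upi_nonzero.
have exT : exists t, `[< exists M : nat, ('X_w : S) ^+ M *: (('X_v : S) ^+ t *: xi) = 0 >].
  (* Support at the other point is impossible: a power of X_w would kill xi, but its image in the
     top survives. So the top decides where X is supported. *)
  case: tX => /torsion_tor[m /(_ xi)[t ht]].
    by exists m; apply/asboolP; exists t; apply: ht.
  by case: (xiw (t + m)%N); rewrite exprD -scalerA.
case: (ex_minnP exT) => t /asboolP[M xiM] tmin.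
pose al := ('X_w : S) ^+ M *: xi.
have gal : gpr (x_ w *+ (N + M) - x_ v *~ i) al = al.
  by rewrite gprX' mulrnDr addrAC addrK gxi.
have eal : ('X_v : S) ^+ t *: al = 0 by rewrite scalerA mulrC -scalerA.
pose phi := U_mk vw gal eal.
have hphi : graph phi (upi i t ('X_w ^+ (N + M)), al) by apply: U_mkE.
(* A kernel of X_v-order s < t would give a smaller exponent than the minimal t. *)
have phim : mono phi.
  apply/mono_kernel => a; have [s [st Ks [M2 Ks2]]] := U_sub vw (graded_kernel phi).
  move/Ks=> [f ->]; have ->: s = t; last first.
    rewrite upiZ U_Xv //; exact: (sub0 (submod_tor _)).
  apply/eqP; rewrite eqn_leq st; apply/tmin/asboolP.
  have h1 := graphZ ('X_w ^+ M2 * 'X_v ^+ s) hphi; rewrite -upiZ in h1.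
  have h2 := graphZ ('X_w ^+ (N + M)) Ks2; rewrite -upiZ scaler0 in h2.
  have [|l /(_ w)] := @coh_fun _ _ _ _ _ phi (upi i t ('X_w ^+ M2 * 'X_v ^+ s * 'X_w ^+ (N + M))) _ 0 h1.
    move: h2; congr (graph phi (upi _ _ _, 0)); ring.
  rewrite subr0 !scalerA => e; exists (l + M2 + M)%N; rewrite -[RHS]e scalerA.
  congr (_ *: _); rewrite !exprD; ring.
have Cal : graph C (al, upi i 1 ('X_w ^+ (N + M))).
  by rewrite addnC exprD upiZ; apply: graphZ.
(* By uniseriality either phi lies in the radical, contradicting that C is nonzero on [al], or it
   contains the radical. *)
have phir x : evt (range r) x -> evt (range phi) x.
  case: (Xu phim rm) => [[z /clsP hz]|le]; last first.
    move=> h; apply: evt_idem; first exact: submod_range.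
    by apply: evt_sub h => y; apply: sub_le_range.
  have /clsP/coh_eqE/(_ (upi i t ('X_w ^+ (N + M))) (upi i 1 ('X_w ^+ (N + M))) 0) :
    cls (coh_comp C phi) = cls (coh_zero _ _).
    by rewrite cls_comp hz cls_comp hcmpA Cr h0cmp cls0.
  rewrite subr0 => h; have /(U_tor vw) : tor (upi i 1 ('X_w ^+ (N + M))).
    by apply: h => //; exists al.
  by rewrite -['X_w ^+ _]mul1r -(expr0 'X_v) => /upi_nonzero h'; case: h'.
(* The range of phi contains the kernel of C and hits a generator of the top. *)
have phie x : evt (range phi) x.
  have sR := submod_range phi; have sE := submod_evt sR.
  have [s hs] := coh_dom C x; apply: (evt_pow (s := s) sR) => u.
  have [b] := hs u; have [s0 ->] := upi_surj b; move: (_ *: x) => y Cy.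
  have yw : evt (range phi) (('X_w : S) ^+ (N + M) *: y).
    rewrite -[_ *: y](subrK (s0 *: al)); apply: (subD sE).
      apply/phir/Cker; have := graphB (graphZ ('X_w ^+ (N + M)) Cy) (graphZ s0 Cal).
      by rewrite -!upiZ mulrC subrr.
    by apply: evt_base; exists (s0 *: upi i t ('X_w ^+ (N + M))); apply: graphZ.
  have yv : evt (range phi) (('X_v : S) ^+ 1 *: y).
    by apply/phir/Cker; have := graphZ ('X_v ^+ 1) Cy; rewrite U_Xv.
  apply: (evt_pow (s := (N + M).+1) sR) => u'; have [->|->] := ord2E vw u'.
    exact: submod_exp sE _ yv.
  exact: submod_exp sE _ yw.
have XU : isoO X (Uo i t).
  by apply/isoO_sym; exists (cls phi); apply/is_isoE; apply: mono_iso.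
by rewrite -(U_length_uniq (length_iso XU lX)).
Qed.

End Classify.

End TubeObjects.

(** * The Auslander--Reiten sequences *)

Theorem proposition3p6 (k : closedFieldType) (R : realType) (p q : nat)
    (hp : (1 <= p)%N) (hpq : (p <= q)%N)
    (X : grmod k p q) (gamma : curve R)
    (hX : indecomposable X)
    (hX' : line_bundle X \/ torsion_at ord0 X \/ torsion_at ord_max X)
    (hgamma : phi gamma X) :
  exists (gamma_s gamma_e : option (curve R)) (gamma_se : curve R)
         (Xs Xe Xse : grmod k p q),
    [/\ s_move p q gamma gamma_s /\ phi_opt gamma_s Xs,
        e_move p q gamma gamma_e /\ phi_opt gamma_e Xe,
        se_move p q gamma gamma_se /\ phi gamma_se Xse,
        forall Y : grmod k p q, indecomposable Y ->
          (exists f : coh_hom X Y, irreducible_morphism f) <->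
          (iso Y Xs \/ iso Y Xe) &
        exists (f : coh_hom X (dsum Xs Xe)) (g : coh_hom (dsum Xs Xe) Xse),
          AR_sequence f g].
Proof.
case: p => [//|p'] in hp hpq X hX hX' hgamma *.
case: q => [//|q'] in hpq X hX hX' hgamma *.
have vw : ord0 != ord_max :> 'I_2 by [].
have wv : ord_max != ord0 :> 'I_2 by [].
have lO (y : L p'.+1 q'.+1) : localH (Oline k y) by apply: local_line vw _.
have lU v w : v != w -> forall i j, localH (Uo k p' q' v i j) by move=> nvw i j; apply: local_U nvw _ _.
have Uat v w : v != w -> forall i j, is_uniserial_at v i j.+1 (Uo k p' q' v i j.+1).
  by move=> nvw i j; have := U_uniserial_at k p' q' nvw (i - 1) j; rewrite subrK.
pose cls := @arc_curve R p'.+1 q'.+1.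
(* Lets the endpoints prescribed by the constructors of [phi] be matched up to integer
   arithmetic. *)
have phi_eq (a b : arc) (Z : grmod k p'.+1 q'.+1) : phi (cls b) Z -> a = b -> phi (cls a) Z.
  by move=> h ->.
have torsion (Y : grmod k p'.+1 q'.+1) : uniserial Y -> line_bundle Y \/ torsion_at ord0 Y \/ torsion_at ord_max Y ->
    torsion_at ord0 Y \/ torsion_at ord_max Y.
  by move=> uY [/(line_not_uniserial vw uY)|].
case: hgamma hX' => {gamma X hX} [i j X /isoE XO _|i [//|j] X _ [Xu Xl XT] /(torsion _ Xu) tX|
    i [//|j] X _ [Xu Xl XT] /(torsion _ Xu)/or_comm tX].
(* With v = x_1 and w = x_2 the middle terms are O(y + x_2) and O(y + x_1), in the order of the
   moves s and e. *)
- move: XO; set y := _ - _ => XO.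
  have [[ir ar] _] := AR_conclude XO (line_exact k vw y) (line_left_almost_split k vw y)
    (lO _) (lO _) (lO _) (lO _).
  exists (Some (cls (Bridging i (j - 1)))), (Some (cls (Bridging (i + 1) j))),
    (cls (Bridging (i + 1) (j - 1))).
  do 3 eexists; split; [| | | exact: ir | exact: ar]; (split; first by exists (Bridging i j)).
  + apply: phi_bridging; apply/isoE.
    have -> : y + xvec p'.+1 q'.+1 ord_max = xvec p'.+1 q'.+1 ord0 *~ i - xvec p'.+1 q'.+1 ord_max *~ (j - 1).
      by rewrite mulrzBr mulr1z opprB addrA addrAC.
    exact: isoO_refl.
  + apply: phi_bridging; apply/isoE.
    have -> : y + xvec p'.+1 q'.+1 ord0 = xvec p'.+1 q'.+1 ord0 *~ (i + 1) - xvec p'.+1 q'.+1 ord_max *~ j.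
      by rewrite mulrzDr mulr1z addrAC.
    exact: isoO_refl.
  + apply: phi_bridging; apply/isoE.
    have -> : y + xvec p'.+1 q'.+1 ord0 + xvec p'.+1 q'.+1 ord_max =
        xvec p'.+1 q'.+1 ord0 *~ (i + 1) - xvec p'.+1 q'.+1 ord_max *~ (j - 1).
      by rewrite mulrzDr mulrzBr !mulr1z opprB addrA addrAC [y + _]addrAC.
    exact: isoO_refl.
- have XU := uniserial_classify vw Xu Xl tX XT.
  have [[ir ar] _] := AR_conclude XU (tube_exact k p' q' vw i j) (tube_left_almost_split k p' q' vw i j)
    (lU _ _ vw _ _) (lU _ _ vw _ _) (lU _ _ vw _ _) (lU _ _ vw _ _).
  (* From here j is the length minus one; for j = 0 the move is undefined and the matching middle
     term [Uo _ i 0] is zero. *)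
  exists (if j is 0%N then None else Some (cls (PeriphIn (i - j%:Z - 1) i))),
    (Some (cls (PeriphIn (i - j.+1%:Z - 1) (i + 1)))),
    (cls (PeriphIn (i - j.+1%:Z - 1 + 1) (i + 1))).
  have wf : wf_arc (PeriphIn (i - j.+1%:Z - 1) i) by rewrite /=; lia.
  do 3 eexists; split; [| | | exact: ir | exact: ar].
  + split; last first.
      case: j {Xl XU wf ir ar} => [|j]; first exact/is_zeroE/U_zero.
      exact: (phi_inner R (ltn0Sn _) (Uat _ _ vw i j)).
    exists (PeriphIn (i - j.+1%:Z - 1) i); split=> //=.
    case: j {Xl XU wf ir ar} => [|j]; first by case: ifP => //; lia.
    case: ifP => [_|]; last by lia.
    by congr (Some (cls (PeriphIn _ _))); lia.
  + split; first by exists (PeriphIn (i - j.+1%:Z - 1) i).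
    apply: phi_eq (phi_inner R (ltn0Sn _) (Uat _ _ vw (i + 1) j.+1)) _ => //; congr PeriphIn; lia.
  + split; first by exists (PeriphIn (i - j.+1%:Z - 1) i).
    apply: phi_eq (phi_inner R (ltn0Sn _) (Uat _ _ vw (i + 1) j)) _ => //; congr PeriphIn; lia.
- have XU := uniserial_classify wv Xu Xl tX XT.
  (* On the outer boundary the move s gives the longer middle term, hence the reversed order. *)
  have [_ [ir ar]] := AR_conclude XU (tube_exact k p' q' wv i j) (tube_left_almost_split k p' q' wv i j)
    (lU _ _ wv _ _) (lU _ _ wv _ _) (lU _ _ wv _ _) (lU _ _ wv _ _).
  exists (Some (cls (PeriphOut (- i - 1) (j.+1%:Z - i + 1)))),
    (if j is 0%N then None else Some (cls (PeriphOut (- i) (j%:Z - i + 1)))),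
    (cls (PeriphOut (- i - 1) (j.+1%:Z - i + 1 - 1))).
  have wf : wf_arc (PeriphOut (- i) (j.+1%:Z - i + 1)) by rewrite /=; lia.
  do 3 eexists; split; [| | | exact: ir | exact: ar].
  + split; first by exists (PeriphOut (- i) (j.+1%:Z - i + 1)).
    apply: phi_eq (phi_outer R (ltn0Sn _) (Uat _ _ wv (i + 1) j.+1)) _ => //; congr PeriphOut; lia.
  + split; last first.
      case: j {Xl XU wf ir ar} => [|j]; first exact/is_zeroE/U_zero.
      exact: (phi_outer R (ltn0Sn _) (Uat _ _ wv i j)).
    exists (PeriphOut (- i) (j.+1%:Z - i + 1)); split=> //=.
    case: j {Xl XU wf ir ar} => [|j]; first by case: ifP => //; lia.
    case: ifP => [_|]; last by lia.
    by congr (Some (cls (PeriphOut _ _))); lia.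
  + split; first by exists (PeriphOut (- i) (j.+1%:Z - i + 1)).
    apply: phi_eq (phi_outer R (ltn0Sn _) (Uat _ _ wv (i + 1) j)) _ => //; congr PeriphOut; lia.
Qed.
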